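(* Let $G$ be an aperiodic Borel graph of finite maximum degree $\Delta$. Then for every integer $k \geq \Delta+1$, $G$ has a Borel-equitable $k$-coloring.
   Context: A Borel graph is a simple undirected graph $G$ whose vertex set $V(G)$ is a standard Borel space and whose edge set is a Borel subset of $V(G)\times V(G)$. $G$ is aperiodic if every connected component of $G$ is infinite. A $k$-coloring is a map $f\colon V(G)\to \mathcal{C}$ with $|\mathcal{C}|=k$; it is proper if adjacent vertices get different colors, and Borel if every color class $f^{-1}(\alpha)$ is Borel. For Borel sets $A,B\subseteq V(G)$, write $A\approx_G B$ ($G$-equidecomposable) if there is a Borel bijection $\phi\colon A\to B$ such that for every $x\in A$, $\phi(x)$ and $x$ lie in the same connected component of $G$. A Borel-equitable $k$-coloring is a Borel proper $k$-coloring $f$ such that $f^{-1}(\alpha)\approx_G f^{-1}(\beta)$ for all colors $\alpha,\beta$. *)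

(* Defs.v *)
From Stdlib Require Import Reals List Relations.
Open Scope R_scope.

Definition is_metric {X : Type} (d : X -> X -> R) : Prop :=
  (forall x y, 0 <= d x y) /\
  (forall x y, d x y = 0 <-> x = y) /\
  (forall x y, d x y = d y x) /\
  (forall x y z, d x z <= d x y + d y z).

Definition metric_open {X : Type} (d : X -> X -> R) (U : X -> Prop) : Prop :=
  forall x, U x -> exists e, 0 < e /\ forall y, d x y < e -> U y.

Definition metric_complete {X : Type} (d : X -> X -> R) : Prop :=
  forall u : nat -> X,
    (forall e, 0 < e -> exists N, forall m n, (N <= m)%nat -> (N <= n)%nat -> d (u m) (u n) < e) ->
    exists l, forall e, 0 < e -> exists N, forall n, (N <= n)%nat -> d (u n) l < e.

(* countable dense subset (possibly empty, if X is empty) *)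
Definition metric_separable {X : Type} (d : X -> X -> R) : Prop :=
  exists s : nat -> option X,
    forall x e, 0 < e -> exists n y, s n = Some y /\ d x y < e.

Definition polish_metric {X : Type} (d : X -> X -> R) : Prop :=
  is_metric d /\ metric_complete d /\ metric_separable d.

Definition is_sigma_algebra {X : Type} (S : (X -> Prop) -> Prop) : Prop :=
  S (fun _ => True) /\
  (forall A, S A -> S (fun x => ~ A x)) /\
  (forall F : nat -> X -> Prop, (forall n, S (F n)) -> S (fun x => exists n, F n x)).

Definition generated_sigma {X : Type} (G : (X -> Prop) -> Prop) (A : X -> Prop) : Prop :=
  forall S, is_sigma_algebra S -> (forall B, G B -> S B) -> S A.

Definition metric_borel {X : Type} (d : X -> X -> R) : (X -> Prop) -> Prop :=
  generated_sigma (metric_open d).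

Definition standard_borel {X : Type} (S : (X -> Prop) -> Prop) : Prop :=
  exists d, polish_metric d /\ forall A, S A <-> metric_borel d A.

Definition product_sigma {X : Type} (S : (X -> Prop) -> Prop) : (X * X -> Prop) -> Prop :=
  generated_sigma (fun E => exists A B, S A /\ S B /\
                        forall p, E p <-> (A (fst p) /\ B (snd p))).

Definition borel_graph {X : Type} (S : (X -> Prop) -> Prop) (adj : X -> X -> Prop) : Prop :=
  standard_borel S /\
  (forall x y, adj x y -> adj y x) /\
  (forall x, ~ adj x x) /\
  product_sigma S (fun p => adj (fst p) (snd p)).

Definition connected {X : Type} (adj : X -> X -> Prop) : X -> X -> Prop :=
  clos_refl_trans X adj.

Definition aperiodic {X : Type} (adj : X -> X -> Prop) : Prop :=
  forall x (l : list X), exists y, connected adj x y /\ ~ In y l.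

Definition degree_le {X : Type} (adj : X -> X -> Prop) (D : nat) : Prop :=
  forall x (l : list X), NoDup l -> (forall y, In y l -> adj x y) -> (length l <= D)%nat.

Definition borel_proper_coloring {X : Type} (S : (X -> Prop) -> Prop)
    (adj : X -> X -> Prop) (k : nat) (f : X -> nat) : Prop :=
  (forall x, (f x < k)%nat) /\
  (forall x y, adj x y -> f x <> f y) /\
  (forall a, S (fun x => f x = a)).

Definition equidecomposable {X : Type} (S : (X -> Prop) -> Prop)
    (adj : X -> X -> Prop) (A B : X -> Prop) : Prop :=
  exists phi : X -> X,
    (forall x, A x -> B (phi x)) /\
    (forall x y, A x -> A y -> phi x = phi y -> x = y) /\
    (forall y, B y -> exists x, A x /\ phi x = y) /\
    (forall C, S C -> S (fun x => A x /\ C (phi x))) /\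
    (forall x, A x -> connected adj x (phi x)).

Definition borel_equitable_coloring {X : Type} (S : (X -> Prop) -> Prop)
    (adj : X -> X -> Prop) (k : nat) (f : X -> nat) : Prop :=
  borel_proper_coloring S adj k f /\
  forall a b, (a < k)%nat -> (b < k)%nat ->
    equidecomposable S adj (fun x => f x = a) (fun x => f x = b).

(* Main.v *)
(* Call an invariant Borel set compressible if infinitely many disjoint copies of it embed, along the
   components, into the space. Off a compressible set there is a component-wise density: [m A x] is the
   limiting proportion of copies of a small set that can be packed into [A] on the component of [x]; it is
   additive and monotone under injections along components, so that classes of equal density are
   equidecomposable, again off a compressible set.

   To equalize the densities of the color classes, take a set [B] of colors whose classes are all denser than
   the classes outside [B]. The counting argument of Kierstead and Kostochka for the Hajnal-Szemeredi
   theorem, with counting replaced by mass transport, finds a vertex [z] such that recoloring [z] and some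
   of its neighbours moves weight out of [B]. Many such moves are performed simultaneously, but few enough
   that a weighted potential of the densities drops by a multiple of the amount of change. Hence the
   changes are summable, and by Borel-Cantelli the colorings converge off a compressible set; the limit has
   no moves left, so its class densities agree.

   On the compressible part, any coloring works whose classes meet all balls of some fixed radius:
   the whole part then embeds into each class, and Schroeder-Bernstein applies.

   All of this needs the neighbourhood of a Borel set to be Borel, a case of the Lusin-Novikov theorem
   obtained by separating more than [Delta] analytic sets at a time. *)

Require Import Defs.
From Stdlib Require Import ZArith Reals List Relations Lra Lia Cantor.
From Stdlib Require Import ClassicalEpsilon FunctionalExtensionality PropExtensionality.
From Stdlib Require Import ssreflect.
Import ListNotations.
Open Scope general_if_scope.
Set Bullet Behavior "None".

Arguments Cantor.to_nat : simpl never.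
Arguments Cantor.of_nat : simpl never.

(* No invariant measure need exist, so counting over color classes has nothing to be averaged
   against. The density [m] replaces all invariant measures at once; it is calibrated by repeatedly
   halving the space, which works because the components are infinite, and its laws hold off
   compressible sets only. What keeps the construction Borel is one finite labelling [kap] that
   distinguishes distinct points at distance at most 3. It turns adjacency into finitely many Borel
   functions and components into orbits of a countable group, codes a recoloring of a ball by a word
   over the labels, and lets all moves with centers of one label be made together, since their balls
   neither meet nor touch. Edge counts become inequalities of densities after splitting the edges by
   the labels of their ends. Moves for different sets [B] are interleaved, so the potential must
   fall under all of them; hence it involves the [j] largest densities for every [j]. The count has
   two cases: if [B] has nearly half of the colors or more, a single color outside [B] gives the
   contradiction; otherwise all outside colors are used, with weights depending on degrees. *)
Existing Class is_sigma_algebra.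

Lemma pred_ext {A : Type} (P Q : A -> Prop) : (forall x, P x <-> Q x) -> P = Q.
Proof. move=> H; extensionality x; apply: propositional_extensionality; exact: H. Qed.

Lemma contra_not {P Q : Prop} : (Q -> P) -> ~ P -> ~ Q.
Proof. by move=> h np /h. Qed.

(** * Closure properties of sigma-algebras and countable-valued Borel functions *)

Section Sigma.
Context {X : Type} {S : (X -> Prop) -> Prop} `{SA : is_sigma_algebra X S}.

Lemma S_ext (A B : X -> Prop) : (forall x, A x <-> B x) -> S A -> S B.
Proof. by move=> /pred_ext ->. Qed.

Lemma S_not (A : X -> Prop) : S A -> S (fun x => ~ A x).
Proof. by case: SA => _ [H _]; apply: H. Qed.

Lemma S_ex (F : nat -> X -> Prop) : (forall n, S (F n)) -> S (fun x => exists n, F n x).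
Proof. by case: SA => _ [_ H]; apply: H. Qed.

Lemma S_all (F : nat -> X -> Prop) : (forall n, S (F n)) -> S (fun x => forall n, F n x).
Proof.
move=> H; apply: (S_ext (fun x => ~ exists n, ~ F n x)).
  by move=> x; split => [h n | h [n]]; [apply: NNPP => h'; apply: h; exists n | move=> h'; apply: h'].
by apply: S_not; apply: S_ex => n; apply: S_not.
Qed.

Lemma S_cst (P : Prop) : S (fun _ => P).
Proof.
case: SA => HT _; case: (classic P) => p.
  by apply: (S_ext (fun _ => True)) HT.
by apply: (S_ext (fun _ => ~ True)) => [x|]; [tauto | apply: S_not].
Qed.

Lemma S_or (A B : X -> Prop) : S A -> S B -> S (fun x => A x \/ B x).
Proof.
move=> HA HB; apply: (S_ext (fun x => exists n, (match n with 0 => A | _ => B end) x)).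
  move=> x; split; first by case=> [[|n]] h; [left | right].
  by case=> h; [exists 0%nat | exists 1%nat].
by apply: S_ex => -[|n].
Qed.

Lemma S_and (A B : X -> Prop) : S A -> S B -> S (fun x => A x /\ B x).
Proof.
move=> HA HB; apply: (S_ext (fun x => ~ (~ A x \/ ~ B x))); first by move=> x; tauto.
by apply: S_not; apply: S_or; apply: S_not.
Qed.

Lemma S_imp (A B : X -> Prop) : S A -> S B -> S (fun x => A x -> B x).
Proof.
move=> HA HB; apply: (S_ext (fun x => ~ A x \/ B x)); first by move=> x; tauto.
by apply: S_or => //; apply: S_not.
Qed.

Lemma S_iff (A B : X -> Prop) : S A -> S B -> S (fun x => A x <-> B x).
Proof. by move=> HA HB; apply: S_and; apply: S_imp. Qed.

End Sigma.

Definition meas {X Y : Type} (S : (X -> Prop) -> Prop) (T : (Y -> Prop) -> Prop) (f : X -> Y) : Prop :=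
  forall A, T A -> S (fun x => A (f x)).

Definition measn {X : Type} (S : (X -> Prop) -> Prop) (h : X -> nat) : Prop :=
  forall n, S (fun x => h x = n).

Ltac bor_step :=
  first
    [ assumption
    | apply: S_cst
    | lazymatch goal with
      | |- _ (fun x => @?A x /\ @?B x) => apply: S_and
      | |- _ (fun x => @?A x \/ @?B x) => apply: S_or
      | |- _ (fun x => ~ @?A x) => apply: S_not
      | |- _ (fun x => @?A x <-> @?B x) => apply: S_iff
      | |- _ (fun x => exists n : nat, @?F x n) => apply: S_ex => ?
      | |- _ (fun x => forall n : nat, @?F x n) => apply: S_all => ?
      | |- _ (fun x => @?A x -> @?B x) => apply: S_imp
      end ].
Ltac bor := repeat bor_step.

Section Measn.
Context {X : Type} {S : (X -> Prop) -> Prop} `{SA : is_sigma_algebra X S}.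

(** A countable-valued Borel function may be substituted into a Borel condition: split according to
    its value. *)
Lemma measn_pre (h : X -> nat) (P : X -> nat -> Prop) :
  measn S h -> (forall n, S (fun x => P x n)) -> S (fun x => P x (h x)).
Proof.
move=> Hh HP; apply: (S_ext (fun x => exists n, h x = n /\ P x n)).
  by move=> x; split => [[n [<-]]//|]; exists (h x).
by bor; apply: HP || apply: Hh.
Qed.

Lemma measn_cst n : measn S (fun _ => n).
Proof. by move=> m; apply: S_cst. Qed.

Lemma measn_op2 (op : nat -> nat -> nat) (h1 h2 : X -> nat) :
  measn S h1 -> measn S h2 -> measn S (fun x => op (h1 x) (h2 x)).
Proof.
move=> H1 H2 n; apply: (measn_pre h1 (fun x a => op a (h2 x) = n)) => // a.
by apply: (measn_pre h2 (fun x b => op a b = n)) => // b; apply: S_cst.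
Qed.

Lemma measn_rel2 (R : nat -> nat -> Prop) (h1 h2 : X -> nat) :
  measn S h1 -> measn S h2 -> S (fun x => R (h1 x) (h2 x)).
Proof.
move=> H1 H2; apply: (measn_pre h1 (fun x a => R a (h2 x))) => // a.
by apply: (measn_pre h2 (fun x b => R a b)) => // b; apply: S_cst.
Qed.

Lemma measn_sub (h : X -> nat) (P : nat -> Prop) : measn S h -> S (fun x => P (h x)).
Proof. by move=> H; apply: (measn_pre h (fun _ => P)) => // n; apply: S_cst. Qed.

End Measn.

Definition dec (P : Prop) : {P} + {~ P} := excluded_middle_informative P.

(** Total by Hilbert's epsilon; on the empty predicate it is an unspecified constant, a case that
    [measn_least] treats separately. *)
Definition least (P : nat -> Prop) : nat :=
  epsilon (inhabits 0%nat) (fun n => P n /\ forall m, (m < n)%nat -> ~ P m).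

Lemma leastP (P : nat -> Prop) : (exists n, P n) -> P (least P) /\ forall m, (m < least P)%nat -> ~ P m.
Proof.
move=> H; apply: (epsilon_spec (inhabits 0%nat) (fun n => P n /\ forall m, (m < n)%nat -> ~ P m)).
case: H => n; elim/(well_founded_induction lt_wf): n => n IH Pn.
case: (classic (exists m, (m < n)%nat /\ P m)) => [[m [lt Pm]]|H]; first exact: (IH m).
by exists n; split => // m lt Pm; apply: H; exists m.
Qed.

Lemma least_le (P : nat -> Prop) n : P n -> (least P <= n)%nat.
Proof.
move=> Pn; case: (le_lt_dec (least P) n) => // lt.
by case: (leastP P) => [|_ /(_ n lt)]; [exists n|].
Qed.

Lemma least_eq (P : nat -> Prop) n : P n -> (forall m, (m < n)%nat -> ~ P m) -> least P = n.
Proof.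
move=> Pn H; have := least_le P n Pn; have [|Pl _] := leastP P; first by exists n.
by case: (le_lt_dec n (least P)) => [|/H//]; lia.
Qed.

Lemma least_iff (P : nat -> Prop) n : (exists m, P m) ->
  least P = n <-> (P n /\ forall m, (m < n)%nat -> ~ P m).
Proof. by move=> /leastP H; split => [<-//|[]]; apply: least_eq. Qed.

Lemma least_ext (P Q : nat -> Prop) : (forall n, P n <-> Q n) -> least P = least Q.
Proof. by move=> /pred_ext ->. Qed.

Lemma measn_least {X : Type} {S : (X -> Prop) -> Prop} `{SA : is_sigma_algebra X S}
    (P : nat -> X -> Prop) :
  (forall n, S (P n)) -> measn S (fun x => least (fun n => P n x)).
Proof.
move=> HP n; set z := least (fun _ => False).
apply: (S_ext (fun x => ((exists m, P m x) /\ P n x /\ (forall m, (m < n)%nat -> ~ P m x)) \/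
                        (~ (exists m, P m x) /\ z = n))).
  move=> x; case: (classic (exists m, P m x)) => H.
    by rewrite least_iff //; tauto.
  have -> : least (fun n => P n x) = z.
    by apply: least_ext => m; split => // h; case: H; exists m.
  by tauto.
by bor; apply: HP.
Qed.

Fixpoint declist (l m : nat) : list nat :=
  match l with
  | 0 => []
  | S l => let (a, b) := of_nat m in a :: declist l b
  end.

(** An enumeration of all finite words, with repetitions: a quantifier over words becomes one over
    numbers, hence a countable union or intersection. *)
Definition word (n : nat) : list nat := let (l, m) := of_nat n in declist l m.

Lemma word_surj (w : list nat) : exists n, word n = w.
Proof.
have [m Hm] : exists m, declist (length w) m = w.
  elim: w => [|a w [m IH]] /=; first by exists 0%nat.
  by exists (to_nat (a, m)); rewrite cancel_of_to IH.
by exists (to_nat (length w, m)); rewrite /word cancel_of_to.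
Qed.

Lemma S_exw {X : Type} {S : (X -> Prop) -> Prop} `{SA : is_sigma_algebra X S}
    (F : list nat -> X -> Prop) : (forall w, S (F w)) -> S (fun x => exists w, F w x).
Proof.
move=> H; apply: (S_ext (fun x => exists n, F (word n) x)); last by bor; apply: H.
move=> x; split => [[n h]|[w h]]; first by exists (word n).
by have [n E] := word_surj w; exists n; rewrite E.
Qed.

Lemma S_allw {X : Type} {S : (X -> Prop) -> Prop} `{SA : is_sigma_algebra X S}
    (F : list nat -> X -> Prop) : (forall w, S (F w)) -> S (fun x => forall w, F w x).
Proof.
move=> H; apply: (S_ext (fun x => forall n, F (word n) x)); last by bor; apply: H.
move=> x; split => [h w|h n //].
by have [n <-] := word_surj w.
Qed.

Lemma choose {A B : Type} (R : A -> B -> Prop) :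
  (forall x, exists y, R x y) -> exists f, forall x, R x (f x).
Proof.
move=> H; exists (fun x => proj1_sig (constructive_indefinite_description _ (H x))) => x.
exact: (proj2_sig (constructive_indefinite_description _ (H x))).
Qed.

Definition eps (n : nat) : R := (/ 2) ^ n.

Lemma eps_pos n : 0 < eps n.
Proof. by apply: pow_lt; lra. Qed.

Lemma eps_S n : eps n = 2 * eps (S n).
Proof. by rewrite /eps /=; lra. Qed.

Lemma eps_mono m n : (m <= n)%nat -> eps n <= eps m.
Proof.
by elim => [|k _ IH]; [lra | have := eps_S k; have := eps_pos (S k); lra].
Qed.

Lemma eps_small e : 0 < e -> exists n, eps n < e.
Proof.
move=> He; case: (pow_lt_1_zero (/ 2) _ e He) => [|n H]; first by rewrite Rabs_pos_eq; lra.
by exists n; have := H n (le_n n); rewrite Rabs_pos_eq //; apply: Rlt_le; apply: eps_pos.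
Qed.

Lemma Bo_sigma {X : Type} (d : X -> X -> R) (Bo : (X -> Prop) -> Prop) :
  (forall A, Bo A <-> metric_borel d A) -> is_sigma_algebra Bo.
Proof.
move=> HB; split; [|split].
- by apply/HB => C [].
- move=> A /HB HA; apply/HB => C HC HO; case: (HC) => _ [H _]; apply: H; exact: HA.
- move=> F HF; apply/HB => C HC HO; case: (HC) => _ [_ H]; apply: H => n.
  by move/HB: (HF n); apply.
Qed.

(** A duplicate-free list in [Q] either exhausts [Q] or can be prolonged, and prolonging stops by
    length [D]. *)
Lemma bounded_finite {A : Type} (Q : A -> Prop) (D : nat) :
  (forall l, NoDup l -> (forall a, In a l -> Q a) -> (length l <= D)%nat) ->
  exists l, NoDup l /\ (forall a, Q a <-> In a l) /\ (length l <= D)%nat.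
Proof.
move=> H.
have step n : (exists l, NoDup l /\ forall a, Q a <-> In a l) \/
              (exists l, NoDup l /\ (forall a, In a l -> Q a) /\ length l = n).
  elim: n => [|n [IH|[l [h1 [h2 h3]]]]]; [right | by left |].
    by exists []; split; [apply: NoDup_nil | split].
  case: (classic (exists a, Q a /\ ~ In a l)) => [[a [Qa na]]|h].
    right; exists (a :: l); split; first by apply: NoDup_cons.
    by split => [b [<-//|/h2]|] //=; rewrite h3.
  left; exists l; split => // a; split; last exact: h2.
  by move=> Qa; apply: NNPP => na; apply: h; exists a.
case: (step (S D)) => [[l [h1 h2]]|[l [h1 [h2 h3]]]]; last by have := H l h1 h2; lia.
by exists l; do 2!split => //; apply: H => // a /h2.
Qed.

Lemma max_nat (Q : nat -> Prop) (D c : nat) : Q c -> (forall c, Q c -> (c <= D)%nat) ->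
  exists c, Q c /\ forall c', Q c' -> (c' <= c)%nat.
Proof.
move=> Qc HD.
case: (leastP (fun n => exists c, Q c /\ (D - c = n)%nat)); first by exists (D - c)%nat, c.
case=> c' [Qc' E] Hmin; exists c'; split => // b Qb.
case: (le_lt_dec b c') => // lt; case: (Hmin (D - b)%nat); last by exists b.
by have := HD b Qb; lia.
Qed.

Lemma S_allww {X : Type} {S : (X -> Prop) -> Prop} `{SA : is_sigma_algebra X S}
    (F : list (list nat) -> X -> Prop) : (forall w, S (F w)) -> S (fun x => forall w, F w x).
Proof.
move=> H; apply: (S_ext (fun x => forall w, F (map word w) x)); last by apply: S_allw => w; apply: H.
move=> x; split => [h w|h w //].
have [v <-] : exists v, map word v = w; last by apply: h.
elim: w => [|a w [v IH]]; first by exists [].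
by have [n E] := word_surj a; exists (n :: v); rewrite /= IH E.
Qed.

(** * Borel sets with finite sections in a standard Borel space *)

Section Polish.
Context {X : Type} (d : X -> X -> R) (Hm : is_metric d) (Hc : metric_complete d).
Context (s : nat -> option X).
Context (Hs : forall x e, 0 < e -> exists n y, s n = Some y /\ d x y < e).
Context (Bo : (X -> Prop) -> Prop) (HB : forall A, Bo A <-> metric_borel d A).

Instance Bo_sig : is_sigma_algebra Bo := Bo_sigma d Bo HB.

Lemma d0 x y : 0 <= d x y. Proof. by case: Hm => H _; apply: H. Qed.
Lemma dxx x : d x x = 0. Proof. by case: Hm => _ [H _]; apply/H. Qed.
Lemma dsep x y : d x y = 0 -> x = y. Proof. by case: Hm => _ [H _] /H. Qed.
Lemma dC x y : d x y = d y x. Proof. by case: Hm => _ [_ [H _]]; apply: H. Qed.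
Lemma dT x y z : d x z <= d x y + d y z. Proof. by case: Hm => _ [_ [_ H]]; apply: H. Qed.

Lemma open_Bo U : metric_open d U -> Bo U.
Proof. by move=> HU; apply/HB => C _; apply. Qed.

Lemma Bo_ind (C : (X -> Prop) -> Prop) : is_sigma_algebra C ->
  (forall U, metric_open d U -> C U) -> forall A, Bo A -> C A.
Proof. by move=> HC HO A /HB; apply. Qed.

Lemma ball_open p e : metric_open d (fun y => d y p < e).
Proof.
move=> y Hy; exists (e - d y p); split; first by lra.
by move=> z Hz; have := dT z y p; rewrite (dC z y); lra.
Qed.

(** The sequence of codes of [y] embeds the space into Baire space. Points with the same [n]-th code
    are within [2 * eps n], so fixing codes cuts the space into small Borel pieces. *)
Definition code (n : nat) (y : X) : nat :=
  least (fun i => exists p, s i = Some p /\ d y p < eps n).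

Lemma codeP n y : exists p, s (code n y) = Some p /\ d y p < eps n.
Proof.
case: (Hs y (eps n) (eps_pos n)) => i [p Hp].
by apply: (proj1 (leastP (fun i => exists p, s i = Some p /\ d y p < eps n) _)); exists i, p.
Qed.

Lemma code_close n y z : code n y = code n z -> d y z < 2 * eps n.
Proof.
case: (codeP n y) => p [Hp1 Hp2]; case: (codeP n z) => q [Hq1 Hq2] E.
move: Hp1; rewrite E Hq1 => -[Epq]; subst q.
by have := dT y p z; rewrite (dC p z); lra.
Qed.

Lemma code_Bo n : measn Bo (code n).
Proof.
apply: measn_least => i; case: (s i) => [p|].
  apply: (S_ext (fun y => d y p < eps n)); last exact: open_Bo (ball_open _ _).
  by move=> y; split => [h|[q [[<-]]]//]; exists p.
by apply: (S_ext (fun _ => False)); [move=> y; split => // -[p []] | apply: S_cst].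
Qed.

Lemma code_inj y z : (forall n, code n y = code n z) -> y = z.
Proof.
move=> H; apply: dsep; case: (Req_dec (d y z) 0) => // h.
have pos : 0 < d y z / 2 by have := d0 y z; lra.
by case: (eps_small _ pos) => n Hn; have := code_close n y z (H n); lra.
Qed.

(** Completeness read in codes. The limit need not itself have the codes [a], hence the conclusion
    speaks of distances. *)
Lemma code_lim (a : nat -> nat) :
  (forall n, exists y, forall i, (i < n)%nat -> code i y = a i) ->
  exists l, forall n y, (forall i, (i < S n)%nat -> code i y = a i) -> d y l <= 2 * eps n.
Proof.
move=> H; case: (choose _ (fun n => H (S n))) => y Hy.
have close m n z : (n <= m)%nat -> (forall i, (i < S n)%nat -> code i z = a i) -> d z (y m) < 2 * eps n.
  by move=> le Hz; apply: code_close; rewrite Hz ?Hy; lia.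
case: (Hc y) => [e He|l Hl].
  case: (eps_small (e / 2)) => [|N HN]; first by lra.
  exists (S N) => m n lm ln; apply: (Rlt_trans _ (2 * eps N)); last by lra.
  by apply: code_close; rewrite !Hy; lia.
exists l => n z Hz; apply: Rnot_lt_le => lt.
case: (Hl (d z l - 2 * eps n)) => [|N HN]; first by lra.
have := HN (max n N) ltac:(lia); have := close (max n N) n z ltac:(lia) Hz.
by have := dT z (y (max n N)) l; lra.
Qed.

(** * Analytic sets *)

Definition closed3 (Z : (nat -> nat) -> X -> X -> Prop) : Prop :=
  forall sg x y,
    (forall n, exists sg' x' y', Z sg' x' y' /\ (forall i, (i < n)%nat -> sg' i = sg i) /\
                          d x x' < eps n /\ d y y' < eps n) ->
    Z sg x y.

(** Projections of closed subsets of Baire space times the square. *)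
Definition ana (P : X * X -> Prop) : Prop :=
  exists Z, closed3 Z /\ forall x y, P (x, y) <-> exists sg, Z sg x y.

(** The first digit of the witness names the member of the union. *)
Lemma ana_ex (P : nat -> X * X -> Prop) :
  (forall n, ana (P n)) -> ana (fun p => exists n, P n p).
Proof.
move=> H; case: (choose _ H) => Z HZ.
exists (fun sg x y => Z (sg 0%nat) (fun i => sg (S i)) x y); split.
  move=> sg x y Hl; case: (HZ (sg 0%nat)) => HC _; apply: HC => n.
  case: (Hl (S n)) => sg' [x' [y' [h1 [h2 [h3 h4]]]]].
  exists (fun i => sg' (S i)), x', y'; split; last split.
  - by rewrite -(h2 0%nat) //; lia.
  - by move=> i lt; apply: h2; lia.
  - by have := eps_mono n (S n) ltac:(lia); lra.
move=> x y; split.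
  case=> n; case: (HZ n) => _ HP /HP [sg h].
  by exists (fun i => match i with 0 => n | S i => sg i end).
by case=> sg h; exists (sg 0%nat); case: (HZ (sg 0%nat)) => _ HP; apply/HP; exists (fun i => sg (S i)).
Qed.

Lemma bound_fin (f : nat -> nat) m : exists N, forall i, (i < m)%nat -> (f i < N)%nat.
Proof.
elim: m => [|m [N IH]]; first by exists 0%nat; lia.
exists (S (N + f m)) => i lt; case: (Nat.eq_dec i m) => [->|ne]; first by lia.
by have := IH i ltac:(lia); lia.
Qed.

(** One sequence carries a witness for every [n], interleaved by the pairing function; a finite
    prefix of each is determined by a finite prefix of the whole. *)
Lemma ana_all (P : nat -> X * X -> Prop) :
  (forall n, ana (P n)) -> ana (fun p => forall n, P n p).
Proof.
move=> H; case: (choose _ H) => Z HZ.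
exists (fun sg x y => forall n, Z n (fun i => sg (to_nat (n, i))) x y); split.
  move=> sg x y Hl n; case: (HZ n) => HC _; apply: HC => m.
  case: (bound_fin (fun i => to_nat (n, i)) m) => N HN.
  case: (Hl (N + m)%nat) => sg' [x' [y' [h1 [h2 [h3 h4]]]]].
  exists (fun i => sg' (to_nat (n, i))), x', y'; split; last split.
  - exact: h1.
  - by move=> i lt; apply: h2; have := HN i lt; lia.
  - by have := eps_mono m (N + m) ltac:(lia); lra.
move=> x y; split.
  move=> h.
  have {}h n : exists sg, Z n sg x y by case: (HZ n) => _ HP; apply/HP.
  case: (choose _ h) => f Hf.
  exists (fun j => let (n, i) := of_nat j in f n i) => n.
  by have -> : (fun i => let (n0, i0) := of_nat (to_nat (n, i)) in f n0 i0) = f n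
    by extensionality i; rewrite cancel_of_to.
by case=> sg h n; case: (HZ n) => _ HP; apply/HP; exists (fun i => sg (to_nat (n, i))).
Qed.

Lemma ana_ext (P Q : X * X -> Prop) : (forall p, P p <-> Q p) -> ana P -> ana Q.
Proof. by move=> /pred_ext ->. Qed.

(** Analytic sets may fail to be closed under complements; those with analytic complement form a
    sigma-algebra, which therefore contains all product Borel sets. *)
Definition biana (P : X * X -> Prop) : Prop := ana P /\ ana (fun p => ~ P p).

Lemma ana_closed (F : X * X -> Prop) :
  (forall x y, (forall n, exists x' y', F (x', y') /\ d x x' < eps n /\ d y y' < eps n) -> F (x, y)) ->
  ana F.
Proof.
move=> HF; exists (fun _ x y => F (x, y)); split; last first.
  by move=> x y; split => [h|[]//]; exists (fun _ => 0%nat).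
move=> sg x y h; apply: HF => n; case: (h n) => _ [x' [y' [h1 [_ h2]]]].
by exists x', y'.
Qed.

Lemma biana_sigma : is_sigma_algebra biana.
Proof.
split; [|split].
- by split; apply: ana_closed => // x y /(_ 0%nat) [? [? [[]]]].
- by move=> A [h1 h2]; split => //; apply: ana_ext h1 => p; tauto.
- move=> F HF; split; first by apply: ana_ex => n; case: (HF n).
  apply: (ana_ext (fun p => forall n, ~ F n p)).
    by move=> p; split => [h [n /h]//|h n h']; apply: h; exists n.
  by apply: ana_all => n; case: (HF n).
Qed.

Lemma sigma_pre {Y Z : Type} (C : (Y -> Prop) -> Prop) (g : Y -> Z) :
  is_sigma_algebra C -> is_sigma_algebra (fun A : Z -> Prop => C (fun y => A (g y))).
Proof.
by case=> h1 [h2 h3]; split; [|split] => [|A|F] //; [apply: h2 | apply: (h3 (fun n y => F n (g y)))].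
Qed.

(** An open set is the countable union of the closed sets of points whose [eps n]-ball it contains,
    and these pull back to closed sets along a Lipschitz map. *)
Lemma biana_pre (g : X * X -> X) :
  (forall x y x' y', d (g (x, y)) (g (x', y')) <= d x x' + d y y') ->
  forall A, Bo A -> biana (fun p => A (g p)).
Proof.
move=> Hg; apply: Bo_ind; first exact: sigma_pre biana_sigma.
move=> U HU; split.
  apply: (ana_ext (fun p => exists n, forall z, d (g p) z < eps n -> U z)).
    move=> p; split => [[n]|Up]; first by apply; rewrite dxx; apply: eps_pos.
    case: (HU _ Up) => e [He H]; case: (eps_small e He) => n Hn.
    by exists n => z Hz; apply: H; lra.
  apply: ana_ex => n; apply: ana_closed => x y H z Hz.
  case: (eps_small ((eps n - d (g (x, y)) z) / 2)) => [|m Hmm]; first by lra.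
  case: (H m) => x' [y' [h [h1 h2]]]; apply: h.
  have := dT (g (x', y')) (g (x, y)) z; have := Hg x y x' y'.
  by rewrite (dC (g (x, y)) (g (x', y'))); lra.
apply: ana_closed => x y H Uxy; case: (HU _ Uxy) => e [He Hx].
case: (eps_small (e / 2)) => [|m Hmm]; first by lra.
case: (H m) => x' [y' [h [h1 h2]]]; apply: h; apply: Hx.
by have := Hg x y x' y'; lra.
Qed.

Lemma product_biana P : product_sigma Bo P -> biana P.
Proof.
move=> HP; apply: HP; first exact: biana_sigma.
move=> E [A [B [HA [HBB /pred_ext ->]]]].
have Hsig := biana_sigma.
apply: S_and.
  by apply: (biana_pre fst) => // x y x' y' /=; have := d0 y y'; lra.
by apply: (biana_pre snd) => // x y x' y' /=; have := d0 x x'; lra.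
Qed.

(** * Separation of analytic sets without a common point *)

Section Novikov.
Context (D : nat).

Definition separated (A : nat -> X -> Prop) : Prop :=
  exists B : nat -> X -> Prop, (forall i, Bo (B i)) /\
    (forall i x, (i <= D)%nat -> A i x -> B i x) /\
    ~ exists x, forall i, (i <= D)%nat -> B i x.

(** Only coordinate [l] is split: take unions of the separators there and intersections in the other
    coordinates. *)
Lemma separated_union (A : nat -> X -> Prop) l (F : nat -> X -> Prop) :
  (forall x, A l x -> exists m, F m x) ->
  (forall m, separated (fun i => if Nat.eq_dec i l then F m else A i)) ->
  separated A.
Proof.
move=> HA HF; case: (choose _ HF) => B HBm.
exists (fun i => if Nat.eq_dec i l then (fun x => exists m, B m i x) else (fun x => forall m, B m i x)).
split; [|split].
- have hB m j : Bo (B m j) by case: (HBm m).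
  by move=> i; case: (Nat.eq_dec i l) => _; bor; apply: hB.
- move=> i x le Ai; case: (Nat.eq_dec i l) => [e|ne].
    subst i; case: (HA x Ai) => m Fm; exists m; case: (HBm m) => _ [h _]; apply: h => //.
    by case: (Nat.eq_dec l l).
  by move=> m; case: (HBm m) => _ [h _]; apply: h => //; case: (Nat.eq_dec i l).
- case=> x Hx; case: (le_lt_dec l D) => [le|lt].
    have := Hx l le; case: (Nat.eq_dec l l) => // _ [m Bm].
    case: (HBm m) => _ [_ h]; apply: h; exists x => i lei.
    by have := Hx i lei; case: (Nat.eq_dec i l) => [->|].
  case: (HBm 0%nat) => _ [_ h]; apply: h; exists x => i lei.
  by have := Hx i lei; case: (Nat.eq_dec i l) => [|_]; [lia|].
Qed.

(** By [separated_union] a failure survives replacing one set by a suitable piece; doing so for the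
    [D + 1] coordinates in turn gives [v]. *)
Lemma separated_refine (A : nat -> X -> Prop) (F : nat -> nat -> X -> Prop) :
  (forall i x, A i x -> exists m, F i m x) -> ~ separated A ->
  exists v : nat -> nat, ~ separated (fun i => F i (v i)).
Proof.
move=> HA Hn.
have step l : exists v : nat -> nat,
    ~ separated (fun i => if lt_dec i l then F i (v i) else A i).
  elim: l => [|l [v IH]].
    exists (fun _ => 0%nat); move: Hn; apply: contra_not => -[B HBB]; exists B.
    by move: HBB => /=.
  have [m Hmm] : exists m, ~ separated (fun i => if Nat.eq_dec i l then F l m else
                                  if lt_dec i l then F i (v i) else A i).
    apply: NNPP => H; apply: IH; apply: (separated_union _ l (F l)) => [x|m].
      by case: (lt_dec l l) => [|_]; [lia | apply: HA].
    by apply: NNPP => h; apply: H; exists m.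
  exists (fun i => if Nat.eq_dec i l then m else v i); move: Hmm; apply: contra_not.
  have <- // : (fun i => if lt_dec i (S l) then F i (if Nat.eq_dec i l then m else v i) else A i) =
         (fun i => if Nat.eq_dec i l then F l m else if lt_dec i l then F i (v i) else A i).
  extensionality i; case: (Nat.eq_dec i l) => [->|ne].
    by case: (lt_dec l (S l)) => //; lia.
  by case: (lt_dec i l); case: (lt_dec i (S l)) => //; lia.
case: (step (S D)) => v Hv; exists v; move: Hv; apply: contra_not => -[B [h1 [h2 h3]]].
exists B; split => //; split => // i x le.
by case: (lt_dec i (S D)) => [_|]; [apply: h2 | lia].
Qed.

Lemma separated_ball (A : nat -> X -> Prop) i j a b e : (i <= D)%nat -> (j <= D)%nat -> i <> j ->
  (forall x, A i x -> d x a < e) -> (forall x, A j x -> d x b < e) -> 2 * e <= d a b -> separated A.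
Proof.
move=> li lj ne Ha Hb He.
exists (fun l x => (l = i -> d x a < e) /\ (l = j -> d x b < e)); split; [|split].
- move=> l; bor; exact: open_Bo (ball_open _ _).
- by move=> l x le Al; split => E; subst l; [apply: Ha | apply: Hb].
- case=> x H; have [/(_ eq_refl) h1 _] := H i li; have [_ /(_ eq_refl) h2] := H j lj.
  by have := dT a x b; rewrite (dC a x); lra.
Qed.

(** A digit of the witness with the codes of both points: agreeing traces make witnesses and points
    converge together. *)
Definition trace (sg : nat -> nat) (x y : X) (j : nat) : nat :=
  to_nat (sg j, to_nat (code j x, code j y)).

(* If separation failed, it would keep failing after restricting each set to one piece
   of diameter 2^-n at every stage; the pieces shrink to limit points, which closedness of the witness
   relations puts back into the given sets, and which can be separated by balls unless they coincide. *)
Lemma novikov (P : nat -> X * X -> Prop) : (forall i, ana (P i)) ->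
  ~ (exists x, forall i, (i <= D)%nat -> exists y, P i (x, y)) ->
  separated (fun i x => exists y, P i (x, y)).
Proof.
move=> /choose [Z HZ] Hempty; apply: NNPP => Hns.
pose piece (n : nat) (t : nat -> nat -> nat) (i : nat) (x : X) :=
  exists sg y, Z i sg x y /\ forall j, (j < n)%nat -> trace sg x y j = t i j.
have Hstep (nt : nat * (nat -> nat -> nat)) : exists v : nat -> nat, ~ separated (piece (fst nt) (snd nt)) ->
    ~ separated (piece (S (fst nt)) (fun i j => if Nat.eq_dec j (fst nt) then v i else snd nt i j)).
  case: nt => n t /=; case: (classic (separated (piece n t))) => H; first by exists (fun _ => 0%nat).
  case: (separated_refine (piece n t)
    (fun i m x => exists sg y, Z i sg x y /\ (forall j, (j < n)%nat -> trace sg x y j = t i j) /\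
                             trace sg x y n = m) _ H) => [i x [sg [y [h1 h2]]]|v Hv].
    by exists (trace sg x y n), sg, y.
  exists v => _; move: Hv; apply: contra_not => -[B [h1 [h2 h3]]].
  exists B; split => //; split => // i x le [sg [y [k1 [k2 k3]]]]; apply: h2 => //.
  exists sg, y; split => // j lt; case: (Nat.eq_dec j n) => [->//|ne].
  by apply: k2; lia.
case: (choose _ Hstep) => v Hv.
(* Stage [n] fixes column [n] only, so the stages stabilize to [t]. *)
pose st := fix st n := match n with
  | 0 => fun _ _ => 0%nat
  | S n => fun i j => if Nat.eq_dec j n then v (n, st n) i else st n i j end.
have Hst n : ~ separated (piece n (st n)).
  elim: n => [|n IH]; last exact: (Hv (n, st n) IH).
  move: Hns; apply: contra_not => -[B [h1 [h2 h3]]].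
  exists B; split => //; split => // i x le [y Py]; apply: h2 => //.
  by case: (HZ i) => _ HP; move/HP: Py => [sg h]; exists sg, y; split => // j; lia.
pose t i j := st (S j) i j.
have stt n i j : (j < n)%nat -> st n i j = t i j.
  elim: n => [|n IH] lt; first by lia.
  rewrite /t /=; case: (Nat.eq_dec j j) => // _; case: (Nat.eq_dec j n) => [->//|ne].
  by have := IH ltac:(lia); rewrite /t /=; case: (Nat.eq_dec j j).
have Ht n : ~ separated (piece n t).
  have := Hst n; apply: contra_not => -[B [h1 [h2 h3]]].
  exists B; split => //; split => // i x le [sg [y [k1 k2]]]; apply: h2 => //.
  by exists sg, y; split => // j lt; rewrite k2 // stt.
have Hne n i : (i <= D)%nat -> exists x, piece n t i x.
  move=> le; apply: NNPP => H; apply: (Ht n).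
  exists (fun l _ => l <> i); split; [|split].
  - by move=> l; apply: S_cst.
  - by move=> l x _ Hl E; subst l; apply: H; exists x.
  - by case=> x /(_ i le).
pose tri i j := of_nat (t i j).
pose a i j := fst (of_nat (snd (tri i j))).
pose b i j := snd (of_nat (snd (tri i j))).
have dec_tr sg x y i j : trace sg x y j = t i j ->
    sg j = fst (tri i j) /\ code j x = a i j /\ code j y = b i j.
  by move=> E; rewrite /a /b /tri -E /trace !cancel_of_to /= ?cancel_of_to.
have Hlx i : exists l, (i <= D)%nat -> forall n x, (forall j, (j < S n)%nat -> code j x = a i j) -> d x l <= 2 * eps n.
  case: (le_lt_dec i D) => [le|lt]; last first.
    case: (Hne 0%nat 0%nat ltac:(lia)) => x _; exists x; lia.
  case: (code_lim (a i)) => [n|l Hl]; last by exists l.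
  case: (Hne n i le) => x [sg [y [_ h]]]; exists x => j lt.
  by case: (dec_tr _ _ _ _ _ (h j lt)) => _ [].
have Hly i : exists l, (i <= D)%nat -> forall n x, (forall j, (j < S n)%nat -> code j x = b i j) -> d x l <= 2 * eps n.
  case: (le_lt_dec i D) => [le|lt]; last first.
    case: (Hne 0%nat 0%nat ltac:(lia)) => x _; exists x; lia.
  case: (code_lim (b i)) => [n|l Hl]; last by exists l.
  case: (Hne n i le) => x [sg [y [_ h]]]; exists y => j lt.
  by case: (dec_tr _ _ _ _ _ (h j lt)) => _ [].
case: (choose _ Hlx) => lx {}Hlx; case: (choose _ Hly) => ly {}Hly.
have HP i : (i <= D)%nat -> P i (lx i, ly i).
  move=> le; case: (HZ i) => HC HP; apply/HP; exists (fun j => fst (tri i j)).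
  (* Three further columns put the points within [2 * eps (S (S n)) = eps (S n)] of the limits,
     which is below [eps n]. *)
  apply: HC => n; case: (Hne (S (S (S n))) i le) => x [sg [y [h1 h2]]].
  exists sg, x, y; split => //; split.
    by move=> j lt; case: (dec_tr _ _ _ _ _ (h2 j ltac:(lia))).
  have := eps_S n; have := eps_S (S n); have := eps_pos (S (S n)).
  have := Hlx i le (S (S n)) x (fun j lt => proj1 (proj2 (dec_tr _ _ _ _ _ (h2 j lt)))).
  have := Hly i le (S (S n)) y (fun j lt => proj2 (proj2 (dec_tr _ _ _ _ _ (h2 j lt)))).
  by rewrite (dC (lx i)) (dC (ly i)); lra.
case: (classic (exists i, (i <= D)%nat /\ lx i <> lx 0%nat)) => [[i [le ne]]|H]; last first.
  apply: Hempty; exists (lx 0%nat) => i le; exists (ly i).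
  have <- : lx i = lx 0%nat by apply: NNPP => ne; apply: H; exists i.
  exact: HP.
have pos : 0 < d (lx i) (lx 0%nat).
  by have := d0 (lx i) (lx 0%nat); case: (Req_dec (d (lx i) (lx 0%nat)) 0) => [/dsep//|]; lra.
case: (eps_small (d (lx i) (lx 0%nat) / 4)) => [|n Hn]; first by lra.
apply: (Ht (S n)); apply: (separated_ball _ i 0%nat (lx i) (lx 0%nat) (d (lx i) (lx 0%nat) / 2)) => //; try lia; try lra.
  by move=> E; apply: ne; rewrite E.
- move=> x [sg [y [_ h]]]; apply: (Rle_lt_trans _ (2 * eps n)); last by lra.
  by apply: Hlx => // j lt; case: (dec_tr _ _ _ _ _ (h j lt)) => _ [].
- move=> x [sg [y [_ h]]]; apply: (Rle_lt_trans _ (2 * eps n)); last by lra.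
  by apply: (Hlx 0%nat); [lia|] => j lt; case: (dec_tr _ _ _ _ _ (h j lt)) => _ [].
Qed.

End Novikov.

Definition ext (w v : list nat) : Prop := firstn (length w) v = w.

Lemma ext_trans u v w : ext u v -> ext v w -> ext u w.
Proof.
rewrite /ext => h1 h2; rewrite -{2}h1 -h2 firstn_firstn.
suff -> : Nat.min (length u) (length v) = length u by [].
by rewrite -h1 length_firstn; lia.
Qed.

Lemma ext_length u v : ext u v -> (length u <= length v)%nat.
Proof. by move=> h; rewrite -h length_firstn; lia. Qed.

Lemma ext_firstn n v : ext (firstn n v) v.
Proof.
rewrite /ext length_firstn; case: (le_lt_dec n (length v)) => h; first by rewrite Nat.min_l.
by rewrite Nat.min_r ?firstn_all ?firstn_all2 //; lia.
Qed.

Lemma ext_firstn2 u n v : ext u v -> (length u <= n)%nat -> ext u (firstn n v).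
Proof. by rewrite /ext => h le; rewrite firstn_firstn Nat.min_l. Qed.

Lemma ext_nth u v i : ext u v -> (i < length u)%nat -> nth i u 0%nat = nth i v 0%nat.
Proof.
move=> h lt; rewrite -{1}h nth_firstn.
by case: (Nat.ltb_spec i (length u)) => //; lia.
Qed.

(** * Countably many Borel functions covering a relation with bounded sections *)

Section Selection.
Context (P : X * X -> Prop) (HP : product_sigma Bo P) (D : nat).
Context (Hdeg : forall x l, NoDup l -> (forall y, In y l -> P (x, y)) -> (length l <= D)%nat).

Definition cyl (w : list nat) (y : X) : Prop :=
  forall i, (i < length w)%nat -> code i y = nth i w 0%nat.

Definition pre (y : X) (n : nat) : list nat := map (fun i => code i y) (seq 0 n).

Lemma pre_length y n : length (pre y n) = n.
Proof. by rewrite length_map length_seq. Qed.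

Lemma pre_nth y n i : (i < n)%nat -> nth i (pre y n) 0%nat = code i y.
Proof.
move=> lt; rewrite (nth_indep _ 0%nat (code 0 y)) ?pre_length //.
by rewrite (map_nth (fun i => code i y)) seq_nth.
Qed.

Lemma cyl_pre y n : cyl (pre y n) y.
Proof. by move=> i; rewrite pre_length => lt; rewrite pre_nth. Qed.

Lemma cyl_eq w v y : length w = length v -> cyl w y -> cyl v y -> w = v.
Proof. by move=> E h1 h2; apply: (nth_ext _ _ 0%nat 0%nat E) => n lt; rewrite -h1 // -h2 // -E. Qed.

Lemma firstn_pre y m n : (m <= n)%nat -> firstn m (pre y n) = pre y m.
Proof.
move=> le; apply: (cyl_eq _ _ y); last exact: cyl_pre.
  by rewrite length_firstn !pre_length; lia.
move=> i; rewrite length_firstn pre_length => lt; rewrite nth_firstn pre_nth; first by case: (Nat.ltb_spec i m) => //; lia.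
by case: (Nat.ltb_spec i m) => //; lia.
Qed.

Lemma cyl_Bo w : Bo (cyl w).
Proof. by rewrite /cyl; bor; apply: code_Bo. Qed.

Definition tuple_sep (ws : list (list nat)) : Prop :=
  separated D (fun i x => exists y, P (x, y) /\ cyl (nth i ws []) y).

(** Distinct words of equal length have disjoint cylinders, so a point common to all projections
    would have more than [D] partners under [P]. *)
Lemma tuple_separated (ws : list (list nat)) n :
  NoDup ws -> (D < length ws)%nat -> (forall w, In w ws -> length w = n) -> tuple_sep ws.
Proof.
move=> Hnd Hlen Hw; rewrite /tuple_sep.
have biS := biana_sigma.
have hana i : ana (fun p => P p /\ cyl (nth i ws []) (snd p)).
  suff [] : biana (fun p => P p /\ cyl (nth i ws []) (snd p)) by [].
  apply: S_and; first exact: product_biana.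
  apply: (biana_pre snd) => [x y x' y' /=|]; first by have := d0 x x'; lra.
  exact: cyl_Bo.
apply: (novikov D (fun i p => P p /\ cyl (nth i ws []) (snd p)) hana).
case=> x Hx.
have [ys Hys] : exists ys : nat -> X, forall i, (i <= D)%nat -> P (x, ys i) /\ cyl (nth i ws []) (ys i).
  apply: (choose (fun i y => (i <= D)%nat -> P (x, y) /\ cyl (nth i ws []) y)) => i.
  case: (le_lt_dec i D) => [le|lt]; last by exists x; lia.
  by case: (Hx i le) => y hy; exists y.
have := Hdeg x (map ys (seq 0 (S D))); rewrite length_map length_seq.
suff h : NoDup (map ys (seq 0 (S D))) /\ forall y, In y (map ys (seq 0 (S D))) -> P (x, y).
  by case: h => h1 h2 /(_ h1 h2); lia.
split; last first.
  by move=> y /in_map_iff [i [<- /in_seq h]]; case: (Hys i ltac:(lia)).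
apply: (proj2 (NoDup_nth _ (ys 0%nat))) => i j; rewrite length_map length_seq => li lj.
rewrite !(map_nth ys (seq 0 (S D)) 0%nat) !seq_nth //= => E.
apply: (proj1 (NoDup_nth ws []) Hnd) => //; try lia.
case: (Hys i ltac:(lia)) => _ h1; case: (Hys j ltac:(lia)) => _ h2.
apply: (cyl_eq _ _ (ys i)) => //; last by rewrite E.
by rewrite !Hw //; apply: nth_In; lia.
Qed.

Lemma sep_choice : exists B : list (list nat) -> nat -> X -> Prop, forall ws,
  (forall i, Bo (B ws i)) /\
  (tuple_sep ws -> (forall i x y, (i <= D)%nat -> P (x, y) -> cyl (nth i ws []) y -> B ws i x) /\
                   ~ exists x, forall i, (i <= D)%nat -> B ws i x).
Proof.
suff H ws : exists B : nat -> X -> Prop, (forall i, Bo (B i)) /\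
  (tuple_sep ws -> (forall i x y, (i <= D)%nat -> P (x, y) -> cyl (nth i ws []) y -> B i x) /\
                   ~ exists x, forall i, (i <= D)%nat -> B i x) by exact: (choose _ H).
case: (classic (tuple_sep ws)) => [[B [h1 [h2 h3]]]|h]; last first.
  by exists (fun _ _ => True); split => // i; apply: S_cst.
exists B; split => // _; split => // i x y le h4 h5; apply: h2 => //.
by exists y.
Qed.

(** [C w] is a Borel set containing the projection of [P] over [cyl w]: the intersection of all
    separators chosen for tuples in which [w] occurs. A point cannot lie in [C w] for more than [D]
    words of one length, as the separators of that tuple have no common point. *)
Lemma node_family : exists C : list nat -> X -> Prop,
  (forall w, Bo (C w)) /\
  (forall w x, C w x -> exists y, cyl w y) /\
  (forall w x y, P (x, y) -> cyl w y -> C w x) /\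
  (forall x n l, NoDup l -> (forall w, In w l -> length w = n /\ C w x) -> (length l <= D)%nat).
Proof.
case: sep_choice => B HBB.
exists (fun w x => (exists y, cyl w y) /\
   forall ws i, (i <= D)%nat -> tuple_sep ws -> nth i ws [] = w -> B ws i x).
split; [|split; [|split]].
- move=> w; apply: S_and; first exact: S_cst.
  by apply: S_allww => ws; bor; case: (HBB ws).
- by move=> w x [].
- move=> w x y Pxy cy; split; first by exists y.
  move=> ws i le good E; case: (HBB ws) => _ /(_ good) [h _].
  by apply: h le Pxy _; rewrite E.
- move=> x n l Hnd Hl; case: (le_lt_dec (length l) D) => // lt; exfalso.
  have good : tuple_sep l by apply: (tuple_separated l n) => // w /Hl [].
  case: (HBB l) => _ /(_ good) [_ h]; apply: h; exists x => i le.
  by case: (Hl (nth i l [])) => [|_ [_ h]]; [apply: nth_In; lia | apply: h].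
Qed.

Section Branches.
Context (C : list nat -> X -> Prop) (CB : forall w, Bo (C w)).
Context (Cne : forall w x, C w x -> exists y, cyl w y).
Context (CP : forall w x y, P (x, y) -> cyl w y -> C w x).
Context (Ccount : forall x n l, NoDup l -> (forall w, In w l -> length w = n /\ C w x) -> (length l <= D)%nat).

Definition node (w : list nat) (x : X) : Prop := forall n, C (firstn n w) x.

(** Since every level is finite, arbitrarily long extensions amount to an infinite branch through
    [w]; this form has countable quantifiers only. *)
Definition alive (w : list nat) (x : X) : Prop :=
  forall m, exists v, (m <= length v)%nat /\ ext w v /\ node v x.

(** Exactly one infinite branch of the tree at [x] passes through [w]. *)
Definition isolated (w : list nat) (x : X) : Prop :=
  alive w x /\ forall v v', length v = length v' -> ext w v -> ext w v' -> alive v x -> alive v' x -> v = v'.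

Lemma node_firstn w x n : node w x -> node (firstn n w) x.
Proof. by move=> h m; rewrite firstn_firstn. Qed.

Lemma node_C w x : node w x -> C w x.
Proof. by move=> /(_ (length w)); rewrite firstn_all. Qed.

Lemma alive_prefix u v x : ext u v -> alive v x -> alive u x.
Proof.
move=> h av m; case: (av m) => t [h1 [h2 h3]]; exists t; split => //; split => //.
exact: ext_trans h2.
Qed.

Lemma alive_C w x : alive w x -> C w x.
Proof. by move=> /(_ 0%nat) [v [_ [<- h]]]; apply: node_C; apply: node_firstn. Qed.

Lemma isolated_Bo w : Bo (isolated w).
Proof.
have nB v : Bo (node v) by rewrite /node; bor; apply: CB.
have aB v : Bo (alive v) by rewrite /alive; apply: S_all => m; apply: S_exw => u; bor; apply: nB.
apply: S_and; first exact: aB.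
by apply: S_allw => v; apply: S_allw => v'; bor; apply: aB.
Qed.

(** König's lemma: if all of the finitely many extensions of length [n] died, they would be dead
    from a common height [M] on. *)
Lemma alive_extend w x n : alive w x -> (length w <= n)%nat ->
  exists v, length v = n /\ ext w v /\ alive v x.
Proof.
move=> aw le; apply: NNPP => H.
case: (bounded_finite (fun v => length v = n /\ C v x) D (Ccount x n)) => l [_ [Hl _]].
have [M HM] : exists M, forall v, In v l -> ext w v -> length v = n ->
    forall u, (M <= length u)%nat -> ext v u -> ~ node u x.
  elim: (l) => [|v l' [M IH]]; first by exists 0%nat.
  case: (classic (ext w v /\ length v = n)) => [[h1 h2]|h]; last first.
    by exists M => v' [<-|/IH //] h1 h2; case: h.
  have [m Hmm] : exists m, forall u, (m <= length u)%nat -> ext v u -> ~ node u x.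
    apply: NNPP => h; apply: H; exists v; split => //; split => // m.
    apply: NNPP => h'; apply: h; exists m => u k1 k2 k3; apply: h'.
    by exists u.
  exists (M + m)%nat => v' [<-|Hin] k1 k2 u k3; first by apply: Hmm; lia.
  by apply: (IH v') => //; lia.
case: (aw (M + n)%nat) => u [h1 [h2 h3]].
have E : length (firstn n u) = n by rewrite length_firstn; lia.
apply: (HM (firstn n u) _ _ _ u) => //.
- by apply/Hl; split => //; apply: h3.
- exact: ext_firstn2.
- by lia.
- exact: ext_firstn.
Qed.

(** All living extensions of [w] are comparable, so they define a single sequence of codes, whose
    limit comes from [code_lim]. *)
Lemma branch_limit w x : exists l, isolated w x ->
  forall n v y, (n < length v)%nat -> ext w v -> alive v x -> cyl v y -> d y l <= 2 * eps n.
Proof.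
case: (classic (isolated w x)) => [[aw Huniq]|]; last by exists x.
case: (choose (fun n v => length v = (length w + n)%nat /\ ext w v /\ alive v x)).
  by move=> n; apply: alive_extend => //; lia.
move=> vs Hvs; pose a i := nth i (vs (S i)) 0%nat.
have same u v i : (length u <= length v)%nat -> ext w u -> ext w v -> alive u x -> alive v x ->
    (i < length u)%nat -> nth i u 0%nat = nth i v 0%nat.
  move=> le e1 e2 a1 a2 lt; apply: ext_nth => //; rewrite /ext.
  apply: Huniq => //; first by rewrite length_firstn; lia.
    by apply: ext_firstn2 => //; apply: ext_length.
  by apply: alive_prefix a2; apply: ext_firstn.
have agree v i : ext w v -> alive v x -> (i < length v)%nat -> nth i v 0%nat = a i.
  move=> e1 a1 lt; case: (Hvs (S i)) => k1 [k2 k3]; rewrite /a.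
  case: (le_lt_dec (length v) (length (vs (S i)))) => h; first exact: same.
  by apply: eq_sym; apply: same => //; lia.
case: (code_lim a) => [n|l Hl].
  case: (Hvs n) => k1 [k2 k3]; case: (Cne _ _ (alive_C _ _ k3)) => y hy.
  by exists y => i lt; rewrite hy ?agree //; lia.
exists l => _ n v y lt e1 a1 cy; apply: Hl => i lti; rewrite cy; first by lia.
by apply: agree => //; lia.
Qed.

(** [h w x] is the limit of the branch through [w]. To see that these functions cover [P], take a
    level where the number of living words is maximal: no living word branches above it, so the
    initial word of [y] is isolated. *)
Lemma branch_functions : exists h : list nat -> X -> X,
  (forall w, meas Bo Bo (h w)) /\
  (forall x y, P (x, y) -> exists w, isolated w x /\ h w x = y).
Proof.
case: (choose (fun wx l => (isolated (fst wx) (snd wx) ->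
  forall n v y, (n < length v)%nat -> ext (fst wx) v -> alive v (snd wx) -> cyl v y -> d y l <= 2 * eps n) /\
  (~ isolated (fst wx) (snd wx) -> l = snd wx))).
  case=> w x /=; case: (classic (isolated w x)) => Hi; last by exists x.
  by case: (branch_limit w x) => l Hl; exists l; split.
move=> h Hh; exists (fun w x => h (w, x)); split; last first.
  move=> x y Pxy.
  have preal n : alive (pre y n) x.
    move=> m; exists (pre y (n + m)); rewrite pre_length; split; first by lia.
    split; first by rewrite /ext pre_length firstn_pre //; lia.
    move=> k; apply: (CP _ x y) => // i lt; rewrite (ext_nth _ _ _ (ext_firstn k _) lt) pre_nth //.
    by move: lt; rewrite length_firstn pre_length; lia.
  pose Q c := exists n l, NoDup l /\ length l = c /\ forall v, In v l -> length v = n /\ alive v x.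
  case: (max_nat Q D 0) => [||c [[n [l [h1 [h2 h3]]]] Hmax]].
  - by exists 0%nat, []; split; [apply: NoDup_nil | split].
  - move=> c [n [l [h1 [<- h3]]]]; apply: (Ccount x n) => // w /h3 [-> /alive_C] //.
  pose w := pre y n.
  have win : In w l.
    apply: NNPP => nin; have := Hmax (S c); suff hQ : Q (S c) by move=> /(_ hQ); lia.
    exists n, (w :: l); split; first by apply: NoDup_cons.
    by split => [|v [<-|/h3]] //=; [rewrite h2 | split; [apply: pre_length | apply: preal]].
  have iso : isolated w x.
    split; first exact: preal.
    (* Two living words above [w], together with extensions of the other members of [l], would
       exceed the maximum [c]. *)
    move=> v v' Ev ev ev' av av'; apply: NNPP => ne.
    have ln : (n <= length v)%nat by have := ext_length _ _ ev; rewrite pre_length.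
    case: (in_split _ _ win) => l1 [l2 El].
    have h3' u : In u (l1 ++ l2) -> In u l /\ u <> w.
      have ndl : NoDup (l1 ++ w :: l2) by rewrite -El.
      case: (NoDup_remove _ _ _ ndl) => _ nin hu; split; last by move=> E; subst u.
      by rewrite El; apply/in_or_app; case: (in_app_or _ _ _ hu) => ?; [left | right; right].
    have [f Hf] : exists f, forall u, In u (l1 ++ l2) -> length (f u) = length v /\ ext u (f u) /\ alive (f u) x.
      apply: (choose (fun u t => In u (l1 ++ l2) -> length t = length v /\ ext u t /\ alive t x)) => u.
      case: (classic (In u (l1 ++ l2))) => [/h3' [/h3 [k1 k2] _]|]; last by exists u.
      by case: (alive_extend u x (length v) k2) => [|t Ht]; [lia | exists t].
    have disj u t : In u (l1 ++ l2) -> ext w t -> length t = length v -> f u <> t.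
      move=> hu et Et E; case: (h3' u hu) => /h3 [k1 k2] []; case: (Hf u hu) => _ [e _].
      by rewrite /ext E k1 in e; rewrite -e -et /w pre_length.
    have := Hmax (S c); suff hQ : Q (S c) by move=> /(_ hQ); lia.
    exists (length v), (v :: v' :: map f (l1 ++ l2)); split; [|split].
    - have ndm : NoDup (map f (l1 ++ l2)).
        apply: NoDup_map_NoDup_ForallPairs; last first.
          have ndl : NoDup (l1 ++ w :: l2) by rewrite -El.
          by case: (NoDup_remove _ _ _ ndl).
        move=> u t hu ht E; case: (h3' u hu) => /h3 [k1 k2] _; case: (h3' t ht) => /h3 [k3 k4] _.
        case: (Hf u hu) => _ [e1 _]; case: (Hf t ht) => _ [e2 _].
        by rewrite -e1 -e2 E k1 k3.
      have nin t : ext w t -> length t = length v -> ~ In t (map f (l1 ++ l2)).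
        by move=> e E /in_map_iff [u [Eu hu]]; apply: (disj u t).
      apply: NoDup_cons; last by apply: NoDup_cons => //; apply: nin.
      by case=> [E|]; [apply: ne | apply: nin].
    - rewrite /= length_map -h2 El !length_app /=; lia.
    - move=> t [<-//|[<-|/in_map_iff [u [<- hu]]]]; first by rewrite Ev.
      by case: (Hf u hu) => k1 [].
  exists w; split => //; case: (Hh (w, x)) => /= /(_ iso) Hlim _.
  apply: eq_sym; apply: dsep; case: (Req_dec (d y (h (w, x))) 0) => // ne.
  case: (eps_small (d y (h (w, x)) / 2)) => [|m Hmm]; first by have := d0 y (h (w, x)); lra.
  have := Hlim (m + n)%nat (pre y (S (m + n))) y.
  rewrite pre_length => /(_ ltac:(lia)); have := eps_mono m (m + n) ltac:(lia).
  suff hex : ext w (pre y (S (m + n))).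
    by move=> h4 /(_ hex (preal _) (cyl_pre _ _)); lra.
  by rewrite /ext pre_length firstn_pre //; lia.
move=> w; apply: Bo_ind; first by apply: sigma_pre Bo_sig.
move=> V HV.
(* The limit lies in the open set [V] iff, for some cylinder on the branch, every point close enough
   to it lies in [V]. *)
apply: (S_ext (fun x => (isolated w x /\ exists v, alive v x /\ (ext w v /\ exists m, (m < length v)%nat /\
    forall y z, cyl v y -> d y z <= 2 * eps m -> V z)) \/ (~ isolated w x /\ V x))); last first.
  have aB v : Bo (alive v).
    rewrite /alive; apply: S_all => m; apply: S_exw => u.
    by rewrite /node; bor; apply: CB.
  apply: S_or; apply: S_and; [exact: isolated_Bo | | apply: S_not; exact: isolated_Bo | exact: open_Bo].
  by apply: S_exw => v; apply: S_and; [apply: aB | apply: S_cst].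
move=> x; case: (Hh (w, x)) => /=; case: (classic (isolated w x)) => Hi; last first.
  by move=> _ /(_ Hi) ->; tauto.
move=> /(_ Hi) Hlim _; split => [[[_ [v [av [ev [m [lt HVm]]]]]]|[]//]|Vh].
  by case: (Cne _ _ (alive_C _ _ av)) => y cy; apply: (HVm y) => //; apply: (Hlim m v).
left; split => //; case: (HV _ Vh) => e [He Hball].
case: (eps_small (e / 4)) => [|m Hmm]; first by lra.
case: (alive_extend w x (length w + S m)) => [||v [k1 [k2 k3]]]; [by case: Hi | lia |].
exists v; split => //; split => //; exists m; split; first by lia.
move=> y z cy Hyz; apply: Hball.
have := Hlim m v y ltac:(lia) k2 k3 cy; have := dT (h (w, x)) y z; rewrite (dC (h (w, x)) y).
by lra.
Qed.

End Branches.

(** The functions of [branch_functions] turn the quantifier over [y] into one over words. *)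
Lemma projection_Bo A : Bo A -> Bo (fun x => exists y, P (x, y) /\ A y).
Proof.
move=> HA; case: node_family => C [CB [Cne [CP Ccount]]].
case: (branch_functions C CB Cne CP Ccount) => h [Hm1 Hcov].
apply: (S_ext (fun x => exists w, P (x, h w x) /\ A (h w x))).
  move=> x; split => [[w [h1 h2]]|[y [h1 h2]]]; first by exists (h w x).
  by case: (Hcov x y h1) => w [_ E]; exists w; rewrite E.
apply: S_exw => w; apply: S_and; last exact: Hm1.
apply: (HP (fun Q => Bo (fun x => Q (x, h w x)))).
  exact: (sigma_pre Bo (fun x => (x, h w x)) Bo_sig).
move=> E [A1 [B1 [HA1 [HB1 /pred_ext ->]]]] /=.
by apply: S_and => //; apply: Hm1.
Qed.

End Selection.
End Polish.

(** * Borel colorings *)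

Lemma S_if {X : Type} {S : (X -> Prop) -> Prop} `{SA : is_sigma_algebra X S} {T : Type}
    (Q : X -> Prop) (f g : X -> T) (A : X -> T -> Prop) :
  S Q -> S (fun x => A x (f x)) -> S (fun x => A x (g x)) ->
  S (fun x => A x (if dec (Q x) then f x else g x)).
Proof.
move=> HQ Hf Hg.
apply: (S_ext (fun x => (Q x /\ A x (f x)) \/ (~ Q x /\ A x (g x)))); last by bor.
by move=> x; case: (dec (Q x)) => q; tauto.
Qed.

Lemma avoid (l : list nat) : exists j, (j <= length l)%nat /\ ~ In j l.
Proof.
apply: NNPP => H.
have := NoDup_incl_length (seq_NoDup (Datatypes.S (length l)) 0) (l' := l); rewrite length_seq => h.
suff /h : incl (seq 0 (Datatypes.S (length l))) l by lia.
move=> j /in_seq hj; apply: NNPP => hn; apply: H; exists j; split => //; lia.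
Qed.

(** * Greedy extension of partial colorings *)

Section GreedyColoring.
Context {X : Type} {Bo : (X -> Prop) -> Prop} `{SA : is_sigma_algebra X Bo}.
Context (R : X -> X -> Prop) (RB : forall A, Bo A -> Bo (fun x => exists y, R x y /\ A y)).
Context (Rsym : forall x y, R x y -> R y x).
Context (k : nat) (Rk : forall x, exists l, (length l < k)%nat /\ forall y, R x y -> In y l).
Context (c : X -> nat) (cB : measn Bo c) (cR : forall x y, R x y -> c x <> c y).
Context (p : X -> nat) (pB : measn Bo p).
Context (pR : forall x y, R x y -> (p x < k)%nat -> p x <> p y).

(** Values of [p] from [k] on mark uncolored vertices. Stage [n] colors those with [c x = n], which
    are pairwise unrelated, so no conflict arises within a stage. *)
Fixpoint stage (n : nat) (x : X) : nat :=
  match n with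
  | 0 => p x
  | Datatypes.S n =>
      if dec (c x = n /\ ~ (p x < k)%nat) then least (fun j => ~ exists y, R x y /\ stage n y = j)
      else stage n x
  end.

Lemma stage_B n : measn Bo (stage n).
Proof.
elim: n => [|n IH] //= j.
apply: (S_if _ _ _ (fun _ a => a = j)); last exact: IH.
  by bor; [apply: cB | apply: (measn_sub p (fun a => (a < k)%nat))].
by apply: (measn_least (fun i x => ~ exists y, R x y /\ stage n y = i)) => i; bor; apply: RB; apply: IH.
Qed.

Lemma stage_late n x : (c x < n)%nat -> stage n x = stage (Datatypes.S (c x)) x.
Proof.
elim: n => [|n IH] lt; first by lia.
case: (Nat.eq_dec n (c x)) => [->//|ne].
by rewrite -IH; [lia | move=> /=; case: (dec (c x = n /\ _)) => // -[]; lia].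
Qed.

Lemma stage_colored n x : (p x < k)%nat -> stage n x = p x.
Proof. by move=> h; elim: n => [|n IH] //=; case: (dec _) => // -[_ []]. Qed.

Lemma greedy_coloring : exists h : X -> nat, measn Bo h /\ (forall x, (h x < k)%nat) /\
  (forall x y, R x y -> h x <> h y) /\ (forall x, (p x < k)%nat -> h x = p x).
Proof.
pose h x := stage (Datatypes.S (c x)) x.
have hun x : ~ (p x < k)%nat -> (h x < k)%nat /\ ~ exists y, R x y /\ stage (c x) y = h x.
  move=> hp; have Eh : h x = least (fun j => ~ exists y, R x y /\ stage (c x) y = j).
    by rewrite /h /=; case: (dec _) => // -[].
  case: (Rk x) => l [hl1 hl2]; case: (avoid (map (stage (c x)) l)) => j.
  rewrite length_map => -[lej nin].
  pose Q j := ~ exists y, R x y /\ stage (c x) y = j.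
  have hj : Q j.
    by case=> y [Ry Ej]; apply: nin; apply/in_map_iff; exists y; split => //; apply: hl2.
  split; first by rewrite Eh; have := least_le Q j hj; rewrite /Q; lia.
  by rewrite Eh; apply: (proj1 (leastP Q _)); exists j.
have hne x y : R x y -> ~ (p x < k)%nat -> (p y < k)%nat \/ (c y < c x)%nat -> h x <> h y.
  move=> Rxy hp hy E; case: (hun x hp) => _; apply; exists y; split => //; rewrite E /h.
  case: hy => hy; first by rewrite !stage_colored.
  by rewrite stage_late.
exists h; split; [|split; [|split]].
- move=> j; apply: (S_ext (fun x => exists n, c x = n /\ stage (Datatypes.S n) x = j)).
    by move=> x; split => [[n [<-]]//|E]; exists (c x).
  by bor; [apply: cB | apply: stage_B].
- by move=> x; case: (classic (p x < k)%nat) => hp; [rewrite /h stage_colored | case: (hun x hp)].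
- move=> x y Rxy; case: (classic (p x < k)%nat) => hx; case: (classic (p y < k)%nat) => hy.
  + by rewrite /h !stage_colored //; apply: pR.
  + by apply: not_eq_sym; apply: hne; [apply: Rsym | | left].
  + by apply: hne => //; left.
  + have := cR x y Rxy; case: (Nat.lt_total (c x) (c y)) => [lt|[//|lt]] _.
      by apply: not_eq_sym; apply: hne; [apply: Rsym | | right].
    by apply: hne => //; right.
- by move=> x hp; rewrite /h stage_colored.
Qed.

End GreedyColoring.

(** All that is kept of the standard Borel structure: countably many Borel sets separating the
    points, and Borel neighbourhoods of Borel sets. *)
Class lf_graph {X : Type} (Bo : (X -> Prop) -> Prop) (adj : X -> X -> Prop) (D : nat) : Prop := {
  lf_sig : is_sigma_algebra Bo;
  lf_sep : exists U : nat -> X -> Prop, (forall n, Bo (U n)) /\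
             forall x y, x <> y -> exists n, U n x /\ ~ U n y;
  lf_nbr : forall A, Bo A -> Bo (fun x => exists y, adj x y /\ A y);
  lf_sym : forall x y, adj x y -> adj y x;
  lf_irr : forall x, ~ adj x x;
  lf_deg : degree_le adj D }.

Lemma borel_graph_lf {X : Type} (Bo : (X -> Prop) -> Prop) (adj : X -> X -> Prop) (D : nat) :
  borel_graph Bo adj -> degree_le adj D -> lf_graph Bo adj D.
Proof.
case=> [[d [[Hm [Hc [s Hs]]] HB]] [Hsym [Hirr HP]]] Hdeg.
have SA := Bo_sigma d Bo HB.
split => //.
  exists (fun n y => code d s (fst (of_nat n)) y = snd (of_nat n)); split.
    by move=> n; exact: (code_Bo d Hm s Bo HB (fst (of_nat n)) (snd (of_nat n))).
  move=> x y ne; apply: NNPP => H; apply: ne.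
  apply: (code_inj d Hm s Hs) => n; apply: NNPP => ne; apply: H.
  by exists (to_nat (n, code d s n x)); rewrite cancel_of_to /=; split => // E; apply: ne; rewrite E.
by apply: (projection_Bo d Hm Hc s Hs Bo HB _ HP D) => x l h1 h2; apply: (Hdeg x).
Qed.

Fixpoint reach {X : Type} (adj : X -> X -> Prop) (r : nat) (x y : X) : Prop :=
  match r with
  | 0 => x = y
  | S r => reach adj r x y \/ exists z, adj x z /\ reach adj r z y
  end.

Section Colorings.
Context {X : Type} {Bo : (X -> Prop) -> Prop} {adj : X -> X -> Prop} {D : nat}.
Context `{LF : lf_graph X Bo adj D}.
Instance lf_sig' : is_sigma_algebra Bo := lf_sig.

Lemma reach_mono r s x y : (r <= s)%nat -> reach adj r x y -> reach adj s x y.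
Proof. by elim=> [//|m _ IH] /IH h; left. Qed.

Lemma reach_refl r x : reach adj r x x.
Proof. by apply: (reach_mono 0); [lia|]. Qed.

Lemma reach_adj x y : adj x y -> reach adj 1 x y.
Proof. by move=> h; right; exists y. Qed.

Lemma reach_trans r s x y z : reach adj r x y -> reach adj s y z -> reach adj (r + s) x z.
Proof.
elim: r x => [|r IH] x /=; first by move=> ->.
case=> [h|[w [h1 h2]]] h3; first by left; apply: IH h3.
by right; exists w; split => //; apply: IH h3.
Qed.

Lemma reach_sym r x y : reach adj r x y -> reach adj r y x.
Proof.
elim: r x => [|r IH] x /=; first by move=> ->.
case=> [/IH h|[w [h1 /IH h2]]]; first by left.
have := reach_trans r 1 y w x h2 (reach_adj w x (lf_sym _ _ h1)).
by rewrite Nat.add_1_r; apply.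
Qed.

Lemma reach_nbr r A : Bo A -> Bo (fun x => exists y, reach adj r x y /\ A y).
Proof.
move=> HA; elim: r => [|r IH].
  by apply: (S_ext A) => // x; split => [h|[y [<-]]//]; exists x.
apply: (S_ext (fun x => (exists y, reach adj r x y /\ A y) \/
                        (exists z, adj x z /\ exists y, reach adj r z y /\ A y))); last first.
  by apply: S_or => //; apply: lf_nbr.
move=> x; split.
  by case=> [[y [h1 h2]]|[z [h1 [y [h2 h3]]]]]; exists y; split => //; [left | right; exists z].
case=> y [[h1|[z [h1 h2]]] h3]; first by left; exists y.
by right; exists z; split => //; exists y.
Qed.

Lemma nbr_list x : exists l, NoDup l /\ (forall y, adj x y <-> In y l) /\ (length l <= D)%nat.
Proof. exact: bounded_finite (lf_deg x). Qed.

Lemma reach_list r : exists n, forall x, exists l, (length l <= n)%nat /\ forall y, reach adj r x y -> In y l.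
Proof.
elim: r => [|r [n IH]].
  by exists 1%nat => x; exists [x]; split => // y ->; left.
exists (n + D * n)%nat => x; case: (IH x) => l [h1 h2].
case: (choose _ IH) => f Hf; case: (nbr_list x) => ln [_ [h3 h4]].
exists (l ++ flat_map f ln); split.
  rewrite length_app; suff : (length (flat_map f ln) <= length ln * n)%nat by nia.
  elim: (ln) => [|z lz IHz] /=; first by lia.
  by rewrite length_app; case: (Hf z) => ? _; lia.
move=> y [h|[z [h5 h6]]]; apply/in_or_app; first by left; apply: h2.
right; apply/in_flat_map; exists z; split; first by apply/h3.
by case: (Hf z) => _; apply.
Qed.

(** [V w] is a finite intersection of separating sets. Balls are finite, so some [V w] meets the
    ball around [x] in [x] alone; the first such [w] is the color, and two points of one ball cannot
    share it. *)
Lemma countable_coloring r : exists c : X -> nat, measn Bo c /\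
  forall x y, reach adj r x y -> x <> y -> c x <> c y.
Proof.
case: (lf_sep (lf_graph := LF)) => U [UB Usep].
pose V w x := forall n, In n w -> U n x.
have VB w : Bo (V w) by rewrite /V; bor; apply: UB.
(* That [y] differs from [x] is expressed by the sets [U m], which keeps the condition Borel. *)
pose good w x := V w x /\ ~ exists m, U m x /\ exists y, reach adj r x y /\ (~ U m y /\ V w y).
have goodB w : Bo (good w).
  by rewrite /good; bor; [apply: VB | apply: UB | apply: reach_nbr; bor; [apply: UB | apply: VB]].
have goodE x : exists n, good (word n) x.
  suff [w Hw] : exists w, good w x by case: (word_surj w) => n E; exists n; rewrite E.
  case: (reach_list r) => N /(_ x) [l [_ Hl]].
  have [w [h1 h2]] : exists w, V w x /\ forall y, In y l -> y <> x -> ~ V w y.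
    elim: (l) => [|y l' [w [h1 h2]]]; first by exists []; split => ? [].
    case: (classic (y = x)) => [->|ne].
      by exists w; split => // z [->//|]; apply: h2.
    case: (Usep x y (not_eq_sym ne)) => n [k1 k2].
    exists (n :: w); split; first by move=> m [<-//|]; apply: h1.
    move=> z [<-|hz] nez hV; first by apply: k2; apply: hV; left.
    by apply: (h2 z hz nez) => m hm; apply: hV; right.
  exists w; split => // -[m [k1 [y [k2 [k3 k4]]]]].
  by apply: (h2 y) => //; [apply: Hl | move=> E; apply: k3; rewrite E].
exists (fun x => least (fun n => good (word n) x)); split.
  by apply: measn_least => n; apply: goodB.
move=> x y Hr ne E.
case: (proj1 (leastP _ (goodE x))) => _; apply; case: (Usep x y ne) => m [k1 k2].
exists m; split => //; exists y; split => //; split => //; rewrite E.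
by case: (proj1 (leastP _ (goodE y))).
Qed.

Lemma finite_coloring r : exists (M : nat) (kap : X -> nat), measn Bo kap /\ (forall x, (kap x < M)%nat) /\
  forall x y, reach adj r x y -> x <> y -> kap x <> kap y.
Proof.
case: (countable_coloring r) => c [cB cR]; case: (reach_list r) => N HN.
pose R x y := reach adj r x y /\ x <> y.
case: (lf_sep (lf_graph := LF)) => U [UB Usep].
(* The constant [S N] as initial coloring leaves every vertex uncolored. *)
case: (@greedy_coloring X Bo _ R _ _ (S N) _ c cB _ (fun _ => S N)).
- move=> A HA; apply: (S_ext (fun x => exists m, U m x /\ exists y, reach adj r x y /\ (~ U m y /\ A y))).
    move=> x; split.
      by case=> m [h1 [y [h2 [h3 h4]]]]; exists y; split => //; split => // E; apply: h3; rewrite -E.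
    case=> y [[h1 h2] h3]; case: (Usep x y h2) => m [k1 k2].
    by exists m; split => //; exists y.
  by bor; [apply: UB | apply: reach_nbr; bor; apply: UB].
- by move=> x y [h1 h2]; split; [apply: reach_sym | apply: not_eq_sym].
- by move=> x; case: (HN x) => l [h1 h2]; exists l; split; [lia | move=> y [h _]; apply: h2].
- by move=> x y [h1 h2]; apply: cR.
- exact: measn_cst.
- by move=> x y _; lia.
by move=> h [h1 [h2 [h3 _]]]; exists (S N), h; split => //; split => // x y k1 k2; apply: h3.
Qed.

Lemma extend_coloring k (p : X -> nat) : (D < k)%nat -> measn Bo p ->
  (forall x y, adj x y -> (p x < k)%nat -> p x <> p y) ->
  exists h : X -> nat, measn Bo h /\ (forall x, (h x < k)%nat) /\
    (forall x y, adj x y -> h x <> h y) /\ (forall x, (p x < k)%nat -> h x = p x).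
Proof.
move=> Dk pB pR; case: (countable_coloring 1) => c [cB cR].
apply: (@greedy_coloring X Bo _ adj _ _ k _ c cB _ p) => //.
- exact: lf_nbr.
- exact: lf_sym.
- by move=> x; case: (nbr_list x) => l [_ [h1 h2]]; exists l; split; [lia | move=> y /h1].
- by move=> x y h; apply: cR; [apply: reach_adj | move=> E; subst y; apply: lf_irr h].
Qed.

End Colorings.

(** * Actions of countable groups by Borel bijections *)

(** A countable group of Borel bijections with infinite orbits. An element may have several indices,
    so the group laws are existential. *)
Class action {X : Type} (Bo : (X -> Prop) -> Prop) (g : nat -> X -> X) : Prop := {
  ac_sig : is_sigma_algebra Bo;
  ac_sep : exists U : nat -> X -> Prop, (forall n, Bo (U n)) /\
             forall x y, x <> y -> exists n, U n x /\ ~ U n y;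
  ac_meas : forall i, meas Bo Bo (g i);
  ac_id : exists i, forall x, g i x = x;
  ac_comp : forall i j, exists l, forall x, g l x = g i (g j x);
  ac_inv : forall i, exists j, forall x, g j (g i x) = x /\ g i (g j x) = x;
  ac_inf : forall x (l : list X), exists i, ~ In (g i x) l }.

Definition orb {X : Type} (g : nat -> X -> X) (x y : X) : Prop := exists i, g i x = y.

Section Neighbours.
Context {X : Type} {Bo : (X -> Prop) -> Prop} {adj : X -> X -> Prop} {D : nat}.
Context `{LF : lf_graph X Bo adj D}.
Existing Instance lf_sig.
Context (kap : X -> nat) (kB : measn Bo kap).
Context (kR : forall x y, reach adj 2 x y -> x <> y -> kap x <> kap y).

(* The neighbour labelled [b], or [x] itself if there is none. *)
Definition nu (b : nat) (x : X) : X :=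
  epsilon (inhabits x) (fun y => (adj x y /\ kap y = b) \/ (~ (exists z, adj x z /\ kap z = b) /\ y = x)).

Lemma nu_or b x : (adj x (nu b x) /\ kap (nu b x) = b) \/ (~ (exists z, adj x z /\ kap z = b) /\ nu b x = x).
Proof.
apply: (epsilon_spec (inhabits x) (fun y => (adj x y /\ kap y = b) \/ (~ (exists z, adj x z /\ kap z = b) /\ y = x))).
case: (classic (exists z, adj x z /\ kap z = b)) => [[z h]|h]; first by exists z; left.
by exists x; right.
Qed.

Lemma kap_adj x y : adj x y -> kap x <> kap y.
Proof.
move=> h; apply: kR; last by move=> E; subst y; apply: (lf_irr _ h).
by left; apply: reach_adj.
Qed.

Lemma kap_nbrs x y z : adj x y -> adj x z -> kap y = kap z -> y = z.
Proof.
move=> h1 h2 E; apply: NNPP => ne; apply: (kR y z) => //.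
by apply: (reach_trans 1 1 _ x); apply: reach_adj => //; apply: lf_sym.
Qed.

Lemma nu_adj x y : adj x y -> nu (kap y) x = y.
Proof.
move=> h; case: (nu_or (kap y) x) => [[h1 h2]|[[]]]; last by exists y.
exact: (kap_nbrs x).
Qed.

Lemma nu_kap b x : adj x (nu b x) -> kap (nu b x) = b.
Proof. by case: (nu_or b x) => [[]//|[_ ->] h]; case: (lf_irr _ h). Qed.

Lemma adj_nu x y : adj x y <-> exists b, nu b x = y /\ y <> x.
Proof.
split => [h|[b [<- ne]]].
  by exists (kap y); split; [apply: nu_adj | move=> E; subst y; apply: (lf_irr _ h)].
by case: (nu_or b x) => [[]//|[_ E]].
Qed.

Lemma nu_back b x : adj x (nu b x) -> nu (kap x) (nu b x) = x.
Proof. by move=> h; apply: nu_adj; apply: lf_sym. Qed.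

Lemma nu_meas b : meas Bo Bo (nu b).
Proof.
move=> A HA; apply: (S_ext (fun x => (exists y, adj x y /\ (kap y = b /\ A y)) \/
                                   (~ (exists y, adj x y /\ kap y = b) /\ A x))).
  move=> x; split.
    case=> [[y [h1 [h2 h3]]]|[h1 h2]]; first by rewrite -h2 nu_adj.
    by case: (nu_or b x) => [[k1 k2]|[_ ->]//]; case: h1; exists (nu b x).
  by case: (nu_or b x) => [[k1 k2] h|[k1 k2]]; [left; exists (nu b x) | rewrite k2; right].
by bor; apply: lf_nbr; bor; apply: kB.
Qed.

(* These involutions along the edges with end labels [a] and [b] generate a group whose orbits are the
   components. *)
Definition swap (c : nat) (x : X) : X :=
  let (a, b) := of_nat c in
  if Nat.eq_dec (kap x) a then nu b x else if Nat.eq_dec (kap x) b then nu a x else x.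

Lemma swap_meas c : meas Bo Bo (swap c).
Proof.
move=> A HA; rewrite /swap; case: (of_nat c) => a b.
have hb := nu_meas b A HA; have ha := nu_meas a A HA.
apply: (S_ext (fun x => (kap x = a /\ A (nu b x)) \/ (kap x <> a /\ ((kap x = b /\ A (nu a x)) \/
    (kap x <> b /\ A x))))).
  by move=> x; case: (Nat.eq_dec (kap x) a); case: (Nat.eq_dec (kap x) b); tauto.
by bor; apply: kB.
Qed.

Lemma swap_nu a b x : kap x = a -> swap (to_nat (a, b)) x = nu b x.
Proof. by rewrite /swap cancel_of_to; case: (Nat.eq_dec (kap x) a). Qed.

Lemma swap_eq c x : swap c x = x \/ (adj x (swap c x) /\ swap c (swap c x) = x).
Proof.
rewrite /swap; case: (of_nat c) => a b.
case: (Nat.eq_dec (kap x) a) => [Ea|na].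
  case: (nu_or b x) => [[h1 h2]|[_ ->]]; last by left.
  right; split => //; have ne := kap_adj _ _ h1.
  case: (Nat.eq_dec _ a) => [E|_]; first by rewrite E Ea in ne.
  by case: (Nat.eq_dec _ b) => [_|//]; rewrite -Ea nu_back.
case: (Nat.eq_dec (kap x) b) => [Eb|_]; last by left.
case: (nu_or a x) => [[h1 h2]|[_ ->]]; last by left.
right; split => //; case: (Nat.eq_dec _ a) => [_|//].
by rewrite -Eb nu_back.
Qed.

Lemma swapK c x : swap c (swap c x) = x.
Proof. by case: (swap_eq c x) => [E|[_ //]]; rewrite !E. Qed.

Definition walk (w : list nat) (x : X) : X := fold_right swap x w.

Lemma walk_app v w x : walk (v ++ w) x = walk v (walk w x).
Proof. by rewrite /walk fold_right_app. Qed.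

Lemma walk_rev w x : walk (rev w) (walk w x) = x.
Proof. by elim: w x => [|c w IH] x //=; rewrite walk_app /= swapK IH. Qed.

Lemma walk_conn w x : connected adj x (walk w x).
Proof.
elim: w => [|c w IH] /=; first exact: rt_refl.
apply: (rt_trans _ _ _ (walk w x)) => //.
by case: (swap_eq c (walk w x)) => [->|[h _]]; [apply: rt_refl | apply: rt_step].
Qed.

Lemma conn_walk x y : connected adj x y -> exists w, walk w x = y.
Proof.
elim=> [u v h|u|u v w _ [w1 h1] _ [w2 h2]].
- by exists [to_nat (kap u, kap v)]; rewrite /= swap_nu // nu_adj.
- by exists [].
- by exists (w2 ++ w1); rewrite walk_app h1.
Qed.

(** Concatenating words composes the maps and reversing a word inverts them, as the generators are
    involutions; aperiodicity makes the orbits infinite. *)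
Lemma walk_action : aperiodic adj ->
  action Bo (fun n => walk (word n)) /\ forall x y, orb (fun n => walk (word n)) x y <-> connected adj x y.
Proof.
move=> Hap; have Horb x y : orb (fun n => walk (word n)) x y <-> connected adj x y.
  split => [[n <-]|/conn_walk [w E]]; first exact: walk_conn.
  by case: (word_surj w) => n En; exists n; rewrite En.
split => //; split.
- exact: lf_sig.
- exact: lf_sep.
- move=> i; elim: (word i) => [|c w IH] A HA //=.
  by apply: IH (fun x => A (swap c x)) _; apply: swap_meas.
- by case: (word_surj []) => n E; exists n; rewrite E.
- move=> i j; case: (word_surj (word i ++ word j)) => n E; exists n => x.
  by rewrite E walk_app.
- move=> i; case: (word_surj (rev (word i))) => n E; exists n => x; rewrite E walk_rev; split => //.
  by rewrite -{1}(rev_involutive (word i)) walk_rev.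
- move=> x l; case: (Hap x l) => y [/Horb [n <-] h].
  by exists n.
Qed.

End Neighbours.

(** * Real-valued functions, sums and the potential *)

Lemma pow2_eps n : INR (2 ^ n) * eps n = 1.
Proof. by rewrite pow_INR /eps -Rpow_mult_distr /= (_ : (1 + 1) * / 2 = 1) ?pow1 //; lra. Qed.

Lemma eps_add m n : eps (m + n) = eps m * eps n.
Proof. exact: pow_add. Qed.

Definition dyadic_set (a : nat -> nat -> Prop) (r : R) : Prop :=
  exists n j, a n j /\ (j <= 2 ^ n)%nat /\ r = INR j * eps n.

Definition dyadic_sup (a : nat -> nat -> Prop) : R :=
  epsilon (inhabits 0) (fun l => is_lub (dyadic_set a) l).

Lemma dyadic_supP a : a 0%nat 0%nat -> is_lub (dyadic_set a) (dyadic_sup a).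
Proof.
move=> h; apply: (epsilon_spec (inhabits 0) (fun l => is_lub (dyadic_set a) l)).
case: (completeness (dyadic_set a)) => [||l Hl]; last by exists l.
- exists 1 => r [n [j [_ [le ->]]]]; rewrite -(pow2_eps n).
  by apply: Rmult_le_compat_r; [apply: Rlt_le; apply: eps_pos | apply: le_INR].
- by exists 0, 0%nat, 0%nat; split => //; split; [lia | rewrite /=; lra].
Qed.

Lemma dyadic_sup_ge a n j : a 0%nat 0%nat -> a n j -> (j <= 2 ^ n)%nat -> INR j * eps n <= dyadic_sup a.
Proof. by move=> h0 h le; case: (dyadic_supP a h0) => ub _; apply: ub; exists n, j. Qed.

Lemma dyadic_sup_le a r : a 0%nat 0%nat -> (forall n j, a n j -> (j <= 2 ^ n)%nat -> INR j * eps n <= r) ->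
  dyadic_sup a <= r.
Proof. by move=> h0 h; case: (dyadic_supP a h0) => _; apply => _ [n [j [h1 [h2 ->]]]]; apply: h. Qed.

Lemma dyadic_sup_ge0 a : a 0%nat 0%nat -> 0 <= dyadic_sup a.
Proof. by move=> h; have := dyadic_sup_ge a 0 0 h h (Nat.le_0_l _); rewrite /=; lra. Qed.

Lemma dyadic_sup_le1 a : a 0%nat 0%nat -> dyadic_sup a <= 1.
Proof.
move=> h; apply: dyadic_sup_le => // n j _ le; rewrite -(pow2_eps n).
by apply: Rmult_le_compat_r; [apply: Rlt_le; apply: eps_pos | apply: le_INR].
Qed.

Lemma dyadic_double (a : nat -> nat -> Prop) n j m :
  (forall n j, a n j -> a (S n) (2 * j)%nat) -> a n j -> a (m + n)%nat (2 ^ m * j)%nat.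
Proof.
move=> hd h; elim: m => [|m IH]; first by rewrite Nat.mul_1_l.
by rewrite Nat.pow_succ_r' -Nat.mul_assoc; apply: hd.
Qed.

Lemma dyadic_scale n m j : INR (2 ^ m * j) * eps (m + n) = INR j * eps n.
Proof. by rewrite mult_INR eps_add -{2}(Rmult_1_l (INR j)) -(pow2_eps m); lra. Qed.

(** Subadditivity up to one unit at every scale is enough: rescaling by [2 ^ N] shrinks this error
    below [eps N]. *)
Lemma dyadic_sup_add (a b c : nat -> nat -> Prop) :
  a 0%nat 0%nat -> b 0%nat 0%nat -> c 0%nat 0%nat ->
  (forall n j, a n j -> a (S n) (2 * j)%nat) -> (forall n j, b n j -> b (S n) (2 * j)%nat) ->
  (forall n j, c n j -> c (S n) (2 * j)%nat) ->
  (forall n j, a n j -> (j <= 2 ^ n)%nat) -> (forall n j, b n j -> (j <= 2 ^ n)%nat) ->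
  (forall n j, c n j -> (j <= 2 ^ n)%nat) ->
  (forall n i j, a n i -> b n j -> c n (i + j)%nat) ->
  (forall n l, c n l -> exists i j, a n i /\ b n j /\ (l <= i + j + 1)%nat) ->
  dyadic_sup c = dyadic_sup a + dyadic_sup b.
Proof.
move=> a0 b0 c0 ad bd cd ab bb cb sup sub; apply: Rle_antisym.
  apply: dyadic_sup_le => // n l h _.
  suff H N : INR l * eps n <= dyadic_sup a + dyadic_sup b + eps N.
    apply: Rnot_lt_le => lt.
    case: (eps_small (INR l * eps n - (dyadic_sup a + dyadic_sup b))) => [|N HN]; first by lra.
    by have := H N; lra.
  rewrite -(dyadic_scale n N).
  case: (sub _ _ (dyadic_double c n l N cd h)) => i [j [hi [hj le]]].
  have := dyadic_sup_ge a _ _ a0 hi (ab _ _ hi); have := dyadic_sup_ge b _ _ b0 hj (bb _ _ hj).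
  have := eps_mono N (N + n) ltac:(lia); have p := eps_pos (N + n).
  have : INR (2 ^ N * l) <= INR i + INR j + 1.
    by have := le_INR _ _ le; rewrite !plus_INR /=; lra.
  move/(Rmult_le_compat_r (eps (N + n)) _ _ (Rlt_le _ _ p)); lra.
suff : dyadic_sup a <= dyadic_sup c - dyadic_sup b by lra.
apply: dyadic_sup_le => // n i hi _.
suff : dyadic_sup b <= dyadic_sup c - INR i * eps n by lra.
apply: dyadic_sup_le => // n' j hj _.
have hi' := dyadic_double a n i n' ad hi.
have hj' := dyadic_double b n' j n bd hj; rewrite (Nat.add_comm n n') in hj'.
have hc := sup _ _ _ hi' hj'.
have := dyadic_sup_ge c _ _ c0 hc (cb _ _ hc).
rewrite plus_INR Rmult_plus_distr_r dyadic_scale (Nat.add_comm n' n) dyadic_scale; lra.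
Qed.

Fixpoint rsum (f : nat -> R) (n : nat) : R :=
  match n with 0 => 0 | S n => rsum f n + f n end.

Lemma rsum_mono f m n : (forall i, 0 <= f i) -> (m <= n)%nat -> rsum f m <= rsum f n.
Proof. by move=> h; elim=> [|k _ IH] /=; [lra | have := h k; lra]. Qed.

Lemma rsum_le f h n : (forall i, (i < n)%nat -> f i <= h i) -> rsum f n <= rsum h n.
Proof.
elim: n => [|n IH] H /=; first by lra.
by have := H n ltac:(lia); have := IH (fun i lt => H i ltac:(lia)); lra.
Qed.

Lemma rsum_shift f a n : rsum f (a + n) = rsum f a + rsum (fun i => f (a + i)%nat) n.
Proof.
elim: n => [|n IH]; first by rewrite Nat.add_0_r /=; lra.
by rewrite Nat.add_succ_r /= IH; lra.
Qed.

Lemma rsum_tail f r : (forall i, 0 <= f i) -> (forall n, rsum f n <= r) ->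
  forall e, 0 < e -> exists a, forall n, rsum (fun i => f (a + i)%nat) n <= e.
Proof.
move=> h0 hr e he.
case: (completeness (fun s => exists n, s = rsum f n)) => [||s [ub lub]].
- by exists r => s [n ->].
- by exists 0, 0%nat.
have [a ha] : exists a, s - e < rsum f a.
  apply: NNPP => H; have : s <= s - e; last by lra.
  by apply: lub => _ [n ->]; apply: Rnot_lt_le => lt; apply: H; exists n.
exists a => n; have : rsum f (a + n) <= s by apply: ub; exists (a + n)%nat.
by rewrite rsum_shift; lra.
Qed.

(** The numbers [(a - b) / 2 ^ c], coded by triples: a countable dense set of reals. *)
Definition rat (n : nat) : R :=
  (INR (fst (of_nat n)) - INR (fst (of_nat (snd (of_nat n))))) * eps (snd (of_nat (snd (of_nat n)))).

Lemma rat_dense x y : x < y -> exists n, x < rat n /\ rat n < y.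
Proof.
move=> lt; case: (eps_small (y - x)) => [|c Hc]; first by lra.
have pc := eps_pos c; have [h1 h2] := archimed (x / eps c).
set z := up _ in h1 h2.
have [a [b Ez]] : exists a b : nat, IZR z = INR a - INR b.
  case: (Z_le_gt_dec 0 z) => hz.
    by exists (Z.to_nat z), 0%nat; rewrite INR_IZR_INZ Z2Nat.id //=; lra.
  by exists 0%nat, (Z.to_nat (- z)); rewrite (INR_IZR_INZ (Z.to_nat _)) Z2Nat.id ?opp_IZR /=; [lia | lra].
exists (to_nat (a, to_nat (b, c))); rewrite /rat !cancel_of_to /= ?cancel_of_to /= -Ez.
have Ex : x = x / eps c * eps c by field; lra.
have l1 : x / eps c * eps c < IZR z * eps c by apply: Rmult_lt_compat_r => //; lra.
have l2 : IZR z * eps c <= (x / eps c + 1) * eps c by apply: Rmult_le_compat_r; lra.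
by split; [rewrite {1}Ex | rewrite Rmult_plus_distr_r -Ex in l2]; lra.
Qed.

Definition measR {X : Type} (S : (X -> Prop) -> Prop) (f : X -> R) : Prop := forall q, S (fun x => q < f x).

Section MeasR.
Context {X : Type} {S : (X -> Prop) -> Prop} `{SA : is_sigma_algebra X S}.

Lemma measR_lt f h : measR S f -> measR S h -> S (fun x => f x < h x).
Proof.
move=> hf hh; apply: (S_ext (fun x => exists n, ~ (rat n < f x) /\ rat n < h x)).
  move=> x; split => [[n [h1 h2]]|lt]; first by lra.
  by case: (rat_dense _ _ lt) => n [h1 h2]; exists n; split => //; lra.
by bor; [apply: hf | apply: hh].
Qed.

Lemma measR_cst c : measR S (fun _ => c).
Proof. by move=> q; apply: S_cst. Qed.

Lemma measR_add f h : measR S f -> measR S h -> measR S (fun x => f x + h x).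
Proof.
move=> hf hh q; apply: (S_ext (fun x => exists n, rat n < f x /\ q - rat n < h x)).
  move=> x; split => [[n [h1 h2]]|lt]; first by lra.
  by case: (rat_dense (q - h x) (f x)) => [|n [h1 h2]]; [lra | exists n; split => //; lra].
by bor; [apply: hf | apply: hh].
Qed.

Lemma measR_rsum (f : nat -> X -> R) n : (forall i, measR S (f i)) -> measR S (fun x => rsum (fun i => f i x) n).
Proof. by move=> h; elim: n => [|n IH] /=; [apply: measR_cst | apply: measR_add]. Qed.

Lemma measR_eq f h : measR S f -> measR S h -> S (fun x => f x = h x).
Proof.
move=> hf hh; apply: (S_ext (fun x => ~ (f x < h x) /\ ~ (h x < f x))).
  by move=> x; split => [|->]; lra.
by apply: S_and; apply: S_not; apply: measR_lt.
Qed.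

End MeasR.

(** * Indicators, finite sums and sets of colors *)

Definition indic (P : Prop) : nat := if dec P then 1%nat else 0%nat.

Lemma indic_true P : P -> indic P = 1%nat.
Proof. by rewrite /indic; case: (dec P). Qed.

Lemma indic_false P : ~ P -> indic P = 0%nat.
Proof. by rewrite /indic; case: (dec P). Qed.

(** Lists of sets stand for nonnegative integer-valued functions; comparing these pointwise compares
    sums of densities, see [total_le]. *)
Definition multiplicity {X : Type} (l : list (X -> Prop)) (x : X) : nat :=
  list_sum (map (fun A => indic (A x)) l).

Fixpoint nsum (f : nat -> nat) (n : nat) : nat :=
  match n with 0 => 0%nat | S n => (nsum f n + f n)%nat end.

Lemma nsum_ext f h n : (forall i, (i < n)%nat -> f i = h i) -> nsum f n = nsum h n.
Proof. by elim: n => [|n IH] H //=; rewrite IH ?H //; lia || move=> i lt; apply: H; lia. Qed.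

Lemma nsum_le f h n : (forall i, (i < n)%nat -> (f i <= h i)%nat) -> (nsum f n <= nsum h n)%nat.
Proof.
elim: n => [|n IH] H //=; have := H n ltac:(lia); have := IH (fun i lt => H i ltac:(lia)); lia.
Qed.

Lemma nsum_add f h n : nsum (fun i => f i + h i)%nat n = (nsum f n + nsum h n)%nat.
Proof. by elim: n => [|n IH] //=; lia. Qed.

Lemma nsum_mul c f n : nsum (fun i => c * f i)%nat n = (c * nsum f n)%nat.
Proof. by elim: n => [|n IH] /=; lia. Qed.

Lemma nsum_zero f n : (forall i, (i < n)%nat -> f i = 0%nat) -> nsum f n = 0%nat.
Proof. by elim: n => [|n IH] H //=; rewrite IH ?H //; lia || move=> i lt; apply: H; lia. Qed.

Lemma nsum_swap f n m : nsum (fun i => nsum (f i) m) n = nsum (fun j => nsum (fun i => f i j) n) m.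
Proof.
elim: n => [|n IH] /=; first by rewrite nsum_zero.
by rewrite IH -nsum_add.
Qed.

Lemma nsum_update f h n a : (a < n)%nat -> (forall i, (i < n)%nat -> i <> a -> f i = h i) ->
  (nsum f n + h a = nsum h n + f a)%nat.
Proof.
elim: n => [|n IH] lt H /=; first by lia.
case: (Nat.eq_dec a n) => [e|ne].
  subst a; rewrite (nsum_ext f h n); first by move=> i lti; apply: H; lia.
  by lia.
have := IH ltac:(lia) (fun i lti => H i ltac:(lia)); rewrite (H n); lia.
Qed.

Lemma nsum_single f n a : (a < n)%nat -> (forall i, (i < n)%nat -> i <> a -> f i = 0%nat) -> nsum f n = f a.
Proof.
move=> lt H; have := nsum_update f (fun _ => 0%nat) n a lt H.
by rewrite (nsum_zero (fun _ => 0%nat)) //; lia.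
Qed.

Lemma nsum_ge1 f n a : (a < n)%nat -> (f a <= nsum f n)%nat.
Proof.
move=> lt; pose h i := if Nat.eq_dec i a then f a else 0%nat.
have <- : nsum h n = f a.
  by rewrite (nsum_single h n a) // /h => [i _|]; case: (Nat.eq_dec _ a).
by apply: nsum_le => i _; rewrite /h; case: (Nat.eq_dec i a) => [->|]; lia.
Qed.

Lemma nsum_ge2 f n a b : (a < n)%nat -> (b < n)%nat -> a <> b -> (f a + f b <= nsum f n)%nat.
Proof.
move=> la lb ne; pose h i := if Nat.eq_dec i a then 0%nat else f i.
have ha : h a = 0%nat by rewrite /h; case: (Nat.eq_dec a a).
have hb : h b = f b by rewrite /h; case: (Nat.eq_dec b a) => // e; subst b.
have := nsum_ge1 h n b lb; rewrite hb.
have Eq : (nsum f n + h a = nsum h n + f a)%nat.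
  by apply: nsum_update => // i _ ni; rewrite /h; case: (Nat.eq_dec i a).
by lia.
Qed.

Lemma indic_le (P Q : Prop) : (P -> Q) -> (indic P <= indic Q)%nat.
Proof. by move=> h; rewrite /indic; case: (dec P) => p; case: (dec Q) => q; lia || (case: q; auto). Qed.

Lemma indic_iff (P Q : Prop) : (P <-> Q) -> indic P = indic Q.
Proof. by case=> h1 h2; apply: Nat.le_antisymm; apply: indic_le. Qed.

Lemma indic_le1 P : (indic P <= 1)%nat.
Proof. by rewrite /indic; case: (dec P) => _; lia. Qed.

(* Natural numbers code sets of colors by their binary digits. *)
Definition cset (c al : nat) : Prop := Nat.testbit c al = true.

Definition card (k c : nat) : nat := nsum (fun al => indic (cset c al)) k.

Lemma cset_code k (d : nat -> Prop) : exists c, (c < 2 ^ k)%nat /\ forall al, (al < k)%nat -> cset c al <-> d al.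
Proof.
elim: k d => [|k IH] d; first by exists 0%nat; split => /=; [lia | move=> al; lia].
case: (IH (fun al => d (S al))) => c [h1 h2].
exists (2 * c + indic (d 0%nat))%nat; split.
  by have := indic_le1 (d 0%nat); rewrite Nat.pow_succ_r'; lia.
move=> [|al] lt; rewrite /cset.
  rewrite /indic; case: (dec (d 0%nat)) => h; first by rewrite Nat.testbit_odd_0.
  by rewrite Nat.add_0_r Nat.testbit_even_0; split.
rewrite /indic; case: (dec (d 0%nat)) => h; first by rewrite Nat.testbit_odd_succ; [lia | apply: h2; lia].
by rewrite Nat.add_0_r Nat.testbit_even_succ; [lia | apply: h2; lia].
Qed.

Lemma cset_ext k c c' : (c < 2 ^ k)%nat -> (c' < 2 ^ k)%nat -> (forall al, (al < k)%nat -> cset c al <-> cset c' al) -> c = c'.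
Proof.
move=> h h' H; apply: Nat.bits_inj => al.
case: (le_lt_dec k al) => lt.
  have low n : (n < 2 ^ k)%nat -> Nat.testbit n al = false.
    move=> hn; case: (Nat.eq_dec n 0) => [->|ne]; first exact: Nat.bits_0.
    apply: Nat.bits_above_log2; apply: (Nat.lt_le_trans _ k) => //.
    by apply/Nat.log2_lt_pow2; lia.
  by rewrite !low.
have := H al lt; rewrite /cset; case: (Nat.testbit c al); case: (Nat.testbit c' al) => // -[h1 h2].
  by rewrite h1.
by rewrite h2.
Qed.

Lemma card_lt k c c' b : (forall al, (al < k)%nat -> cset c al -> cset c' al) -> (b < k)%nat -> cset c' b -> ~ cset c b ->
  (card k c < card k c')%nat.
Proof.
move=> H lt h1 h2; rewrite /card.
pose h al := if Nat.eq_dec al b then 1%nat else indic (cset c al).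
have le : (nsum h k <= nsum (fun al => indic (cset c' al)) k)%nat.
  apply: nsum_le => al lta; rewrite /h; case: (Nat.eq_dec al b) => [->|_]; first by rewrite indic_true.
  by apply: indic_le; apply: H.
have Eq : (nsum (fun al => indic (cset c al)) k + h b = nsum h k + indic (cset c b))%nat.
  by apply: (nsum_update (fun al => indic (cset c al))) => // al _ ne; rewrite /h; case: (Nat.eq_dec al b).
rewrite (indic_false (cset c b)) // in Eq.
have hb : h b = 1%nat by rewrite /h; case: (Nat.eq_dec b b).
by lia.
Qed.

Lemma card_exchange k c a b : (a < k)%nat -> (b < k)%nat -> cset c a -> ~ cset c b ->
  exists c', (c' < 2 ^ k)%nat /\ card k c' = card k c /\
    forall al, (al < k)%nat -> cset c' al <-> ((cset c al /\ al <> a) \/ al = b).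
Proof.
move=> la lb ha hb.
case: (cset_code k (fun al => (cset c al /\ al <> a) \/ al = b)) => c' [h1 h2].
exists c'; split => //; split => //.
have ne : a <> b by move=> e; apply: hb; rewrite -e.
case: (cset_code k (fun al => cset c al /\ al <> a)) => c0 [k1 k2].
rewrite /card.
have e1 : (nsum (fun al => indic (cset c al)) k + indic (cset c0 a) =
           nsum (fun al => indic (cset c0 al)) k + indic (cset c a))%nat.
  by apply: (nsum_update (fun al => indic (cset c al))) => // al lt n; apply: indic_iff; rewrite k2 //; tauto.
have e2 : (nsum (fun al => indic (cset c' al)) k + indic (cset c0 b) =
           nsum (fun al => indic (cset c0 al)) k + indic (cset c' b))%nat.
  by apply: (nsum_update (fun al => indic (cset c' al))) => // al lt n; apply: indic_iff; rewrite k2 // h2 //; tauto.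
have f1 : ~ cset c0 a by rewrite k2 //; tauto.
have f2 : ~ cset c0 b by rewrite k2 //; tauto.
have f3 : cset c' b by rewrite h2 //; tauto.
by rewrite indic_false // (indic_true _ ha) in e1; rewrite (indic_false _ f2) (indic_true _ f3) in e2; lia.
Qed.

Section Potential.
Context (k : nat).

(** If [mu c] is the density of the union of the classes in [c], this is the sum of the [j] largest
    class densities. *)
Definition top (mu : nat -> R) (j : nat) : R :=
  fold_right Rmax 0 (map mu (filter (fun c => Nat.eqb (card k c) j) (seq 0 (2 ^ k)))).

(* The weights 2^j make a loss for the [j] largest classes outweigh the same gain for all smaller [j]. *)
Definition potential (mu : nat -> R) : R := rsum (fun j => 2 ^ j * top mu j) (S k).

Lemma top_ge mu c : (c < 2 ^ k)%nat -> mu c <= top mu (card k c).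
Proof.
move=> lt; rewrite /top.
have : In c (filter (fun c' => Nat.eqb (card k c') (card k c)) (seq 0 (2 ^ k))).
  by apply/filter_In; split; [apply/in_seq; lia | apply: Nat.eqb_refl].
elim: (filter _ _) => [|a l IH] //= [->|/IH h]; first exact: Rmax_l.
by apply: Rle_trans h (Rmax_r _ _).
Qed.

Lemma top_le mu j r : 0 <= r -> (forall c, (c < 2 ^ k)%nat -> card k c = j -> mu c <= r) -> top mu j <= r.
Proof.
move=> h0 H; rewrite /top.
have : forall c, In c (filter (fun c' => Nat.eqb (card k c') j) (seq 0 (2 ^ k))) -> mu c <= r.
  by move=> c /filter_In [/in_seq h1 /Nat.eqb_eq h2]; apply: H => //; lia.
elim: (filter _ _) => [|a l IH] //= hl; apply: Rmax_lub; first by apply: hl; left.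
by apply: IH => c hc; apply: hl; right.
Qed.

Lemma top_ge0 mu j : 0 <= top mu j.
Proof. by rewrite /top; elim: (map _ _) => [|a l IH] /=; [lra | apply: Rle_trans IH (Rmax_r _ _)]. Qed.

Lemma potential_ge0 mu : 0 <= potential mu.
Proof.
rewrite /potential; elim: (S k) => [|n IH] /=; first by lra.
have : 0 <= 2 ^ n * top mu n by apply: Rmult_le_pos; [apply: pow_le; lra | apply: top_ge0].
by lra.
Qed.

(** Sets below [B] gain at most [e], sets above [B] gain nothing, and [B] loses [e]. A set
    incomparable with [B] may gain up to [K * e], but exchanging one of its colors for one of [B]
    shows that it was at least [(K + 1) * e] below the maximum for its size. With [b] the size of
    [B], the total change is at most [(2 ^ 0 + ... + 2 ^ (b - 1)) * e - 2 ^ b * e = - e]. *)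
Lemma potential_drop (mu mu' : nat -> R) (B : nat) (e K : R) :
  (B < 2 ^ k)%nat -> 0 <= e -> 0 <= K -> (forall c, 0 <= mu' c) ->
  (forall c, (forall al, (al < k)%nat -> cset c al -> cset B al) -> mu' c <= mu c + e) ->
  (forall c, (forall al, (al < k)%nat -> cset B al -> cset c al) -> mu' c <= mu c) ->
  mu' B + e <= mu B ->
  (forall c, mu' c <= mu c + K * e) ->
  (0 < e -> forall c a b, (a < k)%nat -> (b < k)%nat -> cset c a -> ~ cset B a -> cset B b -> ~ cset c b ->
     exists c', (c' < 2 ^ k)%nat /\ card k c' = card k c /\ mu c + (K + 1) * e <= mu c') ->
  potential mu' + e <= potential mu.
Proof.
move=> hB e0 K0 mu0 h1 h2 h3 h4 h5.
pose b := card k B.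
pose de j := if lt_dec j b then 1 else if Nat.eq_dec j b then -1 else 0.
have htop j : top mu' j <= top mu j + de j * e.
  apply: top_le => [|c lc Ec].
    have tj := top_ge0 mu j; rewrite /de; case: (lt_dec j b) => _; first by lra.
    case: (Nat.eq_dec j b) => [->|_]; last by lra.
    by have := top_ge mu B hB; rewrite -/b; have := mu0 B; lra.
  have tc := top_ge mu c lc; rewrite Ec in tc.
  case: (Req_dec e 0) => [Ez|ne].
    by have := h4 c; rewrite Ez !Rmult_0_r !Rplus_0_r; lra.
  have ep : 0 < e by lra.
  have dl : -1 <= de j by rewrite /de; case: (lt_dec j b) => _; [|case: (Nat.eq_dec j b) => _]; lra.
  case: (classic (exists al, (al < k)%nat /\ cset c al /\ ~ cset B al)) => [[al [la [ca nB]]]|sub].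
    case: (classic (exists be, (be < k)%nat /\ cset B be /\ ~ cset c be)) => [[be [lb [Bb nc]]]|sup].
      case: (h5 ep c al be) => // c' [k1 [k2 k3]].
      have := top_ge mu c' k1; rewrite k2 Ec => tc'; have := h4 c.
      have : -1 * e <= de j * e by apply: Rmult_le_compat_r.
      by lra.
    have hsup x : (x < k)%nat -> cset B x -> cset c x.
      by move=> lx Bx; apply: NNPP => n; apply: sup; exists x.
    have lt : (b < j)%nat by rewrite -Ec; apply: (card_lt k B c al).
    have -> : de j = 0 by rewrite /de; case: (lt_dec j b); [lia | case: (Nat.eq_dec j b) => //; lia].
    by have := h2 c hsup; lra.
  have hsub x : (x < k)%nat -> cset c x -> cset B x.
    by move=> lx cx; apply: NNPP => n; apply: sub; exists x.
  case: (classic (exists be, (be < k)%nat /\ cset B be /\ ~ cset c be)) => [[be [lb [Bb nc]]]|sup].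
    have lt : (j < b)%nat by rewrite -Ec; apply: (card_lt k c B be).
    have -> : de j = 1 by rewrite /de; case: (lt_dec j b).
    by have := h1 c hsub; lra.
  have EB : c = B.
    apply: (cset_ext k) => // x lx; split; first exact: hsub.
    by move=> Bx; apply: NNPP => n; apply: sup; exists x.
  have Ej : j = b by rewrite -Ec EB.
  have -> : de j = -1 by rewrite /de Ej; case: (lt_dec b b); [lia | case: (Nat.eq_dec b b)].
  by rewrite EB in tc *; lra.
have hsum n : rsum (fun j => 2 ^ j * top mu' j) n <= rsum (fun j => 2 ^ j * top mu j) n + rsum (fun j => 2 ^ j * de j) n * e.
  elim: n => [|n IH] /=; first by lra.
  have : 2 ^ n * top mu' n <= 2 ^ n * (top mu n + de n * e).
    by apply: Rmult_le_compat_l => //; apply: pow_le; lra.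
  by lra.
have hde n : rsum (fun j => 2 ^ j * de j) n = if le_lt_dec n b then 2 ^ n - 1 else -1.
  elim: n => [|n IH]; first by case: (le_lt_dec 0 b) => l /=; [lra | lia].
  have -> : rsum (fun j => 2 ^ j * de j) (S n) = rsum (fun j => 2 ^ j * de j) n + 2 ^ n * de n by [].
  have p2 : 2 ^ S n = 2 * 2 ^ n by [].
  rewrite IH /de; case: (le_lt_dec n b) => l1; case: (le_lt_dec (S n) b) => l2; try lia.
  - by case: (lt_dec n b) => l3; [lra | lia].
  - by case: (lt_dec n b) => l3; [lia | case: (Nat.eq_dec n b) => l4; [lra | lia]].
  - by case: (lt_dec n b) => l3; [lia | case: (Nat.eq_dec n b) => l4; [lia | lra]].
have bk : (b <= k)%nat.
  rewrite /b /card; elim: (k) => [|n IH] //=; have := indic_le1 (cset B n); lia.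
have := hsum (S k); rewrite hde /potential; case: (le_lt_dec (S k) b) => l; first by lia.
by lra.
Qed.

End Potential.

Lemma rsum_lt f h n : (forall i, (i < n)%nat -> f i <= h i) -> (exists i, (i < n)%nat /\ f i < h i) ->
  rsum f n < rsum h n.
Proof.
elim: n => [|n IH] le [i [lt hi]] /=; first by lia.
have len := le n ltac:(lia); case: (Nat.eq_dec i n) => [e|ne].
  by subst i; have := rsum_le f h n (fun i l => le i ltac:(lia)); lra.
have : rsum f n < rsum h n by apply: IH => [j l|]; [apply: le; lia | exists i; split => //; lia].
by lra.
Qed.

Lemma rsum_scal c f n : rsum (fun i => c * f i) n = c * rsum f n.
Proof. by elim: n => [|n IH] /=; [lra | rewrite IH; lra]. Qed.

Lemma INR_nsum f n : INR (nsum f n) = rsum (fun i => INR (f i)) n.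
Proof. by elim: n => [|n IH] //=; rewrite plus_INR IH. Qed.

Lemma fact_divide d b : (0 < d)%nat -> (d <= b)%nat -> exists q, fact b = (q * d)%nat.
Proof.
move=> d0; elim: b => [|b IH] le; first by lia.
case: (Nat.eq_dec d (S b)) => [->|ne]; first by exists (fact b); rewrite /fact -/(fact b); lia.
case: IH => [|q Eq]; first by lia.
by exists (S b * q)%nat; rewrite -[fact (S b)]/(S b * fact b)%nat Eq; lia.
Qed.

(** * Embeddings along orbits and compressible sets *)

Section Action.
Context {X : Type} {Bo : (X -> Prop) -> Prop} {g : nat -> X -> X} `{AC : action X Bo g}.
Existing Instance ac_sig.

Local Notation E := (orb g).

Lemma orb_refl x : E x x.
Proof. by case: ac_id => i h; exists i. Qed.

Lemma orb_sym x y : E x y -> E y x.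
Proof. by case=> i <-; case: (ac_inv i) => j h; exists j; case: (h x). Qed.

Lemma orb_trans x y z : E x y -> E y z -> E x z.
Proof. by case=> i <- [j <-]; case: (ac_comp j i) => l h; exists l. Qed.

Lemma orb_g i x : E x (g i x).
Proof. by exists i. Qed.

Definition saturation (A : X -> Prop) (x : X) : Prop := exists i, A (g i x).

Definition invariant (Z : X -> Prop) : Prop := forall x y, E x y -> Z x -> Z y.

Lemma saturation_orb A x : saturation A x <-> exists y, E x y /\ A y.
Proof. by split => [[i h]|[y [[i <-] h]]]; [exists (g i x); split => //; exists i | exists i]. Qed.

Lemma saturation_inv A : invariant (saturation A).
Proof.
move=> x y h /saturation_orb [z [h1 h2]]; apply/saturation_orb; exists z; split => //.
by apply: orb_trans h1; apply: orb_sym.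
Qed.

Lemma saturation_sub (A : X -> Prop) x : A x -> saturation A x.
Proof. by move=> h; apply/saturation_orb; exists x; split => //; apply: orb_refl. Qed.

Lemma saturation_Bo A : Bo A -> Bo (saturation A).
Proof. by move=> h; rewrite /saturation; apply: S_ex => i; apply: ac_meas. Qed.

Lemma invariant_not Z : invariant Z -> invariant (fun x => ~ Z x).
Proof. by move=> h x y /orb_sym e nz z; apply: nz; apply: h z. Qed.

Lemma eq_Bo (f h : X -> X) : meas Bo Bo f -> meas Bo Bo h -> Bo (fun x => f x = h x).
Proof.
move=> Hf Hh; case: ac_sep => U [UB Us].
apply: (S_ext (fun x => forall n, U n (f x) <-> U n (h x))).
  move=> x; split => [H|->//]; apply: NNPP => ne; case: (Us _ _ ne) => n [h1]; apply.
  by apply/H.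
by bor; [apply: (Hf _ (UB _)) | apply: (Hh _ (UB _))].
Qed.

Lemma meas_id : meas Bo Bo (fun x : X => x).
Proof. by []. Qed.

Lemma meas_comp (f h : X -> X) : meas Bo Bo f -> meas Bo Bo h -> meas Bo Bo (fun x => f (h x)).
Proof. by move=> Hf Hh A HA; apply: (Hh (fun x => A (f x))); apply: Hf. Qed.

(** Applies the first group element that works; the default [x] keeps the map inside the orbits. *)
Definition select (P : nat -> X -> Prop) (x : X) : X :=
  if dec (exists i, P i x) then g (least (fun i => P i x)) x else x.

Lemma select_orb P x : E x (select P x).
Proof. by rewrite /select; case: (dec _) => _; [apply: orb_g | apply: orb_refl]. Qed.

Lemma select_meas P : (forall i, Bo (P i)) -> meas Bo Bo (select P).
Proof.
move=> HP A HA; apply: (S_if _ _ _ (fun _ => A)) => //; first by bor; apply: HP.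
apply: (measn_pre (fun x => least (fun i => P i x)) (fun x n => A (g n x))).
  exact: measn_least.
by move=> n; apply: ac_meas.
Qed.

Lemma selectP P x : (exists i, P i x) ->
  exists i, P i x /\ select P x = g i x /\ forall j, (j < i)%nat -> ~ P j x.
Proof.
move=> H; rewrite /select; case: (dec _) => // _.
by case: (leastP _ H) => h1 h2; exists (least (fun i => P i x)).
Qed.

(* Subsets of [nat * X] serve as countable families of subsets of [X], i.e. as sets with multiplicities. *)
Definition borel2 (F : nat * X -> Prop) : Prop := forall i, Bo (fun x => F (i, x)).

Definition morphism2 (Th : nat * X -> nat * X) : Prop :=
  (forall F, borel2 F -> borel2 (fun q => F (Th q))) /\ forall q, E (snd q) (snd (Th q)).

(** The witness is total and Borel throughout but injective on [F] only, so it restricts to smaller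
    families as it is. *)
Definition emb (F G : nat * X -> Prop) : Prop :=
  exists Th, morphism2 Th /\ (forall q, F q -> G (Th q)) /\
             (forall q r, F q -> F r -> Th q = Th r -> q = r).

Definition single (A : X -> Prop) (q : nat * X) : Prop := fst q = 0%nat /\ A (snd q).
Definition infinite_copies (A : X -> Prop) (q : nat * X) : Prop := A (snd q).
Definition copies (j : nat) (A : X -> Prop) (q : nat * X) : Prop := (fst q < j)%nat /\ A (snd q).

Lemma morphism2_mk (lam : nat -> X -> nat) (phi : nat -> X -> X) :
  (forall i, measn Bo (lam i)) -> (forall i, meas Bo Bo (phi i)) -> (forall i x, E x (phi i x)) ->
  morphism2 (fun q => (lam (fst q) (snd q), phi (fst q) (snd q))).
Proof.
move=> hl hp he; split => [F HF i|[i x]] /=; last exact: he.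
apply: (measn_pre (lam i) (fun x n => F (n, phi i x))) => // n.
by apply: (hp i (fun y => F (n, y))); apply: HF.
Qed.

Lemma morphism2_comp Th Ph : morphism2 Th -> morphism2 Ph -> morphism2 (fun q => Th (Ph q)).
Proof.
case=> h1 h2 [h3 h4]; split => [F HF|q]; first by apply: h3 (fun q => F (Th q)) _; apply: h1.
by apply: orb_trans (h4 q) (h2 _).
Qed.

Lemma emb_sub (F G : nat * X -> Prop) : (forall q, F q -> G q) -> emb F G.
Proof. by move=> h; exists (fun q => q); split => //; split => // q; apply: orb_refl. Qed.

Lemma emb_trans F G H : emb F G -> emb G H -> emb F H.
Proof.
case=> Th [h1 [h2 h3]] [Ph [k1 [k2 k3]]]; exists (fun q => Ph (Th q)).
split; first exact: morphism2_comp.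
split => [q Fq|q r Fq Fr Eq]; first by apply: k2; apply: h2.
by apply: h3 => //; apply: k3 => //; apply: h2.
Qed.

(** Unions of orbits can be embedded independently, since images in different orbits never
    collide. *)
Lemma emb_pieces (idx : X -> nat) F G : measn Bo idx -> (forall x y, E x y -> idx x = idx y) ->
  (forall j, emb (fun q => F q /\ idx (snd q) = j) G) -> emb F G.
Proof.
move=> hB hi /choose [Th HTh].
exists (fun q => Th (idx (snd q)) q); split; [split|split].
- move=> H HH i /=; apply: (measn_pre idx (fun x n => H (Th n (i, x)))) => // n.
  by case: (HTh n) => -[h _] _; apply: h.
- by move=> q; case: (HTh (idx (snd q))) => -[_ h] _.
- by move=> q Fq; case: (HTh (idx (snd q))) => _ [h _]; apply: h.
- move=> q r Fq Fr Eq.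
  have Ei : idx (snd q) = idx (snd r).
    case: (HTh (idx (snd q))) => -[_ h] _; case: (HTh (idx (snd r))) => -[_ h'] _.
    by rewrite (hi _ _ (h q)) (hi _ _ (h' r)) Eq.
  by case: (HTh (idx (snd q))) => _ [_ h]; apply: h => //; rewrite {2}Ei -?Eq.
Qed.

(* Compressible sets play the role of null sets. *)
Definition null (A : X -> Prop) : Prop := Bo A /\ emb (infinite_copies A) (single (fun _ => True)).

(** The copy number and the index inside [infinite_copies B] are paired into one index. *)
Lemma emb_infinite A B : emb (single A) (infinite_copies B) -> emb (infinite_copies A) (infinite_copies B).
Proof.
case=> Th [[h1 h2] [h3 h4]].
exists (fun q => (to_nat (fst q, fst (Th (0%nat, snd q))), snd (Th (0%nat, snd q)))).
split; [split|split].
- move=> F HF i /=.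
  apply: (h1 (fun q => F (to_nat (i, fst q), snd q)) _ 0%nat) => j /=; exact: HF.
- by move=> q; apply: (h2 (0%nat, snd q)).
- by move=> [i x] hx; apply: (h3 (0%nat, x)).
- move=> [i x] [j y] hx hy /= Eq.
  have E1 := to_nat_inj _ _ (f_equal fst Eq); have := f_equal snd Eq => /= E2.
  have [] : i = j /\ (0%nat, x) = (0%nat, y); last by move=> -> [->].
  split; first exact: (f_equal fst E1).
  apply: h4 => //; apply: injective_projections => //.
  exact: (f_equal snd E1).
Qed.

Lemma null_sub (A B : X -> Prop) : null B -> Bo A -> (forall x, A x -> B x) -> null A.
Proof. by case=> _ h hA hs; split => //; apply: emb_trans h; apply: emb_sub => q; apply: hs. Qed.

(** A point is sent into [A] by the first suitable group element, whose index serves as copy number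
    and restores injectivity. *)
Lemma null_saturation A : null A -> null (saturation A).
Proof.
case=> hB h; split; first exact: saturation_Bo.
apply: emb_trans h; apply: emb_infinite.
pose P i x := A (g i x).
exists (fun q => (least (fun i => P i (snd q)), select P (snd q))); split; [|split].
- apply: (morphism2_mk (fun _ x => least (fun i => P i x)) (fun _ => select P)) => i.
  + by apply: measn_least => n; apply: ac_meas.
  + by apply: select_meas => n; apply: ac_meas.
  + exact: select_orb.
- move=> [i x] [/= _ hx]; case: (selectP P x hx) => j [h1 [h2 _]]; rewrite /infinite_copies /= h2.
  exact: h1.
- move=> [i x] [j y] [/= -> hx] [/= -> hy] Eq.
  have El := f_equal fst Eq; have := f_equal snd Eq; rewrite /= in El *; rewrite /select.
  case: (dec _) => // _; case: (dec _) => // _; rewrite El => Ex.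
  case: (ac_inv (least (fun i => P i y))) => l hl.
  by congr pair; rewrite -(proj1 (hl x)) Ex (proj1 (hl y)).
Qed.

(** Each orbit is assigned to the first of the sets that it meets; these pieces are invariant and
    lie in the saturations. *)
Lemma null_ex (A : nat -> X -> Prop) : (forall n, null (A n)) -> null (fun x => exists n, A n x).
Proof.
move=> hA; have hA1 n : Bo (A n) by case: (hA n).
have hB : Bo (fun x => exists n, A n x) by bor; apply: hA1.
split => //; pose idx x := least (fun n => saturation (A n) x).
apply: (emb_pieces idx).
- by apply: measn_least => n; apply: saturation_Bo.
- move=> x y e; apply: least_ext => n.
  by split; apply: saturation_inv => //; apply: orb_sym.
- move=> j; case: (null_saturation _ (hA j)) => _ h; apply: emb_trans h.
  apply: emb_sub => -[i x] [/= [n hn] <-].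
  apply: (proj1 (leastP (fun n => saturation (A n) x) _)); exists n.
  exact: saturation_sub.
Qed.

Definition add_set (A : X -> Prop) (F : nat * X -> Prop) (q : nat * X) : Prop :=
  match fst q with 0 => A (snd q) | S i => F (i, snd q) end.

(** Hilbert's hotel: sending in the extra copy and iterating the embedding produces infinitely many
    disjoint copies of [A] in [F]. *)
Lemma emb_absorb A F : emb (add_set A F) F -> emb (infinite_copies A) F.
Proof.
case=> Th [[h1 h2] [h3 h4]].
pose th (q : nat * X) := Th (S (fst q), snd q).
pose it n x := Nat.iter n th (Th (0%nat, x)).
have thF q : F q -> F (th q) by case: q => i x h; apply: (h3 (S i, x)).
have addF q : F q -> add_set A F (S (fst q), snd q) by case: q.
have itF n x : A x -> F (it n x).
  by move=> hx; elim: n => [|n IH] /=; [apply: (h3 (0%nat, x)) | apply: thF].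
have thB H : borel2 H -> borel2 (fun q => H (th q)) by move=> HH i; apply: (h1 H HH (S i)).
exists (fun q => it (fst q) (snd q)); split; [split|split].
- move=> H HH i /=; rewrite /it.
  have {HH} : borel2 (fun q => H (Nat.iter i th q)).
    elim: i H HH => [|i IH] H HH //=.
    exact: (IH (fun q => H (th q)) (thB H HH)).
  by move=> HH; apply: (h1 _ HH 0%nat).
- move=> [n x] /=; elim: n => [|n IH] /=; first exact: (h2 (0%nat, x)).
  exact: (orb_trans _ _ _ IH (h2 (S _, _))).
- by move=> [n x] hx; apply: itF.
- move=> [n x] [m y] hx0 hy0; have hx : A x := hx0; have hy : A y := hy0; clear hx0 hy0 => /=.
  elim: n m => [|n IH] [|m] /= Eq.
  + by have [] := h4 (0%nat, x) (0%nat, y) hx hy Eq => ->.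
  + by have := h4 (0%nat, x) (S _, _) hx (addF _ (itF m y hy)) Eq.
  + by have := h4 (S _, _) (0%nat, y) (addF _ (itF n x hx)) hy Eq.
  + have := h4 (S _, _) (S _, _) (addF _ (itF n x hx)) (addF _ (itF m y hy)) Eq.
    move=> [E1 E2]; have [] : (n, x) = (m, y); last by move=> -> ->.
    by apply: IH; apply: injective_projections.
Qed.

Lemma null_absorb A B : Bo A -> emb (add_set A (single B)) (single B) -> null A.
Proof.
move=> hA /emb_absorb h; split => //; apply: emb_trans h _; apply: emb_sub.
by move=> q [h _].
Qed.

Definition ae (P : X -> Prop) : Prop := exists N, null N /\ forall x, ~ N x -> P x.

Lemma null_empty : null (fun _ => False).
Proof. by split; [apply: S_cst | apply: emb_sub => q []]. Qed.

Lemma ae_all (P : nat -> X -> Prop) : (forall n, ae (P n)) -> ae (fun x => forall n, P n x).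
Proof.
move=> /choose [N HN]; exists (fun x => exists n, N n x); split.
  by apply: null_ex => n; case: (HN n).
move=> x h n; case: (HN n) => _; apply => hn; apply: h.
by exists n.
Qed.

Lemma ae_true (P : X -> Prop) : (forall x, P x) -> ae P.
Proof. by move=> h; exists (fun _ => False); split => //; apply: null_empty. Qed.

Lemma ae_mono (P Q : X -> Prop) : ae P -> (forall x, P x -> Q x) -> ae Q.
Proof. by case=> N [h1 h2] h; exists N; split => // x /h2 /h. Qed.

Lemma ae_and (P Q : X -> Prop) : ae P -> ae Q -> ae (fun x => P x /\ Q x).
Proof.
move=> hP hQ; have : ae (fun x => forall n, (match n with 0 => P | _ => Q end) x).
  by apply: ae_all => -[|n].
by move/ae_mono; apply => x h; split; [apply: (h 0%nat) | apply: (h 1%nat)].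
Qed.

Lemma ae_app (P Q : X -> Prop) : ae P -> ae (fun x => P x -> Q x) -> ae Q.
Proof. by move=> h1 h2; apply: ae_mono (ae_and _ _ h1 h2) _ => x []; auto. Qed.

Lemma ae_null N : null N -> ae (fun x => ~ N x).
Proof. by move=> h; exists N. Qed.

Lemma ae_orb (P : X -> Prop) : ae P -> ae (fun x => forall y, E x y -> P y).
Proof.
case=> N [h1 h2]; exists (saturation N); split; first exact: null_saturation.
move=> x nx y e; apply: h2 => ny; apply: nx; apply/saturation_orb.
by exists y.
Qed.

Lemma ae_inv_null (P : X -> Prop) : ae P -> exists N, null N /\ invariant N /\ forall x, ~ N x -> P x.
Proof.
case=> N [h1 h2]; exists (saturation N); split; first exact: null_saturation.
split; first exact: saturation_inv.
by move=> x nx; apply: h2 => ny; apply: nx; apply: saturation_sub.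
Qed.

Lemma ae_lt (P : nat -> X -> Prop) n : (forall i, (i < n)%nat -> ae (P i)) ->
  ae (fun x => forall i, (i < n)%nat -> P i x).
Proof.
move=> h; apply: ae_all => i; case: (lt_dec i n) => lt; last by apply: ae_true.
by apply: ae_mono (h i lt) _.
Qed.

Definition ginv (i : nat) : nat := least (fun j => forall x, g j (g i x) = x /\ g i (g j x) = x).

Lemma ginvK i x : g (ginv i) (g i x) = x.
Proof. by case: (proj1 (leastP _ (ac_inv i)) x). Qed.

Lemma gKinv i x : g i (g (ginv i) x) = x.
Proof. by case: (proj1 (leastP _ (ac_inv i)) x). Qed.

Lemma g_inj i x y : g i x = g i y -> x = y.
Proof. by move=> h; rewrite -(ginvK i x) h ginvK. Qed.

(** * Greedy matching along group elements *)

Section Greedy.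
Context (A B : X -> Prop).

(** The still unmatched points of [A] and of [B]; step [i] matches [x] with [g i x] whenever both
    are left. *)
Fixpoint greedy (i : nat) : (X -> Prop) * (X -> Prop) :=
  match i with
  | 0 => (A, B)
  | S i => (fun x => fst (greedy i) x /\ ~ snd (greedy i) (g i x),
            fun y => snd (greedy i) y /\ ~ fst (greedy i) (g (ginv i) y))
  end.

Definition left_rest (x : X) : Prop := forall i, fst (greedy i) x.
Definition right_rest (x : X) : Prop := forall i, snd (greedy i) x.
Definition greedy_map : X -> X := select (fun i x => fst (greedy i) x /\ snd (greedy i) (g i x)).

Lemma greedy_decr m n x : (m <= n)%nat ->
  (fst (greedy n) x -> fst (greedy m) x) /\ (snd (greedy n) x -> snd (greedy m) x).
Proof. by elim=> [|k _ [h1 h2]] //=; split => -[h _]; auto. Qed.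

Lemma left_rest_sub x : left_rest x -> A x.
Proof. by move=> /(_ 0%nat). Qed.

Lemma right_rest_sub x : right_rest x -> B x.
Proof. by move=> /(_ 0%nat). Qed.

Lemma first_drop (F : nat -> X -> Prop) x : F 0%nat x -> ~ (forall i, F i x) ->
  exists i, F i x /\ ~ F (S i) x.
Proof.
move=> h0 h; apply: NNPP => H; apply: h; elim=> [|n IH] //.
by apply: NNPP => nF; apply: H; exists n.
Qed.

Lemma greedy_mapP x : A x -> ~ left_rest x ->
  exists i, fst (greedy i) x /\ snd (greedy i) (g i x) /\ greedy_map x = g i x.
Proof.
move=> Ax h; case: (first_drop (fun i => fst (greedy i)) x) => // i [h1 h2].
case: (selectP (fun i x => fst (greedy i) x /\ snd (greedy i) (g i x)) x).
  by exists i; split => //; apply: NNPP => h3; apply: h2.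
by move=> j [[k1 k2] [k3 _]]; exists j.
Qed.

Lemma greedy_map_in x : A x -> ~ left_rest x -> B (greedy_map x) /\ ~ right_rest (greedy_map x).
Proof.
move=> Ax h; case: (greedy_mapP x Ax h) => i [h1 [h2 ->]]; split.
  by case: (greedy_decr 0 i (g i x)) => [|_]; [lia | apply].
by move=> /(_ (S i)) [_]; rewrite ginvK.
Qed.

Lemma greedy_map_inj x y : A x -> A y -> ~ left_rest x -> ~ left_rest y ->
  greedy_map x = greedy_map y -> x = y.
Proof.
move=> Ax Ay hx hy.
case: (greedy_mapP x Ax hx) => i [h1 [h2 ->]]; case: (greedy_mapP y Ay hy) => j [k1 [k2 ->]] Eq.
have no u v a b : fst (greedy a) u -> snd (greedy b) (g b v) -> g a u = g b v -> ~ (a < b)%nat.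
  move=> l1 l2 Euv lt; case: (greedy_decr (S a) b (g b v)) => // _ /(_ l2) [_].
  by rewrite -Euv ginvK.
case: (Nat.lt_total i j) => [lt|[e|lt]].
- by case: (no x y i j).
- by subst j; apply: (g_inj i).
- by case: (no y x j i).
Qed.

Lemma greedy_map_surj y : B y -> ~ right_rest y -> exists x, A x /\ ~ left_rest x /\ greedy_map x = y.
Proof.
move=> By h; case: (first_drop (fun i => snd (greedy i)) y) => // i [h1 h2].
have h3 : fst (greedy i) (g (ginv i) y) by apply: NNPP => h3; apply: h2.
set x := g (ginv i) y in h3.
have Ax : A x by case: (greedy_decr 0 i x) => [|h4 _]; [lia | apply: h4].
have hx : ~ left_rest x by move=> /(_ (S i)) [_]; rewrite gKinv.
exists x; split => //; split => //.
case: (greedy_mapP x Ax hx) => j [k1 [k2 ->]].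
case: (Nat.lt_total i j) => [lt|[e|lt]].
- case: (greedy_decr (S i) j x) => // /(_ k1) [_].
  by rewrite gKinv.
- by rewrite -e gKinv.
- case: (greedy_decr (S j) i x) => // /(_ h3) [_ nk].
  by case: nk.
Qed.

(** Points [x] and [g i x] left on both sides would have been matched at step [i]. Thus an orbit has
    leftovers on one side at most. *)
Lemma greedy_rest x y : left_rest x -> right_rest y -> ~ E x y.
Proof. by move=> h1 h2 [i e]; case: (h1 (S i)) => _; rewrite e; apply; apply: h2. Qed.

Lemma greedy_orb x : E x (greedy_map x).
Proof. exact: select_orb. Qed.

Context (AB : Bo A) (BB : Bo B).

Lemma greedy_Bo i : Bo (fst (greedy i)) /\ Bo (snd (greedy i)).
Proof.
elim: i => [|i [h1 h2]] //=; split; bor.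
  exact: (ac_meas i (snd (greedy i))).
exact: (ac_meas (ginv i) (fst (greedy i))).
Qed.

Lemma left_rest_Bo : Bo left_rest.
Proof. by apply: S_all => i; case: (greedy_Bo i). Qed.

Lemma right_rest_Bo : Bo right_rest.
Proof. by apply: S_all => i; case: (greedy_Bo i). Qed.

Lemma greedy_map_meas : meas Bo Bo greedy_map.
Proof.
apply: select_meas => i; case: (greedy_Bo i) => h1 h2; bor.
exact: (ac_meas i (snd (greedy i))).
Qed.

End Greedy.

Lemma emb_mk (lam : nat -> X -> nat) (phi : nat -> X -> X) (F G : nat * X -> Prop) :
  (forall i, measn Bo (lam i)) -> (forall i, meas Bo Bo (phi i)) -> (forall i x, E x (phi i x)) ->
  (forall i x, F (i, x) -> G (lam i x, phi i x)) ->
  (forall i j x y, F (i, x) -> F (j, y) -> lam i x = lam j y -> phi i x = phi j y -> i = j /\ x = y) ->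
  emb F G.
Proof.
move=> h1 h2 h3 h4 h5.
exists (fun q => (lam (fst q) (snd q), phi (fst q) (snd q))); split; first exact: morphism2_mk.
split => [[i x]|[i x] [j y] hx hy Eq]; first exact: h4.
by case: (h5 i j x y hx hy) => [||-> ->//]; [apply: (f_equal fst Eq) | apply: (f_equal snd Eq)].
Qed.

Lemma emb_single_mk (phi : X -> X) (A B : X -> Prop) :
  meas Bo Bo phi -> (forall x, E x (phi x)) -> (forall x, A x -> B (phi x)) ->
  (forall x y, A x -> A y -> phi x = phi y -> x = y) -> emb (single A) (single B).
Proof.
move=> h1 h2 h3 h4; apply: (emb_mk (fun _ _ => 0%nat) (fun _ => phi)) => //.
- by move=> _; apply: measn_cst.
- by move=> i x [_ hx]; split => //; apply: h3.
- by move=> i j x y [/= -> hx] [/= -> hy] _ Eq; split => //; apply: h4.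
Qed.

Lemma emb_singleP (A B : X -> Prop) : emb (single A) (single B) ->
  exists phi, meas Bo Bo phi /\ (forall x, E x (phi x)) /\ (forall x, A x -> B (phi x)) /\
    (forall x y, A x -> A y -> phi x = phi y -> x = y).
Proof.
case=> Th [[h1 h2] [h3 h4]]; exists (fun x => snd (Th (0%nat, x))); split; [|split; [|split]].
- by move=> C HC; apply: (h1 (fun q => C (snd q)) _ 0%nat) => i.
- by move=> x; apply: (h2 (0%nat, x)).
- by move=> x Ax; case: (h3 (0%nat, x)).
- move=> x y Ax Ay Eq; suff [] : (0%nat, x) = (0%nat, y) by [].
  apply: h4 => //; apply: injective_projections => //.
  by case: (h3 (0%nat, x)) => // -> _; case: (h3 (0%nat, y)).
Qed.

(** A preimage of [y] lies in the orbit of [y], so it is sought among countably many points. *)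
Lemma image_Bo (phi : X -> X) A : meas Bo Bo phi -> (forall x, E x (phi x)) -> Bo A ->
  Bo (fun y => exists x, A x /\ phi x = y).
Proof.
move=> h1 h2 hA; apply: (S_ext (fun y => exists i, A (g i y) /\ phi (g i y) = y)).
  move=> y; split => [[i [k1 k2]]|[x [k1 k2]]]; first by exists (g i y).
  by have [i Ei] := orb_sym _ _ (h2 x); exists i; rewrite k2 in Ei; rewrite Ei.
by bor; [apply: ac_meas | apply: eq_Bo => //; apply: meas_comp => //; apply: ac_meas].
Qed.

Lemma emb_inverse (phi : X -> X) (A : X -> Prop) : meas Bo Bo phi -> (forall x, E x (phi x)) -> Bo A ->
  (forall x y, A x -> A y -> phi x = phi y -> x = y) ->
  exists psi, meas Bo Bo psi /\ (forall x, E x (psi x)) /\ forall x, A x -> psi (phi x) = x.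
Proof.
move=> h1 h2 hA hinj.
exists (select (fun i y => A (g i y) /\ phi (g i y) = y)); split; [|split].
- apply: select_meas => i; bor; first exact: ac_meas.
  by apply: eq_Bo => //; apply: meas_comp => //; apply: ac_meas.
- exact: select_orb.
- move=> x Ax; case: (selectP (fun i y => A (g i y) /\ phi (g i y) = y) (phi x)).
    by have [i Ei] := orb_sym _ _ (h2 x); exists i; rewrite Ei.
  by move=> i [[k1 k2] [-> _]]; apply: hinj.
Qed.

(* At most one point per orbit is null because every orbit is infinite. *)
Lemma null_transversal (A : X -> Prop) : Bo A -> (forall x y, A x -> A y -> E x y -> x = y) -> null A.
Proof.
move=> hA h1.
(* Orbit-preserving functions with pairwise different values at every point: each avoids its
   predecessors, which infinite orbits permit. *)
pose phis := fix phis (n : nat) : list (X -> X) := match n with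
  | 0 => []
  | S n => select (fun i x => Forall (fun f => g i x <> f x) (phis n)) :: phis n end.
pose P n i x := Forall (fun f => g i x <> f x) (phis n).
pose phi n := select (P n).
have hm n : Forall (meas Bo Bo) (phis n).
  elim: n => [|n IH]; first exact: Forall_nil.
  apply: Forall_cons => //; apply: select_meas => i.
  change (Bo (P n i)); rewrite /P; elim: {n} (phis n) / IH => [|f l hf _ IH]; first by apply: (S_ext (fun _ => True)); [move=> x; split => // _; apply: Forall_nil | apply: S_cst].
  apply: (S_ext (fun x => g i x <> f x /\ Forall (fun f => g i x <> f x) l)).
    by move=> x; rewrite Forall_cons_iff.
  by bor; apply: eq_Bo => //; apply: ac_meas.
have hin m n : (m < n)%nat -> In (phi m) (phis n).
  by elim: n => [|n IH] lt; [lia | case: (Nat.eq_dec m n) => [->|ne]; [left | right; apply: IH; lia]].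
have hnew n x : exists i, P n i x.
  case: (ac_inf x (map (fun f => f x) (phis n))) => i hi; exists i.
  by apply/Forall_forall => f hf Ef; apply: hi; apply/in_map_iff; exists f.
have hne m n x : (m < n)%nat -> phi m x <> phi n x.
  move=> lt Eq; case: (selectP (P n) x (hnew n x)) => i [k1 [k2 _]].
  by move/Forall_forall: k1 => /(_ _ (hin m n lt)); apply; rewrite Eq.
split => //; apply: (emb_mk (fun _ _ => 0%nat) phi).
- by move=> _; apply: measn_cst.
- by move=> n; apply: (proj1 (Forall_forall _ _) (hm (S n))); apply: hin.
- by move=> n x; apply: select_orb.
- by [].
- move=> n m x y hx hy _ Eq.
  have Exy : x = y.
    apply: h1 => //; apply: (orb_trans _ (phi n x)); first exact: select_orb.
    by rewrite Eq; apply: orb_sym; apply: select_orb.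
  subst y; split => //; case: (Nat.lt_total n m) => [lt|[//|lt]].
    by case: (hne n m x lt).
  by case: (hne m n x lt).
Qed.

(** [T] and [T'] embed into each other and cover [L] up to a null set, so each has half of its
    density. *)
Definition half (L T : X -> Prop) : Prop :=
  Bo T /\ (forall x, T x -> L x) /\ exists T', Bo T' /\ (forall x, T' x -> L x /\ ~ T x) /\
    emb (single T) (single T') /\ emb (single T') (single T) /\ null (fun x => L x /\ ~ T x /\ ~ T' x).

(* Pair off distinct points of [L] lying in the same orbit, separating the two points of a pair by a
   set [U m] so that simultaneous pairs do not overlap. *)
Lemma half_exists L : Bo L -> exists T, half L T.
Proof.
move=> hL; case: ac_sep => U [UB Us].
(* [n] codes a group element [i] and a set [U m]; stage [n] pairs the points [x] in [U m] with
   [g i x] outside [U m], if both are still unpaired. *)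
pose D (R : X -> Prop) n x := R x /\ U (snd (of_nat n)) x /\ R (g (fst (of_nat n)) x) /\
  ~ U (snd (of_nat n)) (g (fst (of_nat n)) x).
pose R := fix R n := match n with
  | 0 => L
  | S n => fun x => R n x /\ ~ D (R n) n x /\ ~ D (R n) n (g (ginv (fst (of_nat n))) x) end.
pose d n := D (R n) n.
pose T x := exists i m, d (to_nat (i, m)) x.
pose T' y := exists i m, d (to_nat (i, m)) (g (ginv i) y).
have gB i A : Bo A -> Bo (fun x => A (g i x)) by apply: ac_meas.
have DB Q n : Bo Q -> Bo (D Q n) by move=> h; rewrite /D; bor; [apply: UB | exact: gB h | exact: gB (UB _)].
have RB n : Bo (R n).
  by elim: n => [|n IH] //=; bor; [exact: DB | exact: gB (DB _ _ IH)].
have dB n : Bo (d n) by apply: DB.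
have Rdec m n x : (m <= n)%nat -> R n x -> R m x by elim=> [|k _ IH] //= [h _]; auto.
have dnot n m x : d n x -> (n < m)%nat -> ~ R m x /\ ~ R m (g (fst (of_nat n)) x).
  move=> h lt; split => hR; have /= := Rdec (S n) m _ lt hR; first by case=> _ [].
  by rewrite ginvK => -[_ [_]].
have duniq n m x : d n x -> d m x -> n = m.
  move=> h1 h2; case: (Nat.lt_total n m) => [lt|[//|lt]].
    by case: (dnot n m x h1 lt) => hh; case: hh; case: h2.
  by case: (dnot m n x h2 lt) => hh; case: hh; case: h1.
have dcross n m x y : d n x -> d m y -> g (fst (of_nat n)) x <> y.
  move=> h1 h2 Eq; case: (Nat.lt_total n m) => [lt|[e|lt]].
  - by case: (dnot n m x h1 lt) => _; rewrite Eq; apply; case: h2.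
  - by subst m; case: h1 => _ [_ [_ k]]; case: h2 => _ [k' _]; rewrite Eq in k.
  - by case: (dnot m n y h2 lt) => hh _; apply: hh; rewrite -Eq; case: h1 => _ [_ []].
have duniq2 n m x y : d n x -> d m y -> g (fst (of_nat n)) x = g (fst (of_nat m)) y -> n = m.
  move=> h1 h2 Eq; case: (Nat.lt_total n m) => [lt|[//|lt]].
    by case: (dnot n m x h1 lt) => _ []; rewrite Eq; case: h2 => _ [_ []].
  by case: (dnot m n y h2 lt) => _ []; rewrite -Eq; case: h1 => _ [_ []].
have TB : Bo T by rewrite /T; bor.
have TB' : Bo T' by rewrite /T'; bor; exact: gB (dB _).
have TL x : T x -> L x by case=> i [m [h _]]; apply: (Rdec 0%nat _ x) h; lia.
exists T; split => //; split => //; exists T'; split => //; split.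
  move=> x [i [m h]]; split.
    case: (h) => _ [_ [h3 _]]; rewrite cancel_of_to /= gKinv in h3.
    by apply: (Rdec 0%nat _ x) h3; lia.
  case=> j [l h']; have := dcross _ _ _ _ h h'; rewrite cancel_of_to /= gKinv.
  by case.
split; [|split].
- have hsel x : T x -> exists i m, d (to_nat (i, m)) x /\ select (fun i x => exists m, d (to_nat (i, m)) x) x = g i x.
    case/(selectP (fun i x => exists m, d (to_nat (i, m)) x)) => i [[m h] [k _]].
    by exists i, m.
  apply: (emb_single_mk (select (fun i x => exists m, d (to_nat (i, m)) x))).
  + by apply: select_meas => i; bor.
  + exact: select_orb.
  + by move=> x /hsel [i [m [h ->]]]; exists i, m; rewrite ginvK.
  + move=> x y /hsel [i [m [h ->]]] /hsel [j [l [h' ->]]] Eq.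
    have En : to_nat (i, m) = to_nat (j, l) by apply: (duniq2 _ _ x y h h'); rewrite !cancel_of_to.
    have Eij := f_equal fst (to_nat_inj _ _ En); rewrite /= in Eij; subst j.
    exact: (g_inj i).
- pose Q i y := exists j m, (forall x, g i x = g (ginv j) x) /\ d (to_nat (j, m)) (g (ginv j) y).
  have hsel y : T' y -> exists j m, d (to_nat (j, m)) (g (ginv j) y) /\ select Q y = g (ginv j) y.
    case=> j [m h]; case: (selectP Q y); first by exists (ginv j), j, m.
    by move=> i [[j' [m' [k1 k2]]] [k3 _]]; exists j', m'; split => //; rewrite k3 k1.
  apply: (emb_single_mk (select Q)).
  + apply: select_meas => i; rewrite /Q; bor; exact: gB (dB _).
  + exact: select_orb.
  + by move=> y /hsel [j [m [h ->]]]; exists j, m.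
  + move=> x y /hsel [i [m [h ->]]] /hsel [j [l [h' ->]]] Eq.
    rewrite Eq in h; have := f_equal fst (to_nat_inj _ _ (duniq _ _ _ h h')) => /= Eij.
    by move: Eq; rewrite Eij; apply: g_inj.
(* Unpaired points survive all stages; two of them in one orbit would be separated by some [U m] and
   hence paired. *)
- have key x : L x /\ ~ T x /\ ~ T' x -> forall n, R n x.
    case=> Lx [nT nT']; elim=> [|n IH] //=; split => //.
    rewrite -(cancel_to_of n); case E0 : (of_nat n) => [i m].
    split=> h; [apply: nT | apply: nT']; exists i, m => //.
    by move: h; rewrite cancel_of_to.
  apply: null_transversal => [|x y /key hx /key hy [i e]]; first by bor.
  apply: NNPP => ne; case: (Us x y ne) => m [u1 u2].
  have h : d (to_nat (i, m)) x.
    by rewrite /d /D cancel_of_to /= e; split.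
  by case: (dnot _ _ x h (Nat.lt_succ_diag_r _)) => k _; apply: k.
Qed.

Lemma emb_restrict (Z : X -> Prop) F G : invariant Z -> emb F G ->
  emb (fun q => F q /\ Z (snd q)) (fun q => G q /\ Z (snd q)).
Proof.
move=> hZ [Th [[h1 h2] [h3 h4]]]; exists Th; split => //; split => [q [h h']|q r [h _] [h' _]]; last exact: h4.
by split; [apply: h3 | apply: hZ h'].
Qed.

Lemma emb_add_set A F G : emb F G -> emb (add_set A F) (add_set A G).
Proof.
case=> Th [[h1 h2] [h3 h4]].
exists (fun q => match fst q with 0 => q | S i => (S (fst (Th (i, snd q))), snd (Th (i, snd q))) end).
split; [split|split].
- move=> H HH [|i] /=; first exact: HH.
  by apply: (h1 (fun q => H (S (fst q), snd q))) => j; exact: (HH (S j)).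
- by move=> [[|i] x] /=; [apply: orb_refl | apply: (h2 (i, x))].
- move=> [[|i] x] //= h; have := h3 (i, x) h.
  by case: (Th (i, x)).
- move=> [[|i] x] [[|j] y] //= h h' [E1 E2].
  have [] : (i, x) = (j, y); last by move=> -> ->.
  by apply: h4 => //; apply: injective_projections.
Qed.

Lemma emb_copies_restrict (Z A : X -> Prop) j F : invariant Z -> emb F (copies j A) ->
  emb (fun q => F q /\ Z (snd q)) (copies j (fun x => A x /\ Z x)).
Proof.
move=> hZ h; apply: emb_trans (emb_restrict Z _ _ hZ h) _.
by apply: emb_sub => q [[]].
Qed.

(** * The density of a set on an orbit *)

Section Density.
Context (T : nat -> X -> Prop) (T0 : forall x, T 0%nat x) (TS : forall n, half (T n) (T (S n))).

Lemma T_Bo n : Bo (T n).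
Proof.
case: n => [|n]; last by case: (TS n).
by apply: (S_ext (fun _ => True)); [move=> x; split | apply: S_cst].
Qed.

(** What the greedy matchings of [j] successive copies of [T n] leave of [A]. *)
Fixpoint remainder (n : nat) (A : X -> Prop) (j : nat) : X -> Prop :=
  match j with
  | 0 => A
  | S j => right_rest (T n) (remainder n A j)
  end.

(** Points of [T n] for which copy number [j] finds no room. *)
Definition failure (n : nat) (A : X -> Prop) (j : nat) : X -> Prop := left_rest (T n) (remainder n A j).

(* [j] copies of [T n], a set of density [2^-n], fit into [A] on the orbit of [x]. *)
Definition packs (n : nat) (A : X -> Prop) (j : nat) (x : X) : Prop :=
  forall i, (i < j)%nat -> ~ saturation (failure n A i) x.

Lemma remainder_Bo n A j : Bo A -> Bo (remainder n A j).
Proof. by move=> h; elim: j => [|j IH] //=; apply: right_rest_Bo => //; apply: T_Bo. Qed.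

Lemma failure_Bo n A j : Bo A -> Bo (failure n A j).
Proof. by move=> h; apply: left_rest_Bo; [apply: T_Bo | apply: remainder_Bo]. Qed.

Lemma packs_Bo n A j : Bo A -> Bo (packs n A j).
Proof. by move=> h; rewrite /packs; bor; apply: saturation_Bo; apply: failure_Bo. Qed.

Lemma packs_inv n A j : invariant (packs n A j).
Proof. by move=> x y e h i lt; apply: (invariant_not _ (saturation_inv _) _ _ e); apply: h. Qed.

Lemma remainder_decr n A i j x : (i <= j)%nat -> remainder n A j x -> remainder n A i x.
Proof. by elim=> [|k _ IH] //= /right_rest_sub. Qed.

Lemma failure_T n A j x : failure n A j x -> T n x.
Proof. exact: left_rest_sub. Qed.

Lemma remainder_split n A j : Bo A -> exists psi, meas Bo Bo psi /\ (forall x, E x (psi x)) /\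
  forall x, remainder n A j x -> ~ remainder n A (S j) x ->
    T n (psi x) /\ ~ failure n A j (psi x) /\ greedy_map (T n) (remainder n A j) (psi x) = x.
Proof.
move=> hA; set B := remainder n A j.
have BB : Bo B by apply: remainder_Bo.
have TB := T_Bo n.
case: (emb_inverse (greedy_map (T n) B) (fun x => T n x /\ ~ left_rest (T n) B x)).
- exact: greedy_map_meas.
- exact: greedy_orb.
- by bor; apply: left_rest_Bo.
- by move=> x y [h1 h2] [h3 h4]; apply: greedy_map_inj.
move=> psi [h1 [h2 h3]]; exists psi; split => //; split => // x Bx nx.
by case: (greedy_map_surj (T n) B x Bx nx) => t [k1 [k2 <-]]; rewrite h3.
Qed.

Lemma split_copies n A j : Bo A ->
  emb (single A) (add_set (remainder n A j) (copies j (T n))).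
Proof.
move=> hA; elim: j => [|j IH]; first by apply: emb_sub => -[[|i] x] [].
apply: emb_trans IH _; case: (remainder_split n A j hA) => psi [h1 [h2 h3]].
have BB := remainder_Bo n A (S j) hA.
apply: (emb_mk (fun i x => match i with 0 => if dec (remainder n A (S j) x) then 0%nat else S j | S i => S i end)
               (fun i x => match i with 0 => if dec (remainder n A (S j) x) then x else psi x | S i => x end)).
- move=> [|i] l; last exact: S_cst.
  by apply: (S_if _ (fun _ => 0%nat) (fun _ => S j) (fun _ m => m = l)) => //; apply: S_cst.
- move=> [|i] C HC //; apply: (S_if _ (fun x => x) psi (fun _ => C)) => //; exact: h1.
- by move=> [|i] x; [case: (dec _) => _ //|]; apply: orb_refl.
- move=> [|i] x; rewrite /add_set /copies /=; last by case=> lt h; split => //; lia.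
  case: (dec _) => h hx //; split; first by lia.
  by case: (h3 x hx h).
- move=> [|i] [|i'] x y; rewrite /add_set /copies /=.
  + case: (dec _) => h; case: (dec _) => h' // hx hy _ Eq; split => //.
    by case: (h3 x hx h) => _ [_ <-]; case: (h3 y hy h') => _ [_ <-]; rewrite Eq.
  + by case: (dec _) => h // hx [lt hy] []; lia.
  + by case: (dec _) => h // [lt hy] hx []; lia.
  + by move=> _ _ [->] ->.
Qed.

(** Where placing copy [j] fails, it has used up all that was left of [A]; so [A] fits into [S j]
    copies, and in the last of them the failed points are still free. *)
Lemma failure_copies n A j Z : Bo A -> Bo Z -> invariant Z ->
  (forall x, Z x -> saturation (failure n A j) x) ->
  emb (add_set (fun x => failure n A j x /\ Z x) (single (fun x => A x /\ Z x))) (copies (S j) (T n)).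
Proof.
move=> hA hZ iZ Zs.
have h0 := emb_restrict Z _ _ iZ (split_copies n A j hA).
have {}h0 : emb (single (fun x => A x /\ Z x))
    (fun q => add_set (remainder n A j) (copies j (T n)) q /\ Z (snd q)).
  by apply: emb_trans h0; apply: emb_sub => q [? []].
apply: (emb_trans _ _ _ (emb_add_set _ _ _ h0)).
case: (remainder_split n A j hA) => psi [h1 [h2 h3]].
have full x : remainder n A j x -> Z x -> ~ remainder n A (S j) x.
  move=> hx /Zs /saturation_orb [y [exy hy]] hr.
  by apply: (greedy_rest _ _ y x hy hr); apply: orb_sym.
apply: (emb_mk (fun i x => match i with 0 => j | 1 => j | S (S i) => i end)
               (fun i x => match i with 1 => psi x | _ => x end)).
- by move=> [|[|i]]; apply: measn_cst.
- by move=> [|[|i]].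
- by move=> [|[|i]] x //; apply: orb_refl.
- move=> [|[|i]] x; rewrite /add_set /copies /=.
  + by case=> /failure_T h _; split => //; lia.
  + by case=> hx zx; split; [lia | case: (h3 x hx (full x hx zx))].
  + by case=> -[lt h] _; split => //; lia.
- move=> [|[|i]] [|[|i']] x y; rewrite /add_set /copies /=.
  + by move=> _ _ _ ->.
  + move=> [hf _] [hy zy] _ Eq; case: (h3 y hy (full y hy zy)) => _ [hh _].
    by rewrite -Eq in hh.
  + by move=> _ [[lt _] _] Eq; lia.
  + move=> [hy zy] [hf _] _ Eq; case: (h3 x hy (full x hy zy)) => _ [hh _].
    by rewrite Eq in hh.
  + move=> [hx zx] [hy zy] _ Eq; split => //.
    case: (h3 x hx (full x hx zx)) => _ [_ <-]; case: (h3 y hy (full y hy zy)) => _ [_ <-].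
    by rewrite Eq.
  + by move=> _ [[lt _] _] Eq; lia.
  + by move=> [[lt _] _] _ Eq; lia.
  + by move=> [[lt _] _] _ Eq; lia.
  + by move=> _ _ -> ->.
Qed.

(** Each greedy map lands in points that the next remainder excludes, so different copies do not
    meet. *)
Lemma packs_emb n A j Z : Bo A -> (forall x, Z x -> packs n A j x) ->
  emb (copies j (fun x => T n x /\ Z x)) (single A).
Proof.
move=> hA hZ.
have nf i x : Z x -> (i < j)%nat -> ~ failure n A i x.
  by move=> /hZ h /h nf hf; apply: nf; apply: saturation_sub.
have TB := T_Bo n.
apply: (emb_mk (fun _ _ => 0%nat) (fun i => greedy_map (T n) (remainder n A i))).
- by move=> i; apply: measn_cst.
- by move=> i; apply: greedy_map_meas => //; apply: remainder_Bo.
- by move=> i x; apply: greedy_orb.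
- move=> i x [/= lt [tx zx]]; split => //=.
  have [h _] := greedy_map_in _ _ x tx (nf i x zx lt).
  by apply: (remainder_decr n A 0 i) h; lia.
- have key i i' x y : (i < i')%nat -> (i' < j)%nat -> T n x -> Z x -> T n y -> Z y ->
      greedy_map (T n) (remainder n A i) x <> greedy_map (T n) (remainder n A i') y.
    move=> lt lt' tx zx ty zy Eq.
    have [h1 h2] := greedy_map_in _ _ x tx (nf i x zx ltac:(lia)).
    have [k1 k2] := greedy_map_in _ _ y ty (nf i' y zy lt').
    by apply: h2; apply: (remainder_decr n A (S i) i') => //; rewrite Eq.
  move=> i i' x y [/= lt [tx zx]] [/= lt' [ty zy]] _ Eq.
  case: (Nat.lt_total i i') => [l|[e|l]].
  + by case: (key i i' x y).
  + by subst i'; split => //; apply: greedy_map_inj Eq => //; apply: nf.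
  + by case: (key i' i y x).
Qed.

(** Suppose copy [l < j] fails. Then [A] together with the failed points fits into [S l <= j] copies
    of [T n] and hence back into [A], so the failed points are null by absorption. *)
Lemma packs_of_emb n A j Z : Bo A -> Bo Z -> invariant Z ->
  emb (copies j (fun x => T n x /\ Z x)) (single A) -> ae (fun x => Z x -> packs n A j x).
Proof.
move=> hA hZ iZ hemb.
suff h l : (l < j)%nat -> ae (fun x => Z x -> ~ saturation (failure n A l) x).
  by apply: ae_mono (ae_lt _ j h) _ => x hx zx i lt; apply: hx.
move=> lt; set W := fun x => Z x /\ saturation (failure n A l) x.
have WB : Bo W by rewrite /W; bor; apply: saturation_Bo; apply: failure_Bo.
have iW : invariant W.
  by move=> x y e [h1 h2]; split; [apply: iZ h1 | apply: saturation_inv h2].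
suff hW : null W by apply: ae_mono (ae_null _ hW) _ => x nW zx hs; apply: nW.
suff hN : null (fun x => failure n A l x /\ W x).
  apply: null_sub (null_saturation _ hN) WB _ => x Wx; case: (Wx) => _ /saturation_orb [y [e hy]].
  by apply/saturation_orb; exists y; split => //; split => //; apply: iW Wx.
apply: (null_absorb _ (fun x => A x /\ W x)).
  by bor; apply: failure_Bo.
have h1 := failure_copies n A l W hA WB iW (fun x h => proj2 h).
have := emb_copies_restrict W _ _ _ iW h1.
set F := (add_set _ _); move=> h2.
have {}h2 : emb F (copies (S l) (fun x => T n x /\ W x)).
  by apply: emb_trans h2; apply: emb_sub => -[[|i] x] h; split => //; [case: h | case: h => _ []].
apply: emb_trans h2 _.
have h3 := emb_restrict W _ _ iW hemb.
apply: (emb_trans _ _ _ (emb_trans _ _ _ _ h3)); last by apply: emb_sub => q [[]].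
apply: emb_sub => q [lq [tq Wq]]; split => //; split; first by lia.
by split => //; case: Wq.
Qed.

Lemma packs_mono n A B j Z : Bo A -> Bo B -> Bo Z -> invariant Z ->
  emb (single (fun x => A x /\ Z x)) (single B) -> ae (fun x => Z x -> packs n A j x -> packs n B j x).
Proof.
move=> hA hB hZ iZ h.
set W := fun x => Z x /\ packs n A j x.
have WB : Bo W by rewrite /W; bor; apply: packs_Bo.
have iW : invariant W by move=> x y e [h1 h2]; split; [apply: iZ h1 | apply: packs_inv h2].
suff : ae (fun x => W x -> packs n B j x) by move/ae_mono; apply => x h1 h2 h3; apply: h1.
apply: packs_of_emb => //; apply: emb_trans h.
have h1 := emb_restrict W _ _ iW (packs_emb n A j W hA (fun x hx => proj2 hx)).
apply: (emb_trans _ _ _ (emb_trans _ _ _ _ h1)).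
  by apply: emb_sub => q [lq [tq Wq]].
by apply: emb_sub => q [[e ha] [hz _]]; split.
Qed.

Lemma packs_add n A B C i j : Bo A -> Bo B -> Bo C -> (forall x, A x -> ~ B x) ->
  (forall x, A x \/ B x -> C x) ->
  ae (fun x => packs n A i x -> packs n B j x -> packs n C (i + j) x).
Proof.
move=> hA hB hC dis hABC.
set W := fun x => packs n A i x /\ packs n B j x.
have WB : Bo W by rewrite /W; bor; apply: packs_Bo.
have iW : invariant W by move=> x y e [h1 h2]; split; [apply: packs_inv h1 | apply: packs_inv h2].
suff : ae (fun x => W x -> packs n C (i + j) x) by move/ae_mono; apply => x h h1 h2; apply: h.
apply: packs_of_emb => //.
case: (packs_emb n A i W hA (fun x hx => proj1 hx)) => Th [[h1 h2] [h3 h4]].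
case: (packs_emb n B j W hB (fun x hx => proj2 hx)) => Ph [[k1 k2] [k3 k4]].
exists (fun q => if lt_dec (fst q) i then Th q else Ph ((fst q - i)%nat, snd q)).
split; [split|split].
- move=> H HH l /=; case: (lt_dec l i) => _; first exact: h1.
  by apply: (k1 H HH (l - i)%nat).
- move=> q; case: (lt_dec _ i) => _; first exact: h2.
  exact: (k2 ((fst q - i)%nat, snd q)).
- move=> q [lq hq]; case: (lt_dec _ i) => lt.
    by case: (h3 q (conj lt hq)) => e1 e2; split => //; apply: hABC; left.
  case: (k3 ((fst q - i)%nat, snd q)) => [|e1 e2]; first by split => //=; lia.
  by split => //; apply: hABC; right.
- have key q r : copies (i + j) (fun x => T n x /\ W x) q -> copies (i + j) (fun x => T n x /\ W x) r ->
      (fst q < i)%nat -> ~ (fst r < i)%nat -> Th q <> Ph ((fst r - i)%nat, snd r).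
    move=> [lq hq] [lr hr] l1 l2 Eq.
    case: (h3 q (conj l1 hq)) => _ e1.
    case: (k3 ((fst r - i)%nat, snd r)) => [|_ e2]; first by split => //=; lia.
    by apply: (dis _ e1); rewrite Eq.
  move=> q r hq hr; case: (lt_dec _ i) => l1; case: (lt_dec _ i) => l2 Eq.
  + by apply: h4 => //; split; [| case: hq | | case: hr].
  + by case: (key q r).
  + by case: (key r q).
  + have [E1 E2] : ((fst q - i)%nat, snd q) = ((fst r - i)%nat, snd r).
      by apply: k4 => //; split => /=; [case: hq; lia | case: hq | case: hr; lia | case: hr].
    apply: injective_projections => //; lia.
Qed.

(** Otherwise [C] together with the failed points of [A] fits into [S i + S j] copies of [T n],
    which fit into [C], and absorption applies again. *)
Lemma packs_sub n A B C i j : Bo A -> Bo B -> Bo C -> (forall x, C x -> A x \/ B x) ->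
  ae (fun x => saturation (failure n A i) x -> saturation (failure n B j) x ->
               ~ packs n C (S i + S j) x).
Proof.
move=> hA hB hC hCAB.
set W := fun x => (saturation (failure n A i) x /\ saturation (failure n B j) x) /\
                  packs n C (S i + S j) x.
have WB : Bo W.
  by rewrite /W; bor; [apply: saturation_Bo; apply: failure_Bo | apply: saturation_Bo; apply: failure_Bo | apply: packs_Bo].
have iW : invariant W.
  by move=> x y e [[h1 h2] h3]; split; [split|]; [apply: saturation_inv h1 | apply: saturation_inv h2 | apply: packs_inv h3].
suff hW : null W by apply: ae_mono (ae_null _ hW) _ => x nW h1 h2 h3; apply: nW.
suff hN : null (fun x => failure n A i x /\ W x).
  apply: null_sub (null_saturation _ hN) WB _ => x Wx; case: (Wx) => -[/saturation_orb [y [e hy]] _] _.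
  by apply/saturation_orb; exists y; split => //; split => //; apply: iW Wx.
apply: (null_absorb _ (fun x => C x /\ W x)); first by bor; apply: failure_Bo.
have p1 := failure_copies n A i W hA WB iW (fun x h => proj1 (proj1 h)).
have p2 := failure_copies n B j W hB WB iW (fun x h => proj2 (proj1 h)).
have p3 := packs_emb n C (S i + S j) W hC (fun x h => proj2 h).
apply: (emb_trans _ (copies (S i + S j) (fun x => T n x /\ W x))); last first.
  apply: (emb_trans _ _ _ (emb_trans _ _ _ _ (emb_restrict W _ _ iW p3))).
    by apply: emb_sub => q [h1 [h2 h3]].
  by apply: emb_sub => q [[]].
apply: (emb_trans _ (fun q => copies (S i + S j) (T n) q /\ W (snd q))); last first.
  by apply: emb_sub => q [[]].
set F := add_set _ _.
apply: (emb_trans _ (fun q => F q /\ W (snd q))).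
  by apply: emb_sub => -[[|l] x] h; split => //; [case: h | case: h => _ []].
apply: emb_restrict => //.
case: p1 => Th [[h1 h2] [h3 h4]]; case: p2 => Ph [[k1 k2] [k3 k4]].
(* The extra copy and the points of [A] use the packing of [A], all others that of [B], shifted by
   [S i]. *)
pose sp (q : nat * X) := (fst q = 0%nat \/ A (snd q)).
exists (fun q => if dec (sp q) then Th q else ((S i + fst (Ph q))%nat, snd (Ph q))).
have hF q : F q -> sp q -> add_set (fun x => failure n A i x /\ W x) (single (fun x => A x /\ W x)) q.
  case: q => [[|l] x] //; rewrite /sp /F /add_set /single /=.
  by case=> -> [_ w] [//|a].
have hF' q : F q -> ~ sp q -> add_set (fun x => failure n B j x /\ W x) (single (fun x => B x /\ W x)) q.
  case: q => [[|l] x]; rewrite /sp /F /add_set /single /=; first by move=> _ []; left.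
  case=> -> [c w] nsp; split => //; split => //.
  by case: (hCAB x c) => // a; case: nsp; right.
split; [split|split].
- move=> H HH l.
  apply: (S_if (fun x => sp (l, x)) (fun x => Th (l, x)) (fun x => ((S i + fst (Ph (l, x)))%nat, snd (Ph (l, x)))) (fun _ => H)).
  + by rewrite /sp /=; bor.
  + exact: h1.
  + by apply: (k1 (fun q => H ((S i + fst q)%nat, snd q))) => m; exact: (HH (S i + m)%nat).
- by move=> q; case: (dec _) => _.
- move=> q Fq; case: (dec (sp q)) => s.
    by case: (h3 q (hF q Fq s)) => e1 e2; split => //; lia.
  by case: (k3 q (hF' q Fq s)) => e1 e2; split => //=; lia.
- move=> q r Fq Fr; case: (dec (sp q)) => s; case: (dec (sp r)) => s' Eq.
  + by apply: h4 => //; apply: hF.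
  + by case: (h3 q (hF q Fq s)); rewrite Eq /=; lia.
  + by case: (h3 r (hF r Fr s')); rewrite -Eq /=; lia.
  + apply: k4; [exact: hF' | exact: hF' |].
    apply: injective_projections; last exact: (f_equal snd Eq).
    by have := f_equal fst Eq => /=; lia.
Qed.

Lemma half_copies n j (Z : X -> Prop) : invariant Z ->
  emb (copies (2 * j) (fun x => T (S n) x /\ Z x)) (copies j (fun x => T n x /\ Z x)).
Proof.
move=> iZ; case: (TS n) => _ [hs [T' [_ [hT' [/emb_singleP [phi [h1 [h2 [h3 h4]]]] _]]]]].
apply: (emb_mk (fun i _ => if lt_dec i j then i else (i - j)%nat)
               (fun i => if lt_dec i j then fun x => x else phi)).
- by move=> i; apply: measn_cst.
- by move=> i; case: (lt_dec i j) => _; [apply: meas_id | apply: h1].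
- by move=> i x; case: (lt_dec i j) => // _; apply: orb_refl.
- move=> i x [/= lt [tx zx]]; case: (lt_dec i j) => l; split => //=.
  + by split => //; apply: hs.
  + by lia.
  + by split; [case: (hT' _ (h3 x tx)) | apply: iZ (h2 x) zx].
- move=> i i' x y [/= lt [tx zx]] [/= lt' [ty zy]].
  case: (lt_dec i j) => l; case: (lt_dec i' j) => l' //.
  + by move=> _ Eq; case: (hT' _ (h3 y ty)) => _; rewrite -Eq.
  + by move=> _ Eq; case: (hT' _ (h3 x tx)) => _; rewrite Eq.
  + by move=> E1 Eq; split; [lia | apply: h4].
Qed.

(** The null remainder of the halving is put into [N], together with its orbits. *)
Lemma copies_half n j (Z : X -> Prop) : invariant Z ->
  exists N, null N /\ invariant N /\
    emb (copies j (fun x => T n x /\ (Z x /\ ~ N x))) (copies (2 * j) (fun x => T (S n) x /\ Z x)).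
Proof.
move=> iZ; case: (TS n) => BT [hs [T' [BT' [hT' [_ [/emb_singleP [phi [h1 [h2 [h3 h4]]]] hN]]]]]].
exists (saturation (fun x => T n x /\ ~ T (S n) x /\ ~ T' x)); split; first exact: null_saturation.
split; first exact: saturation_inv.
have hsp x : T n x -> ~ saturation (fun x => T n x /\ ~ T (S n) x /\ ~ T' x) x -> ~ T (S n) x -> T' x.
  by move=> tx ns nt; apply: NNPP => nt'; apply: ns; apply: saturation_sub.
apply: (emb_mk (fun i x => if dec (T (S n) x) then i else (j + i)%nat)
               (fun i x => if dec (T (S n) x) then x else phi x)).
- move=> i l; apply: (S_if _ (fun _ => i) (fun _ => (j + i)%nat) (fun _ m => m = l)) => //; exact: S_cst.
- by move=> i C HC; apply: (S_if _ (fun x => x) phi (fun _ => C)) => //; apply: h1.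
- by move=> i x; case: (dec _) => // _; apply: orb_refl.
- move=> i x [/= lt [tx [zx nx]]]; case: (dec _) => l; split => //=; try lia.
  by split; [apply: h3; apply: hsp | apply: iZ (h2 x) zx].
- move=> i i' x y [/= lt [tx [zx nx]]] [/= lt' [ty [zy ny]]].
  case: (dec _) => l; case: (dec _) => l' //; try lia.
  by move=> E1 Eq; split; [lia | apply: h4 => //; apply: hsp].
Qed.

Lemma all_cover n : exists N, null N /\ invariant N /\
  emb (single (fun x => ~ N x)) (copies (2 ^ n) (T n)).
Proof.
elim: n => [|n [N [h1 [h2 h3]]]].
  exists (fun _ => False); split; first exact: null_empty.
  by split => //; apply: emb_sub => -[i x] [/= -> _]; split => //=; lia.
case: (copies_half n (2 ^ n) (fun _ => True)) => // M [k1 [k2 k3]].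
exists (fun x => N x \/ M x); split; [|split].
- have : null (fun x => exists n, (match n with 0 => N | _ => M end) x) by apply: null_ex => -[|l].
  move=> h; apply: null_sub h _ _; first by case: h1 => ? _; case: k1 => ? _; bor.
  by move=> x [h|h]; [exists 0%nat | exists 1%nat].
- by move=> x y e [h|h]; [left; apply: h2 h | right; apply: k2 h].
- have iM := invariant_not _ k2.
  have := emb_copies_restrict _ _ _ _ iM h3 => h4.
  apply: (emb_trans _ _ _ (emb_trans _ _ _ _ h4)).
    by apply: emb_sub => q [e h]; split; [split|]; tauto.
  apply: (emb_trans _ _ _ (emb_trans _ _ _ _ k3)).
    by apply: emb_sub => q [l [h5 h6]]; split => //; split.
  by apply: emb_sub => q [l []].
Qed.

(** The whole space fits into [2 ^ n] copies of [T n], so a larger packing would let these copies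
    absorb one more. *)
Lemma packs_bound n A j : Bo A -> ae (fun x => packs n A j x -> (j <= 2 ^ n)%nat).
Proof.
move=> hA; case: (le_lt_dec j (2 ^ n)) => lt; first exact: ae_true.
case: (all_cover n) => N [h1 [h2 h3]].
set W := fun x => packs n A j x /\ ~ N x.
have WB : Bo W by rewrite /W; bor; [apply: packs_Bo | case: h1].
have iW : invariant W.
  by move=> x y e [k1 k2]; split; [apply: packs_inv k1 | apply: (invariant_not _ h2 _ _ e k2)].
suff hW : null W.
  by apply: ae_mono (ae_and _ _ (ae_null _ hW) (ae_null _ h1)) _ => x [nW nN] hp; case: nW.
have p1 := packs_emb n A j W hA (fun x h => proj1 h).
suff hN : null (fun x => T n x /\ W x).
  apply: null_sub (null_saturation _ hN) WB _ => x Wx; case: h3 => Th [[_ k2] [k3 _]].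
  apply/saturation_orb; exists (snd (Th (0%nat, x))); split; first exact: (k2 (0%nat, x)).
  split; last by apply: iW (k2 (0%nat, x)) Wx.
  by case: (k3 (0%nat, x)) => //; case: Wx.
split; first by bor; apply: T_Bo.
apply: (emb_trans _ (copies (2 ^ n) (fun x => T n x /\ W x))); last first.
  apply: emb_trans (emb_trans _ _ _ _ p1) _; last by apply: emb_sub => q [].
  by apply: emb_sub => q [l h]; split => //; lia.
apply: emb_absorb.
apply: (emb_trans _ (copies j (fun x => T n x /\ W x))).
  apply: (emb_mk (fun i _ => match i with 0 => (2 ^ n)%nat | S i => i end) (fun _ x => x)).
  + by move=> i; apply: measn_cst.
  + by move=> i; apply: meas_id.
  + by move=> i x; apply: orb_refl.
  + by move=> [|i] x h; [split | case: h => /= l h; split => //=; lia].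
  + by move=> [|i] [|i'] x y h h' /=; [move=> _ -> | case: h' => /= l _; lia | case: h => /= l _; lia | move=> -> ->].
apply: (emb_trans _ _ _ (emb_trans _ _ _ _ (emb_restrict W _ _ iW p1))).
  by apply: emb_sub => q [l [h4 h5]].
apply: (emb_trans _ _ _ (emb_trans _ _ _ _ (emb_copies_restrict W _ _ _ iW h3))).
  by apply: emb_sub => q [[e _] w]; split => //; split => //; case: w.
exact: emb_sub.
Qed.

Lemma packs_all n : ae (packs n (fun _ => True) (2 ^ n)).
Proof.
have : ae (fun x => (fun _ => True) x -> packs n (fun _ => True) (2 ^ n) x).
  apply: packs_of_emb => //; try exact: S_cst.
  elim: n => [|n IH]; last by apply: emb_trans IH; apply: half_copies.
  by apply: emb_sub => -[i x] [/= lt _]; split => //=; lia.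
by move/ae_mono; apply => x; apply.
Qed.

Lemma packs_double n A j : Bo A -> ae (fun x => packs n A j x -> packs (S n) A (2 * j) x).
Proof.
move=> hA; apply: packs_of_emb => //; [exact: packs_Bo | exact: packs_inv |].
apply: emb_trans (packs_emb n A j (packs n A j) hA (fun x h => h)).
by apply: half_copies; apply: packs_inv.
Qed.

End Density.

(** The interface used from here on. The exceptional null set depends on the sets involved, so only
    countably many of these laws may be combined at a time. [m_emb] compares densities on the orbits
    in [Z] only, which allows arguments on invariant pieces. *)
Record is_density (m : (X -> Prop) -> X -> R) : Prop := {
  m_inv : forall A x y, E x y -> m A x = m A y;
  m_Bo : forall A q, Bo A -> Bo (fun x => q < m A x);
  m_ge0 : forall A x, 0 <= m A x;
  m_top : ae (fun x => m (fun _ => True) x = 1);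
  m_emb : forall A B Z, Bo A -> Bo B -> Bo Z -> invariant Z ->
    emb (single (fun x => A x /\ Z x)) (single B) -> ae (fun x => Z x -> m A x <= m B x);
  m_add : forall A B C, Bo A -> Bo B -> Bo C -> (forall x, A x -> ~ B x) ->
    (forall x, C x <-> A x \/ B x) -> ae (fun x => m C x = m A x + m B x) }.

Lemma density_exists : exists m, is_density m.
Proof.
have [T [T0 TS]] : exists T : nat -> X -> Prop, (forall x, T 0%nat x) /\ forall n, half (T n) (T (S n)).
  have hh : forall L : X -> Prop, exists T, Bo L -> half L T.
    move=> L; case: (classic (Bo L)) => h; last by exists L.
    by case: (half_exists L h) => T hT; exists T.
  case: (choose _ hh) => f Hf; pose T := fix T n := match n with 0 => fun _ : X => True | S n => f (T n) end.
  have TB n : Bo (T n) by elim: n => [|n IH]; [apply: S_cst | case: (Hf _ IH)].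
  by exists T; split => // n; apply: Hf.
pose p A x := fun n j => packs T n A j x.
have p0 A x n : p A x n 0%nat by move=> i; lia.
have pd A : Bo A -> ae (fun x => forall n j, p A x n j -> p A x (S n) (2 * j)%nat).
  by move=> hA; apply: ae_all => n; apply: ae_all => j; apply: packs_double.
have pb A : Bo A -> ae (fun x => forall n j, p A x n j -> (j <= 2 ^ n)%nat).
  by move=> hA; apply: ae_all => n; apply: ae_all => j; apply: packs_bound.
exists (fun A x => dyadic_sup (p A x)); split.
- move=> A x y e; congr dyadic_sup; extensionality n; apply: pred_ext => j.
  by split; apply: packs_inv => //; apply: orb_sym.
- move=> A q hA.
  apply: (S_ext (fun x => exists n j, packs T n A j x /\ ((j <= 2 ^ n)%nat /\ q < INR j * eps n))).
    move=> x; split.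
      by case=> n [j [h1 [h2 h3]]]; have := dyadic_sup_ge (p A x) n j (p0 A x 0%nat) h1 h2; lra.
    move=> h; apply: NNPP => H; suff : dyadic_sup (p A x) <= q by lra.
    apply: dyadic_sup_le => // n j h1 h2; apply: Rnot_lt_le => lt; apply: H.
    by exists n, j.
  by bor; apply: packs_Bo.
- by move=> A x; apply: dyadic_sup_ge0.
- apply: ae_mono (packs_all T T0 TS 0) _ => x h.
  apply: Rle_antisym; first exact: dyadic_sup_le1.
  by have := dyadic_sup_ge (p (fun _ => True) x) 0 1 (p0 _ x 0%nat) h (le_n _); rewrite /eps /=; lra.
- move=> A B Z hA hB hZ iZ h.
  have : ae (fun x => forall n j, Z x -> p A x n j -> p B x n j).
    by apply: ae_all => n; apply: ae_all => j; apply: packs_mono.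
  move/ae_mono; apply => x hx zx; apply: dyadic_sup_le => // n j h1 h2.
  by apply: dyadic_sup_ge => //; apply: hx.
- move=> A B C hA hB hC dis hABC.
  have hadd : ae (fun x => forall n i j, p A x n i -> p B x n j -> p C x n (i + j)%nat).
    apply: ae_all => n; apply: ae_all => i; apply: ae_all => j; apply: packs_add => //.
    by move=> x /hABC.
  have hsub : ae (fun x => forall n i j, saturation (failure T n A i) x -> saturation (failure T n B j) x ->
                           ~ packs T n C (S i + S j) x).
    apply: ae_all => n; apply: ae_all => i; apply: ae_all => j; apply: packs_sub => //.
    by move=> x /hABC.
  have := ae_and _ _ (ae_and _ _ (ae_and _ _ (pd A hA) (pd B hB)) (pd C hC))
            (ae_and _ _ (ae_and _ _ (ae_and _ _ (pb A hA) (pb B hB)) (pb C hC)) (ae_and _ _ hadd hsub)).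
  move/ae_mono; apply => x [[[dA dB] dC] [[[bA bB] bC] [hx hs]]].
  apply: dyadic_sup_add => // n l hl.
  (* By the bound a largest packing exists, and the next copy fails. *)
  have maxp P : (forall j, p P x n j -> (j <= 2 ^ n)%nat) ->
      exists i, p P x n i /\ saturation (failure T n P i) x.
    move=> hb; apply: NNPP => H.
    have : p P x n (S (2 ^ n)); last by move=> /hb; lia.
    elim: (S (2 ^ n)) => [|j IH]; first exact: p0.
    move=> i lt; case: (Nat.eq_dec i j) => [->|ne]; last by apply: IH; lia.
    by move=> hf; apply: H; exists j.
  case: (maxp A (bA n)) => i [hi fi]; case: (maxp B (bB n)) => j [hj fj].
  exists i, j; split => //; split => //.
  case: (le_lt_dec l (i + j + 1)) => // lt; case: (hs n i j fi fj) => i' lt' hf.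
  by apply: (hl i') => //; lia.
Qed.

(** * Consequences of the density axioms *)

Section DensityTheory.
Context (m : (X -> Prop) -> X -> R) (Hm : is_density m).

Lemma m_meas A : Bo A -> measR Bo (m A).
Proof. by move=> h q; apply: (m_Bo m Hm). Qed.

Lemma m_mono_on A B Z : Bo A -> Bo B -> Bo Z -> invariant Z -> (forall x, Z x -> A x -> B x) ->
  ae (fun x => Z x -> m A x <= m B x).
Proof.
move=> hA hB hZ iZ h; apply: (m_emb m Hm) => //.
by apply: emb_sub => q [e [a z]]; split => //; apply: h.
Qed.

Lemma m_mono A B : Bo A -> Bo B -> (forall x, A x -> B x) -> ae (fun x => m A x <= m B x).
Proof.
move=> hA hB h; have hT : Bo (fun _ => True) by apply: S_cst.
by apply: ae_mono (m_mono_on A B (fun _ => True) hA hB hT _ _) _ => // x; auto.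
Qed.

Lemma m_single_emb A B : Bo A -> Bo B -> emb (single A) (single B) -> ae (fun x => m A x <= m B x).
Proof.
move=> hA hB h; have : ae (fun x => True -> m A x <= m B x); last by move/ae_mono; apply; auto.
apply: (m_emb m Hm A B (fun _ => True)) => //; first exact: S_cst.
by apply: emb_trans h; apply: emb_sub => q [? []].
Qed.

Lemma m_empty : ae (fun x => m (fun _ => False) x = 0).
Proof.
have hF : Bo (fun _ => False) by apply: S_cst.
have h : ae (fun x => m (fun _ => False) x = m (fun _ => False) x + m (fun _ => False) x).
  by apply: (m_add m Hm) => // x; tauto.
by apply: ae_mono h _ => x; lra.
Qed.

Lemma m_off A : Bo A -> ae (fun x => ~ saturation A x -> m A x = 0).
Proof.
move=> hA; have hF : Bo (fun _ => False) by apply: S_cst.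
have := m_mono_on A (fun _ => False) (fun x => ~ saturation A x) hA hF.
have h1 : Bo (fun x => ~ saturation A x) by apply: S_not; apply: saturation_Bo.
have h2 : invariant (fun x => ~ saturation A x) by apply: invariant_not; apply: saturation_inv.
move=> /(_ h1 h2 (fun x ns a => ns (saturation_sub A x a))) h3.
apply: ae_mono (ae_and _ _ h3 m_empty) _ => x [k1 k2] k3.
by have := k1 k3; have := m_ge0 m Hm A x; lra.
Qed.

Lemma m_null N : null N -> ae (fun x => m N x = 0).
Proof.
move=> h; case: (h) => hN _.
by apply: ae_app (ae_null _ (null_saturation _ h)) (m_off N hN).
Qed.

Lemma m_split A B : Bo A -> Bo B -> ae (fun x => m A x = m (fun y => A y /\ B y) x + m (fun y => A y /\ ~ B y) x).
Proof.
move=> hA hB; apply: (m_add m Hm) => //; try by bor.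
  by move=> x [_ b] [_ nb].
by move=> x; case: (classic (B x)); tauto.
Qed.

Lemma m_le1 A : Bo A -> ae (fun x => m A x <= 1).
Proof.
move=> hA; have hT : Bo (fun _ => True) by apply: S_cst.
apply: ae_mono (ae_and _ _ (m_mono A (fun _ => True) hA hT _) (m_top m Hm)) _ => //.
by move=> x [h1 h2]; lra.
Qed.

(** The matched parts embed into each other and so have a common density [M x]; leftovers occur on
    one side of an orbit only. *)
Lemma m_greedy A B : Bo A -> Bo B -> exists M : X -> R, ae (fun x =>
  m A x = m (left_rest A B) x + M x /\ m B x = m (right_rest A B) x + M x /\
  M x = m (fun y => A y /\ ~ left_rest A B y) x /\
  (m (left_rest A B) x = 0 \/ m (right_rest A B) x = 0) /\
  (saturation (left_rest A B) x -> m (right_rest A B) x = 0)).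
Proof.
move=> hA hB; have hl := left_rest_Bo A B hA hB; have hr := right_rest_Bo A B hA hB.
pose A' y := A y /\ ~ left_rest A B y; pose B' y := B y /\ ~ right_rest A B y.
have hA' : Bo A' by rewrite /A'; bor.
have hB' : Bo B' by rewrite /B'; bor.
exists (m A').
have inj x y : A' x -> A' y -> greedy_map A B x = greedy_map A B y -> x = y.
  by move=> [h1 h2] [h3 h4]; apply: greedy_map_inj.
have e1 : emb (single A') (single B').
  apply: (emb_single_mk (greedy_map A B)) => //.
  + exact: greedy_map_meas.
  + exact: greedy_orb.
  + by move=> x [h1 h2]; apply: greedy_map_in.
have e2 : emb (single B') (single A').
  case: (emb_inverse (greedy_map A B) A' (greedy_map_meas A B hA hB) (greedy_orb A B) hA' inj) => psi [h1 [h2 h3]].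
  have hs y : B' y -> A' (psi y) /\ greedy_map A B (psi y) = y.
    move=> [k1 k2]; case: (greedy_map_surj A B y k1 k2) => x [l1 [l2 <-]].
    by rewrite h3.
  apply: (emb_single_mk psi) => // [y /hs []//|y z /hs [_ e] /hs [_ e'] Eq].
  by rewrite -e -e' Eq.
have hl' : ae (fun x => m A x = m A' x + m (left_rest A B) x).
  apply: (m_add m Hm) => // [x []//|x]; split; last by move=> [[]//|]; apply: left_rest_sub.
  by move=> a; rewrite /A'; tauto.
have hr' : ae (fun x => m B x = m B' x + m (right_rest A B) x).
  apply: (m_add m Hm) => // [x []//|x]; split; last by move=> [[]//|]; apply: right_rest_sub.
  by move=> a; rewrite /B'; tauto.
have := ae_and _ _ (ae_and _ _ (m_single_emb _ _ hA' hB' e1) (m_single_emb _ _ hB' hA' e2))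
  (ae_and _ _ (ae_and _ _ hl' hr') (ae_and _ _ (m_off _ hl) (m_off _ hr))).
move/ae_mono; apply => x [[h1 h2] [[h3 h4] [h5 h6]]].
have sr : saturation (left_rest A B) x -> m (right_rest A B) x = 0.
  move=> /saturation_orb [y [exy hy]]; apply: h6 => /saturation_orb [z [exz hz]].
  by apply: (greedy_rest A B y z hy hz); apply: (orb_trans _ x) => //; apply: orb_sym.
have Eq : m A' x = m B' x by lra.
split; first by lra.
split; first by lra.
split => //; split => //.
by case: (classic (saturation (left_rest A B) x)) => [/sr|/h5]; [right | left].
Qed.

Lemma m_lt_placed A B : Bo A -> Bo B -> ae (fun x => m A x < m B x -> ~ saturation (left_rest A B) x).
Proof.
move=> hA hB; case: (m_greedy A B hA hB) => M /ae_mono; apply => x [h1 [h2 [_ [_ h3]]]] lt /h3 h4.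
by have := m_ge0 m Hm (left_rest A B) x; lra.
Qed.

Lemma m_placed A B : Bo A -> Bo B -> ae (fun x => ~ saturation (left_rest A B) x ->
  m B x = m (right_rest A B) x + m A x).
Proof.
move=> hA hB; case: (m_greedy A B hA hB) => M hM.
apply: ae_mono (ae_and _ _ hM (m_off _ (left_rest_Bo A B hA hB))) _ => x [[h1 [h2 _]] h3] /h3.
by lra.
Qed.

(* Successively place [A 0], [A 1], ... into what remains of [B]. *)
Lemma pack_family (A : nat -> X -> Prop) (B Z : X -> Prop) :
  (forall n, Bo (A n)) -> Bo B -> Bo Z -> invariant Z ->
  (forall x n, Z x -> rsum (fun i => m (A i) x) n < m B x) ->
  exists N, null N /\ invariant N /\ emb (fun q => A (fst q) (snd q) /\ Z (snd q) /\ ~ N (snd q)) (single B).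
Proof.
move=> hA hB hZ iZ hsum.
pose Rn := fix Rn n := match n with 0 => B | S n => right_rest (A n) (Rn n) end.
have RB n : Bo (Rn n) by elim: n => [|n IH] //=; apply: right_rest_Bo.
have Rdec i j x : (i <= j)%nat -> Rn j x -> Rn i x by elim=> [|k _ IH] //= /right_rest_sub.
have : ae (fun x => forall n, (m (A n) x < m (Rn n) x -> ~ saturation (left_rest (A n) (Rn n)) x) /\
   (~ saturation (left_rest (A n) (Rn n)) x -> m (Rn n) x = m (Rn (S n)) x + m (A n) x)).
  by apply: ae_all => n; apply: ae_and; [apply: m_lt_placed | apply: m_placed].
case/ae_inv_null => N [h1 [h2 h3]]; exists N; split => //; split => //.
have hpl x : Z x -> ~ N x -> forall n, ~ saturation (left_rest (A n) (Rn n)) x.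
  move=> zx /h3 hx.
  have hR n : m (Rn n) x = m B x - rsum (fun i => m (A i) x) n.
    elim: n => [|n IH]; first by rewrite /=; lra.
    case: (hx n) => k1 k2; have := hsum x (S n) zx => /= k3.
    by have := k2 (k1 ltac:(lra)) => /=; lra.
  by move=> n; case: (hx n) => k1 _; apply: k1; rewrite hR; have := hsum x (S n) zx => /=; lra.
have hnl x n : Z x -> ~ N x -> ~ left_rest (A n) (Rn n) x.
  by move=> zx nx h; apply: (hpl x zx nx n); apply: saturation_sub.
apply: (emb_mk (fun _ _ => 0%nat) (fun n => greedy_map (A n) (Rn n))).
- by move=> i; apply: measn_cst.
- by move=> i; apply: greedy_map_meas.
- by move=> i x; apply: greedy_orb.
- move=> i x [/= ax [zx nx]]; split => //=.
  by case: (greedy_map_in _ _ x ax (hnl x i zx nx)) => h _; apply: (Rdec 0%nat i) h; lia.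
- have key i i' x y : (i < i')%nat -> A i x -> Z x -> ~ N x -> A i' y -> Z y -> ~ N y ->
      greedy_map (A i) (Rn i) x <> greedy_map (A i') (Rn i') y.
    move=> lt ax zx nx ay zy ny Eq.
    have [k1 k2] := greedy_map_in _ _ x ax (hnl x i zx nx).
    have [k3 k4] := greedy_map_in _ _ y ay (hnl y i' zy ny).
    by apply: k2; apply: (Rdec (S i) i') => //; rewrite Eq.
  move=> i i' x y [/= ax [zx nx]] [/= ay [zy ny]] _ Eq.
  case: (Nat.lt_total i i') => [l|[e|l]].
  + by case: (key i i' x y).
  + by subst i'; split => //; apply: greedy_map_inj Eq => //; apply: hnl.
  + by case: (key i' i y x).
Qed.

(** On the orbits where [A] has density zero, infinitely many copies of [A] can be packed into the
    space. *)
Lemma m_zero_null A : Bo A -> ae (fun x => m A x = 0 -> ~ A x).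
Proof.
move=> hA; pose Z x := m A x = 0 /\ m (fun _ => True) x = 1.
have hZ : Bo Z.
  rewrite /Z; apply: S_and; apply: measR_eq; try exact: measR_cst; apply: m_meas => //.
  exact: S_cst.
have iZ : invariant Z.
  by move=> x y e [h1 h2]; split; rewrite -(m_inv m Hm _ x y e).
case: (pack_family (fun _ => A) (fun _ => True) Z) => // [||N [h1 [h2 h3]]].
- exact: S_cst.
- move=> x n [h1 h2]; rewrite h2; have -> : rsum (fun _ => m A x) n = 0; last by lra.
  by elim: n => [|n IH] //=; rewrite IH h1; lra.
have h4 : null (fun x => A x /\ Z x /\ ~ N x).
  split; first by bor; case: h1.
  by apply: emb_trans h3; apply: emb_sub.
apply: ae_mono (ae_and _ _ (ae_and _ _ (ae_null _ h4) (ae_null _ h1)) (m_top m Hm)) _.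
by move=> x [[k1 k2] k3] k4 k5; apply: k1.
Qed.

Lemma half_m L T : Bo L -> half L T -> ae (fun x => m T x = m L x / 2).
Proof.
move=> hL [hT [hs [T' [hT' [hT'L [e1 [e2 hN]]]]]]].
pose R x := L x /\ ~ T x /\ ~ T' x.
have hR : Bo R by case: hN.
have hTT : Bo (fun x => T x \/ T' x) by bor.
have a1 : ae (fun x => m (fun y => T y \/ T' y) x = m T x + m T' x).
  by apply: (m_add m Hm) => // x t /hT'L [].
have a2 : ae (fun x => m L x = m (fun y => T y \/ T' y) x + m R x).
  apply: (m_add m Hm) => // [x [t|t] [_ []]//|x]; split.
    by rewrite /R; tauto.
  by move=> [[/hs|/hT'L []]//|[]].
have := ae_and _ _ (ae_and _ _ a1 a2) (ae_and _ _ (m_null _ hN) (ae_and _ _ (m_single_emb _ _ hT hT' e1) (m_single_emb _ _ hT' hT e2))).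
by move/ae_mono; apply => x [[h1 h2] [h3 [h4 h5]]]; rewrite -/R in h3; lra.
Qed.

Lemma fraction L J : Bo L -> exists T, Bo T /\ (forall x, T x -> L x) /\ ae (fun x => m T x = m L x * eps J).
Proof.
move=> hL; elim: J => [|J [T [h1 [h2 h3]]]].
  by exists L; split => //; split => //; apply: ae_true => x; rewrite /eps /=; lra.
case: (half_exists T h1) => T' hT'; exists T'; split; first by case: hT'.
split; first by case: hT' => _ [h _] x /h /h2.
apply: ae_mono (ae_and _ _ h3 (half_m T T' h1 hT')) _ => x [-> ->].
by rewrite /eps /=; lra.
Qed.

(** If the sum stayed below the density of the union [U], the sets could be packed into a subset [B]
    of slightly smaller density than [U], against monotonicity. [B] is [U] without a part of
    relative density [eps l]. *)
Lemma m_countable (A : nat -> X -> Prop) : (forall n, Bo (A n)) ->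
  ae (fun x => forall r, (forall n, rsum (fun i => m (A i) x) n <= r) -> m (fun y => exists n, A n y) x <= r).
Proof.
move=> hA; pose U y := exists n, A n y.
have hU : Bo U by rewrite /U; bor; apply: hA.
suff H l : exists B, Bo B /\ ae (fun x => m B x = m U x - m U x * eps l) /\
    ae (fun x => ~ ((forall n, rsum (fun i => m (A i) x) n < m B x) /\ m B x < m U x)).
  case: (choose _ H) => B HB.
  have : ae (fun x => forall l, m (B l) x = m U x - m U x * eps l /\
      ~ ((forall n, rsum (fun i => m (A i) x) n < m (B l) x) /\ m (B l) x < m U x)).
    by apply: ae_all => l; case: (HB l) => _ [h1 h2]; apply: ae_and.
  move=> h; apply: ae_mono (ae_and _ _ h (m_le1 U hU)) _ => x [k1 k2] r hr.
  apply: Rnot_lt_le => lt; have r0 : 0 <= r by apply: (hr 0%nat).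
  case: (eps_small (m U x - r)) => [|l hl]; first by rewrite /U; lra.
  case: (k1 l) => E; apply; rewrite E; have pe := eps_pos l.
  have : m U x * eps l <= 1 * eps l by apply: Rmult_le_compat_r => //; lra.
  have : 0 < m U x * eps l by apply: Rmult_lt_0_compat => //; rewrite /U in hl *; lra.
  by move=> p1 p2; split => [n|]; [have := hr n|]; rewrite /U in hl p1 p2 *; lra.
case: (fraction U l hU) => H [h1 [h2 h3]].
pose B x := U x /\ ~ H x.
have hB : Bo B by rewrite /B; bor.
exists B; split => //; split.
  have : ae (fun x => m U x = m H x + m B x).
    by apply: (m_add m Hm) => // [x a []//|x]; rewrite /B; have := h2 x; case: (classic (H x)); tauto.
  by move=> h4; apply: ae_mono (ae_and _ _ h3 h4) _ => x []; lra.
pose Z x := (forall n, rsum (fun i => m (A i) x) n < m B x) /\ m B x < m U x.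
have hZ : Bo Z.
  rewrite /Z; apply: S_and; last by apply: measR_lt; apply: m_meas.
  apply: S_all => n; apply: measR_lt; last exact: m_meas.
  by apply: (measR_rsum (fun i x => m (A i) x)) => i; apply: m_meas.
have iZ : invariant Z.
  move=> x y e; rewrite /Z -(m_inv m Hm B x y e) -(m_inv m Hm U x y e) => -[k1 k2]; split => // n.
  have -> : (fun i => m (A i) y) = (fun i => m (A i) x); last exact: k1.
  by extensionality i; rewrite (m_inv m Hm _ x y e).
case: (pack_family A B Z) => // [x n [] //|N [k1 [k2 k3]]].
have hW : Bo (fun x => Z x /\ ~ N x) by bor; case: k1.
have iW : invariant (fun x => Z x /\ ~ N x).
  by move=> x y e [z n]; split; [apply: iZ z | apply: (invariant_not _ k2 _ _ e n)].
have := m_emb m Hm U B (fun x => Z x /\ ~ N x) hU hB hW iW.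
have hemb : emb (single (fun x => U x /\ Z x /\ ~ N x)) (single B).
  apply: emb_trans k3.
  apply: (emb_mk (fun _ x => least (fun n => A n x)) (fun _ x => x)).
  + by move=> _; apply: measn_least.
  + by move=> _; apply: meas_id.
  + by move=> _ x; apply: orb_refl.
  + by move=> i x [_ [u w]]; split => //=; case: (leastP (fun n => A n x) u).
  + by move=> i j x y [/= -> _] [/= -> _].
move=> /(_ hemb) k4.
apply: ae_mono (ae_and _ _ k4 (ae_null _ k1)) _ => x [k5 k6] k7.
by have := k5 (conj k7 k6); case: k7 => _; rewrite /U; lra.
Qed.

Lemma m_union A B : Bo A -> Bo B -> ae (fun x => m (fun y => A y \/ B y) x <= m A x + m B x).
Proof.
move=> hA hB.
have h1 : ae (fun x => m (fun y => A y \/ B y) x = m A x + m (fun y => B y /\ ~ A y) x).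
  apply: (m_add m Hm) => //; try by bor.
    by move=> x a [].
  by move=> x; case: (classic (A x)); tauto.
have h2 : ae (fun x => m (fun y => B y /\ ~ A y) x <= m B x).
  by apply: m_mono => // [|x []//]; bor.
by apply: ae_mono (ae_and _ _ h1 h2) _ => x []; lra.
Qed.

Lemma borel_cantelli (A : nat -> X -> Prop) : (forall n, Bo (A n)) ->
  ae (fun x => (exists r, forall n, rsum (fun i => m (A i) x) n <= r) ->
               exists n, forall i, (n <= i)%nat -> ~ A i x).
Proof.
move=> hA; pose L x := forall n, exists i, A (n + i)%nat x.
have hL : Bo L by rewrite /L; bor; apply: hA.
have htail n : Bo (fun y => exists i, A (n + i)%nat y) by bor; apply: hA.
have h1 : ae (fun x => forall n, m L x <= m (fun y => exists i, A (n + i)%nat y) x).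
  by apply: ae_all => n; apply: m_mono.
have h2 : ae (fun x => forall n r, (forall j, rsum (fun i => m (A (n + i)%nat) x) j <= r) ->
    m (fun y => exists i, A (n + i)%nat y) x <= r).
  by apply: ae_all => n; apply: (m_countable (fun i => A (n + i)%nat)).
apply: ae_mono (ae_and _ _ (ae_and _ _ h1 h2) (m_zero_null L hL)) _ => x [[k1 k2] k3] [r hr].
have m0 : m L x = 0.
  have g0 := m_ge0 m Hm L x; case: (Req_dec (m L x) 0) => // ne.
  case: (rsum_tail (fun i => m (A i) x) r (fun i => m_ge0 m Hm (A i) x) hr (m L x / 2)) => [|n hn].
    by lra.
  by have := k1 n; have := k2 n _ hn; lra.
apply: NNPP => H; apply: (k3 m0) => n; apply: NNPP => H'; apply: H.
exists n => i le ai; apply: H'; exists (i - n)%nat.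
by rewrite Nat.add_comm Nat.sub_add.
Qed.

(** [T] is a fraction [eps J] of the surplus of [P] over [Q]; the part of [S'] matched into [T] has
    the smaller of both densities. *)
Lemma select_subset S' P Q J : Bo S' -> Bo P -> Bo Q ->
  exists S1, Bo S1 /\ (forall x, S1 x -> S' x) /\
    ae (fun x => m S1 x = Rmin (m S' x) (Rmax 0 (m P x - m Q x) * eps J)).
Proof.
move=> hS hP hQ; have hL := right_rest_Bo Q P hQ hP.
case: (fraction (right_rest Q P) J hL) => T [h1 [h2 h3]].
exists (fun x => S' x /\ ~ left_rest S' T x).
split; first by bor; apply: left_rest_Bo.
split; first by move=> x [].
case: (m_greedy Q P hQ hP) => M1 a1; case: (m_greedy S' T hS h1) => M2 a2.
apply: ae_mono (ae_and _ _ h3 (ae_and _ _ a1 a2)) _ => x.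
move=> [k1 [[k2 [k3 [_ [k4 _]]]] [k5 [k6 [<- [k7 _]]]]]].
have g1 := m_ge0 m Hm (left_rest Q P) x; have g2 := m_ge0 m Hm (right_rest Q P) x.
have g3 := m_ge0 m Hm (left_rest S' T) x; have g4 := m_ge0 m Hm (right_rest S' T) x.
have -> : Rmax 0 (m P x - m Q x) = m (right_rest Q P) x.
  by case: k4 => E; [rewrite Rmax_right | rewrite Rmax_left]; lra.
rewrite -k1; case: k7 => E; [rewrite Rmin_left | rewrite Rmin_right]; lra.
Qed.

(** * Integrating pointwise counts against the density *)

Definition total (l : list (X -> Prop)) (x : X) : R := fold_right Rplus 0 (map (fun A => m A x) l).

(** [A] is taken out of the first member of the list as far as possible, and the rest of it out of
    the tail. *)
Lemma total_remove (Z : X -> Prop) (l : list (X -> Prop)) (A : X -> Prop) : Bo Z -> invariant Z -> Forall Bo l -> Bo A ->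
  (forall x, Z x -> A x -> (0 < multiplicity l x)%nat) ->
  exists l', Forall Bo l' /\ (forall x, multiplicity l' x = (multiplicity l x - indic (A x))%nat) /\
    ae (fun x => Z x -> m A x + total l' x <= total l x).
Proof.
move=> hZ iZ hl; elim: l / hl A => [|B l hB hl IH] A hA hcov.
  exists []; split; first exact: Forall_nil.
  have hF : Bo (fun _ => False) by apply: S_cst.
  split => //; have := m_mono_on A (fun _ => False) Z hA hF hZ iZ.
  move=> /(_ (fun x z a => False_ind _ (Nat.lt_irrefl _ (hcov x z a)))) h.
  apply: ae_mono (ae_and _ _ h m_empty) _ => x [h1 h2] /h1.
  by rewrite /total /=; lra.
have hA1 : Bo (fun x => A x /\ ~ B x) by bor.
case: (IH _ hA1) => [x zx [a nb]|l' [k1 [k2 k3]]].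
  by have := hcov x zx a; rewrite /multiplicity /= indic_false.
exists ((fun x => B x /\ ~ A x) :: l'); split; first by apply: Forall_cons => //; bor.
split.
  move=> x; rewrite /multiplicity /=; have := k2 x; rewrite /multiplicity => ->.
  case: (classic (A x)) => a; case: (classic (B x)) => b.
  - rewrite (indic_false (B x /\ ~ A x)) ?(indic_false (A x /\ ~ B x)) ?(indic_true (A x)) ?(indic_true (B x)) //; try tauto; lia.
  - rewrite (indic_false (B x /\ ~ A x)) ?(indic_true (A x /\ ~ B x)) ?(indic_true (A x)) ?(indic_false (B x)) //; try tauto; lia.
  - rewrite (indic_true (B x /\ ~ A x)) ?(indic_false (A x /\ ~ B x)) ?(indic_false (A x)) ?(indic_true (B x)) //; try tauto; lia.
  - rewrite (indic_false (B x /\ ~ A x)) ?(indic_false (A x /\ ~ B x)) ?(indic_false (A x)) ?(indic_false (B x)) //; try tauto; lia.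
have s1 := m_split A B hA hB; have s2 := m_split B A hB hA.
apply: ae_mono (ae_and _ _ k3 (ae_and _ _ s1 s2)) _ => x [h1 [h2 h3]] /h1; rewrite /total /=.
have E : (fun y => A y /\ B y) = (fun y => B y /\ A y) by apply: pred_ext => y; tauto.
by rewrite E in h2; lra.
Qed.

(** Monotonicity of the integral for integer-valued functions: the sets of [l] are removed from [l']
    one at a time. *)
Lemma total_le (Z : X -> Prop) (l l' : list (X -> Prop)) : Bo Z -> invariant Z -> Forall Bo l -> Forall Bo l' ->
  (forall x, Z x -> (multiplicity l x <= multiplicity l' x)%nat) ->
  ae (fun x => Z x -> total l x <= total l' x).
Proof.
move=> hZ iZ hl; elim: l / hl l' => [|A l hA hl IH] l' hl' h.
  apply: ae_true => x _; rewrite {1}/total /=.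
  elim: (l') => [|B l1 IH']; first by rewrite /total /=; lra.
  by have := m_ge0 m Hm B x; rewrite /total /= in IH' *; lra.
case: (total_remove Z l' A hZ iZ hl' hA) => [x zx a|l1 [h1 [h2 h3]]].
  by have := h x zx; rewrite {1}/multiplicity /= indic_true //; lia.
have h4 : ae (fun x => Z x -> total l x <= total l1 x).
  apply: IH => // x zx; rewrite h2; have := h x zx.
  by rewrite {1}/multiplicity /= -/(multiplicity l x); lia.
apply: ae_mono (ae_and _ _ h3 h4) _ => x [k1 k2] zx.
have -> : total (A :: l) x = m A x + total l x by [].
by have := k1 zx; have := k2 zx; lra.
Qed.

Lemma multiplicity_app (l l' : list (X -> Prop)) x :
  multiplicity (l ++ l') x = (multiplicity l x + multiplicity l' x)%nat.
Proof. by rewrite /multiplicity map_app list_sum_app. Qed.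

Lemma multiplicity_seq (F : nat -> X -> Prop) n x :
  multiplicity (map F (seq 0 n)) x = nsum (fun b => indic (F b x)) n.
Proof.
elim: n => [|n IH] //; rewrite seq_S map_app multiplicity_app IH /multiplicity /=; lia.
Qed.

Lemma multiplicity_repeat (A : X -> Prop) t x : multiplicity (repeat A t) x = (t * indic (A x))%nat.
Proof. by elim: t => [|t IH] //; rewrite /multiplicity /= -/(multiplicity _ x) IH. Qed.

Lemma total_app l l' x : total (l ++ l') x = total l x + total l' x.
Proof. by elim: l => [|A l IH]; rewrite /total /=; [lra | rewrite -!/(total _ _) IH; lra]. Qed.

Lemma total_repeat (A : X -> Prop) t x : total (repeat A t) x = INR t * m A x.
Proof.
elim: t => [|t IH]; first by rewrite /total /=; lra.
by rewrite S_INR -[repeat A (S t)]/(A :: repeat A t) /total /= -/(total _ x) IH; lra.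
Qed.

Lemma total_map_le {I : Type} (F G : I -> X -> Prop) l x : (forall b, m (F b) x <= m (G b) x) ->
  total (map F l) x <= total (map G l) x.
Proof.
move=> h; elim: l => [|b l IH]; first by rewrite /total /=; lra.
by rewrite /total /= -!/(total _ x); have := h b; lra.
Qed.

Lemma Forall_map_Bo {I : Type} (F : I -> X -> Prop) l : (forall b, Bo (F b)) -> Forall Bo (map F l).
Proof. by move=> h; apply/Forall_forall => A /in_map_iff [b [<- _]]. Qed.

Lemma Forall_repeat_Bo (A : X -> Prop) t : Bo A -> Forall Bo (repeat A t).
Proof. by move=> h; apply/Forall_forall => B hB; rewrite (repeat_spec _ _ _ hB). Qed.

Lemma total_le_all (l l' : list (X -> Prop)) : Forall Bo l -> Forall Bo l' ->
  (forall x, (multiplicity l x <= multiplicity l' x)%nat) -> ae (fun x => total l x <= total l' x).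
Proof.
move=> h1 h2 h3; have hT : Bo (fun _ => True) by apply: S_cst.
have h : ae (fun x => True -> total l x <= total l' x) by apply: total_le.
by apply: ae_mono h _ => x; apply.
Qed.

Lemma measn_indic (Q : X -> Prop) : Bo Q -> measn Bo (fun x => indic (Q x)).
Proof.
move=> h n; apply: (S_if Q (fun _ => 1%nat) (fun _ => 0%nat) (fun _ a => a = n)) => //; exact: S_cst.
Qed.

Lemma measn_nsum (f : nat -> X -> nat) n : (forall i, measn Bo (f i)) -> measn Bo (fun x => nsum (fun i => f i x) n).
Proof.
move=> h; elim: n => [|n IH] /=; first exact: measn_cst.
by apply: (measn_op2 Nat.add (fun x => nsum (fun i => f i x) n)).
Qed.

(** * Simultaneous improving moves *)

Section Moves.
Context {adj : X -> X -> Prop} {D : nat} `{LF : lf_graph X Bo adj D}.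
Context (M : nat) (kap : X -> nat) (kB : measn Bo kap) (kM : forall x, (kap x < M)%nat).
Context (kap3 : forall x y, reach adj 3 x y -> x <> y -> kap x <> kap y).
Context (adjE : forall x y, adj x y -> E x y).
Context (k : nat).

Local Notation nu := (nu (adj := adj) kap).

Lemma kap2 x y : reach adj 2 x y -> x <> y -> kap x <> kap y.
Proof. by move=> h; apply: kap3; left. Qed.

Lemma nu_orb b x : E x (nu b x).
Proof. by case: (nu_or (adj := adj) kap b x) => [[/adjE]//|[_ ->]]; apply: orb_refl. Qed.

Definition coloring (f : X -> nat) : Prop :=
  measn Bo f /\ (forall x, (f x < k)%nat) /\ forall x y, adj x y -> f x <> f y.

Definition ball (z y : X) : Prop := y = z \/ adj z y.

(** Labels are distinct on a ball, so [b] names at most one of its points; if there is none the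
    value is [z], which a label test detects ([ball_hasE]). *)
Definition point (b : nat) (z : X) : X := if dec (kap z = b) then z else nu b z.

Lemma ball_reach z y : ball z y -> reach adj 1 z y.
Proof. by case=> [->|]; [apply: reach_refl | apply: reach_adj]. Qed.

Lemma ball_sym z y : ball z y -> ball y z.
Proof. by case=> [->|h]; [left | right; apply: lf_sym]. Qed.

Lemma ball_point b z : ball z (point b z).
Proof.
rewrite /point; case: (dec _) => _; first by left.
by case: (nu_or (adj := adj) kap b z) => [[h _]|[_ ->]]; [right | left].
Qed.

Lemma point_ball z y : ball z y -> point (kap y) z = y.
Proof.
rewrite /point => h; case: (dec _) => e.
  apply: NNPP => ne; apply: (kap2 z y) => //.
  by apply: (reach_mono 1); [lia | apply: ball_reach].
by case: h => [E|h]; [subst y | apply: (nu_adj kap kap2)].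
Qed.

Lemma point_orb b z : E z (point b z).
Proof. by case: (ball_point b z) => [->|/adjE]; first exact: orb_refl. Qed.

Lemma point_meas b : meas Bo Bo (point b).
Proof.
move=> A HA; apply: (S_if _ (fun z => z) (nu b) (fun _ => A)) => //.
exact: (nu_meas kap kB kap2 b A HA).
Qed.

(** Centers of balls that meet or touch are at distance at most 3, where [kap] distinguishes
    them. *)
Lemma ball_uniq z z' y y' : kap z = kap z' -> ball z y -> ball z' y' -> ball y y' -> z = z'.
Proof.
move=> e h h' hy; apply: NNPP => ne; apply: (kap3 z z') => //.
apply: (reach_trans 1 2 z y); first exact: ball_reach.
apply: (reach_trans 1 1 y y'); first exact: ball_reach.
by apply: ball_reach; apply: ball_sym.
Qed.

Definition ball_has (z : X) (h : X -> Prop) (b : nat) : Prop := exists y, ball z y /\ kap y = b /\ h y.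

Lemma ball_hasE z h b : ball_has z h b <-> kap (point b z) = b /\ h (point b z).
Proof.
split => [[y [h1 [<- h3]]]|[h1 h2]]; first by rewrite point_ball.
by exists (point b z); split; first exact: ball_point.
Qed.

Definition ball_count (z : X) (h : X -> Prop) : nat := nsum (fun b => indic (ball_has z h b)) M.

Lemma ball_count_bound z h : (ball_count z h <= M)%nat.
Proof.
have : (ball_count z h <= nsum (fun _ => 1) M)%nat by apply: nsum_le => i _; apply: indic_le1.
suff -> : nsum (fun _ => 1%nat) M = M by [].
by elim: M => [|n IH] //=; lia.
Qed.

(* A recoloring [h] of the ball around [z] that moves weight out of the set of colors [B] and can be
   performed simultaneously at many places; see [potential_drop] for the role of the three counts. *)
Definition improves (B : nat) (f : X -> nat) (z : X) (h : X -> nat) : Prop :=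
  (forall y, ~ ball z y -> h y = f y) /\ (forall y, (h y < k)%nat) /\
  (forall x y, adj x y -> h x <> h y) /\
  (forall c, (forall al, (al < k)%nat -> cset c al -> cset B al) ->
     (ball_count z (fun y => cset c (h y)) <= ball_count z (fun y => cset c (f y)) + 1)%nat) /\
  (forall c, (forall al, (al < k)%nat -> cset B al -> cset c al) ->
     (ball_count z (fun y => cset c (h y)) <= ball_count z (fun y => cset c (f y)))%nat) /\
  (ball_count z (fun y => cset B (h y)) + 1 <= ball_count z (fun y => cset B (f y)))%nat.

Definition palette (n b : nat) : nat := nth b (word n) 0%nat.

Definition recolor (n : nat) (f : X -> nat) (z y : X) : nat :=
  if dec (ball z y) then palette n (kap y) else f y.

(** A recoloring of the ball is a word over the labels, so countably many codes [n] exhaust all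
    moves. *)
Lemma improves_code B f z h : improves B f z h -> exists n, improves B f z (recolor n f z).
Proof.
move=> H; case: (word_surj (map (fun b => h (point b z)) (seq 0 M))) => n En; exists n.
have -> // : recolor n f z = h.
extensionality y; rewrite /recolor; case: (dec _) => hy; last by case: H => /(_ y hy).
rewrite /palette En (nth_indep _ 0%nat (h (point 0 z))).
  by rewrite length_map length_seq.
by rewrite (map_nth (fun b => h (point b z)) (seq 0 M) 0%nat) seq_nth //= point_ball.
Qed.

Lemma adj_Bo (phi psi : X -> X) : meas Bo Bo phi -> meas Bo Bo psi -> Bo (fun x => adj (phi x) (psi x)).
Proof.
move=> h1 h2; apply: (S_ext (fun x => exists b, nu b (phi x) = psi x /\ psi x <> phi x)).
  by move=> x; rewrite (adj_nu kap kap2).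
bor; apply: eq_Bo => //; apply: meas_comp => //; exact: (nu_meas kap kB kap2).
Qed.

Lemma ball_Bo (phi psi : X -> X) : meas Bo Bo phi -> meas Bo Bo psi -> Bo (fun x => ball (phi x) (psi x)).
Proof. by move=> h1 h2; rewrite /ball; apply: S_or; [apply: eq_Bo | apply: adj_Bo]. Qed.

Lemma recolor_Bo n f (phi : X -> X) : measn Bo f -> meas Bo Bo phi -> measn Bo (fun z => recolor n f z (phi z)).
Proof.
move=> hf hp j.
apply: (S_if (fun z => ball z (phi z)) (fun z => palette n (kap (phi z))) (fun z => f (phi z)) (fun _ a => a = j)).
- by apply: ball_Bo.
- by apply: (hp (fun y => palette n (kap y) = j)); apply: (measn_sub kap (fun a => palette n a = j)).
- by apply: (hp (fun y => f y = j)); apply: hf.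
Qed.

Lemma ball_count_Bo (h : X -> X -> Prop) : (forall b, Bo (fun z => h z (point b z))) ->
  measn Bo (fun z => ball_count z (h z)).
Proof.
move=> hh; apply: (measn_nsum (fun b z => indic (ball_has z (h z) b))) => b; apply: measn_indic.
apply: (S_ext (fun z => kap (point b z) = b /\ h z (point b z))); first by move=> z; rewrite ball_hasE.
apply: S_and => //; apply: (point_meas b (fun y => kap y = b)); exact: kB.
Qed.

Lemma improves_Bo B n f : coloring f -> Bo (fun z => improves B f z (recolor n f z)).
Proof.
move=> [fB [fk fp]].
pose new z y := recolor n f z y.
pose cnt c z := ball_count z (fun y => cset c (new z y)).
pose old c z := ball_count z (fun y => cset c (f y)).
(* Quantifiers over points of the ball become quantifiers over labels. *)
apply: (S_ext (fun z => (forall b, (new z (point b z) < k)%nat) /\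
  (forall b c, adj (point b z) (nu c (point b z)) -> new z (point b z) <> new z (nu c (point b z))) /\
  (forall c, (forall al, (al < k)%nat -> cset c al -> cset B al) -> (cnt c z <= old c z + 1)%nat) /\
  (forall c, (forall al, (al < k)%nat -> cset B al -> cset c al) -> (cnt c z <= old c z)%nat) /\
  (cnt B z + 1 <= old B z)%nat)).
  move=> z; split; last first.
    by case=> [h1 [h2 [h3 [h4 [h5 h6]]]]]; split => //; split => // b c; apply: h3.
  case=> [h1 [h2 [h3 [h4 h5]]]]; split; last split; last split => //.
  - by move=> y ny; rewrite /recolor; case: (dec _).
  - move=> y; case: (classic (ball z y)) => by_.
      by rewrite -(point_ball z y by_); apply: h1.
    by rewrite /recolor; case: (dec _).
  - have key x y : ball z x -> adj x y -> new z x <> new z y.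
      move=> bx a; have := h2 (kap x) (kap y).
      by rewrite (point_ball z x bx) (nu_adj kap kap2); first exact; apply.
    move=> x y a; case: (classic (ball z x)) => bx; first exact: key.
    case: (classic (ball z y)) => by_.
      by apply: not_eq_sym; apply: key => //; apply: lf_sym.
    by rewrite /recolor; case: (dec _) => // _; case: (dec _) => // _; apply: fp.
have nB phi : meas Bo Bo phi -> measn Bo (fun z => new z (phi z)) by apply: recolor_Bo.
have cntB c : measn Bo (cnt c).
  apply: (ball_count_Bo (fun z y => cset c (new z y))) => b.
  by apply: (measn_sub (fun z => new z (point b z))); apply: nB; apply: point_meas.
have oldB c : measn Bo (old c).
  apply: (ball_count_Bo (fun _ y => cset c (f y))) => b.
  by apply: (point_meas b (fun y => cset c (f y))); apply: measn_sub.
have nuB c b : meas Bo Bo (fun z => nu c (point b z)).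
  by apply: meas_comp; [apply: (nu_meas kap kB kap2) | apply: point_meas].
apply: S_and.
  by apply: S_all => b; apply: (measn_sub (fun z => new z (point b z)) (fun a => (a < k)%nat)); apply: nB; apply: point_meas.
apply: S_and.
  apply: S_all => b; apply: S_all => c; apply: S_imp.
    by apply: adj_Bo => //; apply: point_meas.
  apply: (measn_rel2 (fun a a' => a <> a') (fun z => new z (point b z)) (fun z => new z (nu c (point b z)))).
    by apply: nB; apply: point_meas.
  exact: nB.
apply: S_and.
  by apply: S_all => c; apply: S_imp; [apply: S_cst | apply: (measn_rel2 (fun a a' => (a <= a' + 1)%nat))].
apply: S_and.
  by apply: S_all => c; apply: S_imp; [apply: S_cst | apply: (measn_rel2 (fun a a' => (a <= a')%nat))].
exact: (measn_rel2 (fun a a' => (a + 1 <= a')%nat)).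
Qed.

Lemma measn_set f d : measn Bo f -> Bo (fun y : X => cset d (f y)).
Proof. exact: measn_sub. Qed.

Lemma touched_Bo A : Bo A -> Bo (fun y => exists z, A z /\ ball z y).
Proof.
move=> hA; apply: (S_ext (fun y => A y \/ exists z, adj y z /\ A z)).
  move=> y; split.
    case=> [a|[z [h a]]]; first by exists y; split => //; left.
    by exists z; split => //; right; apply: lf_sym.
  by case=> z [a [->|h]]; [left | right; exists z; split => //; apply: lf_sym].
by apply: S_or => //; apply: lf_nbr.
Qed.

Section SimultaneousMoves.
Context (f : X -> nat) (fc : coloring f) (B i n : nat) (A : X -> Prop) (AB : Bo A).
Context (Ai : forall z, A z -> kap z = i) (Aimp : forall z, A z -> improves B f z (recolor n f z)).

Definition touched (y : X) : Prop := exists z, A z /\ ball z y.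

Definition update (y : X) : nat := if dec (touched y) then palette n (kap y) else f y.

Lemma center_uniq z z' y y' : A z -> A z' -> ball z y -> ball z' y' -> ball y y' -> z = z'.
Proof. by move=> a a'; apply: ball_uniq; rewrite !Ai. Qed.

(** Up to the neighbours of the ball around [z], the simultaneous update agrees with the single
    recoloring at [z], since other centers are too far away. *)
Lemma update_recolor z x y : A z -> ball z x -> ball x y -> update y = recolor n f z y.
Proof.
move=> a bx bxy; rewrite /update /recolor; case: (dec _) => t; case: (dec _) => b //.
  by case: t => z' [a' b']; case: b; rewrite (center_uniq z z' x y).
by case: t; exists z.
Qed.

Lemma update_coloring : coloring update.
Proof.
case: fc => fB [fk fp]; split; [|split].
- move=> j; apply: (S_if touched (fun y => palette n (kap y)) f (fun _ a => a = j)).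
  + exact: touched_Bo.
  + by apply: (measn_sub kap (fun a => palette n a = j)).
  + exact: fB.
- move=> y; case: (classic (touched y)) => [[z [a b]]|t]; last by rewrite /update; case: (dec _).
  rewrite (update_recolor z y y) //; first by left.
  by case: (Aimp z a) => _ [].
- have key x y : touched x -> adj x y -> update x <> update y.
    move=> [z [a b]] h; rewrite (update_recolor z x x) //; first by left.
    rewrite (update_recolor z x y) //; first by right.
    by case: (Aimp z a) => _ [_ [h' _]]; apply: h'.
  move=> x y h; case: (classic (touched x)) => tx; first exact: key.
  case: (classic (touched y)) => ty; first by apply: not_eq_sym; apply: key => //; apply: lf_sym.
  by rewrite /update; case: (dec _) => // _; case: (dec _) => // _; apply: fp.
Qed.

(** This and [moved_at] collect the points of label [b] in the moved balls and the centers of these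
    balls. Passing between point and center is injective both ways, which turns counts per ball into
    densities. *)
Definition moved (h : X -> Prop) (b : nat) (y : X) : Prop := touched y /\ kap y = b /\ h y.
Definition moved_at (h : X -> Prop) (b : nat) (z : X) : Prop := A z /\ ball_has z h b.

Lemma moved_Bo h b : Bo h -> Bo (moved h b).
Proof. by move=> hB; rewrite /moved; bor; [apply: touched_Bo | apply: kB]. Qed.

Lemma moved_at_Bo h b : Bo h -> Bo (moved_at h b).
Proof.
move=> hB; apply: (S_ext (fun z => A z /\ (kap (point b z) = b /\ h (point b z)))).
  by move=> z; rewrite /moved_at ball_hasE.
by bor; [apply: (point_meas b (fun y => kap y = b)); apply: kB | apply: (point_meas b h)].
Qed.

Lemma moved_emb h b : Bo h -> ae (fun x => m (moved h b) x <= m (moved_at h b) x).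
Proof.
move=> hB; apply: m_single_emb; [exact: moved_Bo | exact: moved_at_Bo |].
have pt y z : A z -> ball z y -> point i y = z.
  by move=> a bz; rewrite -(Ai z a); apply: point_ball; apply: ball_sym.
apply: (emb_single_mk (point i)); [exact: point_meas | exact: point_orb | |].
  by move=> y [[z [a bz]] [ky hy]]; rewrite (pt y z) //; split => //; exists y.
move=> y y' [[z [a bz]] [ky _]] [[z' [a' bz']] [ky' _]]; rewrite (pt y z) // (pt y' z') // => e; subst z'.
by rewrite -(point_ball z y bz) -(point_ball z y' bz') ky ky'.
Qed.

Lemma moved_at_emb h b : Bo h -> ae (fun x => m (moved_at h b) x <= m (moved h b) x).
Proof.
move=> hB; apply: m_single_emb; [exact: moved_at_Bo | exact: moved_Bo |].
apply: (emb_single_mk (point b)); [exact: point_meas | exact: point_orb | |].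
  move=> z [a /ball_hasE [k1 k2]]; split => //.
  by exists z; split => //; apply: ball_point.
move=> z z' [a _] [a' _] e; apply: (center_uniq z z' (point b z) (point b z')) => //; try exact: ball_point.
by left.
Qed.

Lemma moved_multiplicity h y : multiplicity (map (moved h) (seq 0 M)) y = indic (touched y /\ h y).
Proof.
rewrite multiplicity_seq (nsum_single _ M (kap y) (kM y)).
  by move=> b _ ne; apply: indic_false => -[_ [e _]]; apply: ne.
by apply: indic_iff; rewrite /moved; tauto.
Qed.

Lemma moved_at_multiplicity h z : A z -> multiplicity (map (moved_at h) (seq 0 M)) z = ball_count z h.
Proof.
move=> a; rewrite multiplicity_seq; apply: nsum_ext => b _.
by apply: indic_iff; rewrite /moved_at; tauto.
Qed.

Lemma touched_density : ae (fun x => m touched x <= INR M * m A x).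
Proof.
have hT : Bo (fun _ : X => True) by apply: S_cst.
have a1 : ae (fun x => total [touched] x <= total (map (moved (fun _ => True)) (seq 0 M)) x).
  apply: total_le_all.
  - by apply: Forall_cons; [apply: touched_Bo | apply: Forall_nil].
  - by apply: Forall_map_Bo => b; apply: moved_Bo.
  - move=> x; rewrite moved_multiplicity /multiplicity /= Nat.add_0_r.
    by apply: indic_le.
have a2 : ae (fun x => forall b, m (moved (fun _ => True) b) x <= m (moved_at (fun _ => True) b) x).
  by apply: ae_all => b; apply: moved_emb.
have a3 : ae (fun x => total (map (moved_at (fun _ => True)) (seq 0 M)) x <= total (repeat A M) x).
  apply: total_le_all.
  - by apply: Forall_map_Bo => b; apply: moved_at_Bo.
  - exact: Forall_repeat_Bo.
  - move=> x; rewrite multiplicity_repeat; case: (classic (A x)) => a.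
      by rewrite moved_at_multiplicity // indic_true // Nat.mul_1_r; apply: ball_count_bound.
    by rewrite multiplicity_seq nsum_zero; [move=> b _; apply: indic_false => -[] | lia].
apply: ae_mono (ae_and _ _ a1 (ae_and _ _ a2 a3)) _ => x [h1 [h2 h3]].
have := total_map_le _ _ (seq 0 M) x h2; rewrite total_repeat in h3.
by move: h1; rewrite {1}/total /=; lra.
Qed.

(** Nothing changes outside the touched balls, and a change counted in every ball amounts to the
    same multiple of [m A]. *)
Lemma update_class d t t' :
  (forall z, A z -> (ball_count z (fun y => cset d (recolor n f z y)) + t' <=
                     ball_count z (fun y => cset d (f y)) + t)%nat) ->
  ae (fun x => m (fun y => cset d (update y)) x + INR t' * m A x <=
               m (fun y => cset d (f y)) x + INR t * m A x).
Proof.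
move=> hcnt; pose O y := cset d (f y); pose N y := cset d (update y).
have hO : Bo O by apply: measn_set; case: fc.
have hN : Bo N by apply: measn_set; case: update_coloring.
have a1 : ae (fun x => total (N :: map (moved O) (seq 0 M)) x <= total (O :: map (moved N) (seq 0 M)) x).
  apply: total_le_all.
  - by apply: Forall_cons => //; apply: Forall_map_Bo => b; apply: moved_Bo.
  - by apply: Forall_cons => //; apply: Forall_map_Bo => b; apply: moved_Bo.
  - move=> y.
    rewrite -[N :: _]/([N] ++ _) -[O :: _]/([O] ++ _) !multiplicity_app !moved_multiplicity.
    rewrite {1 2}/multiplicity /= !Nat.add_0_r.
    case: (classic (touched y)) => t0.
      rewrite (indic_iff (touched y /\ O y) (O y)); first by tauto.
      by rewrite (indic_iff (touched y /\ N y) (N y)); [tauto | lia].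
    have -> : N y = O y by rewrite /N /O /update; case: (dec _).
    by lia.
have a2 : ae (fun x => forall b, m (moved N b) x <= m (moved_at N b) x).
  by apply: ae_all => b; apply: moved_emb.
have a3 : ae (fun x => forall b, m (moved_at O b) x <= m (moved O b) x).
  by apply: ae_all => b; apply: moved_at_emb.
have a4 : ae (fun x => total (map (moved_at N) (seq 0 M) ++ repeat A t') x <=
                       total (map (moved_at O) (seq 0 M) ++ repeat A t) x).
  apply: total_le_all.
  - by apply/Forall_app; split; [apply: Forall_map_Bo => b; apply: moved_at_Bo | apply: Forall_repeat_Bo].
  - by apply/Forall_app; split; [apply: Forall_map_Bo => b; apply: moved_at_Bo | apply: Forall_repeat_Bo].
  - move=> z; rewrite !multiplicity_app !multiplicity_repeat.
    case: (classic (A z)) => a; last first.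
      rewrite !multiplicity_seq !nsum_zero ?(indic_false (A z)) //; try lia.
        by move=> b _; apply: indic_false => -[].
      by move=> b _; apply: indic_false => -[].
    rewrite !moved_at_multiplicity // (indic_true (A z)) // !Nat.mul_1_r.
    have -> : ball_count z N = ball_count z (fun y => cset d (recolor n f z y)).
      apply: nsum_ext => b _; apply: indic_iff; rewrite !ball_hasE /N.
      by rewrite (update_recolor z (point b z) (point b z)) //; [apply: ball_point | left].
    exact: hcnt.
apply: ae_mono (ae_and _ _ (ae_and _ _ a1 a2) (ae_and _ _ a3 a4)) _ => x [[h1 h2] [h3 h4]].
have e1 := total_map_le _ _ (seq 0 M) x h2; have e2 := total_map_le _ _ (seq 0 M) x h3.
rewrite !total_app !total_repeat in h4.
by move: h1; rewrite {1 2}/total /= -!/(total _ x) -/N -/O; lra.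
Qed.

End SimultaneousMoves.

(** * The limit coloring *)

(** Balls with centers of one label are treated by [touched_density]; the sum over the labels gives
    the second factor [INR M]. *)
Lemma touched_all_density Q : Bo Q -> ae (fun x => m (touched Q) x <= INR M * INR M * m Q x).
Proof.
move=> hQ; pose Qa a z := Q z /\ kap z = a.
have hQa a : Bo (Qa a) by rewrite /Qa; bor; apply: kB.
have a1 : ae (fun x => total [touched Q] x <= total (map (fun a => touched (Qa a)) (seq 0 M)) x).
  apply: total_le_all.
  - by apply: Forall_cons; [apply: touched_Bo | apply: Forall_nil].
  - by apply: Forall_map_Bo => b; apply: touched_Bo.
  - move=> y; rewrite multiplicity_seq /multiplicity /= Nat.add_0_r.
    case: (classic (touched Q y)) => [[z [q b]]|t]; last by rewrite indic_false //; lia.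
    apply: (Nat.le_trans _ (indic (touched (Qa (kap z)) y))).
      by apply: indic_le => _; exists z.
    exact: (nsum_ge1 (fun a => indic (touched (Qa a) y))).
have a2 : ae (fun x => forall a, m (touched (Qa a)) x <= INR M * m (Qa a) x).
  by apply: ae_all => a; apply: (touched_density a) => // z [].
have a3 : ae (fun x => forall a, m (Qa a) x <= m Q x).
  by apply: ae_all => a; apply: m_mono => // z [].
apply: ae_mono (ae_and _ _ a1 (ae_and _ _ a2 a3)) _ => x [h1 [h2 h3]].
move: h1; rewrite {1}/total /=.
suff : total (map (fun a => touched (Qa a)) (seq 0 M)) x <= INR (length (seq 0 M)) * (INR M * m Q x).
  by rewrite length_seq; lra.
elim: (seq 0 M) => [|a l IH]; first by rewrite /total /=; lra.
rewrite -[length (a :: l)]/(S (length l)) S_INR /total /= -/(total _ x).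
have : INR M * m (Qa a) x <= INR M * m Q x by apply: Rmult_le_compat_l => //; apply: pos_INR.
by have := h2 a; lra.
Qed.

(** The factor [eps (S M)] keeps [(M + 1) * gap] within the surplus: this is the margin [K + 1] that
    [potential_drop] demands for [K = M]. *)
Definition gap (f : X -> nat) (be al : nat) (x : X) : R :=
  Rmax 0 (m (fun y => f y = be) x - m (fun y => f y = al) x) * eps (S M).

(** [select_subset] is applied for one pair after another; the second clause says that [A] is as
    large as the bounds permit. *)
Lemma select_many (f : X -> nat) A0 (l : list (nat * nat)) : measn Bo f -> Bo A0 ->
  exists A, Bo A /\ (forall x, A x -> A0 x) /\
    ae (fun x => (forall be al, In (be, al) l -> m A x <= gap f be al x) /\
                 (forall r, r <= m A0 x -> (forall be al, In (be, al) l -> r <= gap f be al x) -> r <= m A x)).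
Proof.
move=> fB hA0; elim: l => [|[be al] l [A [h1 [h2 h3]]]].
  by exists A0; split => //; split => //; apply: ae_true => x; split.
case: (select_subset A (fun y => f y = be) (fun y => f y = al) (S M)) => [//||| A' [k1 [k2 k3]]].
- exact: fB.
- exact: fB.
exists A'; split => //; split => [x /k2 /h2 //|].
apply: ae_mono (ae_and _ _ h3 k3) _ => x [[e1 e2] e3].
have l1 : m A' x <= m A x by rewrite e3; apply: Rmin_l.
have l2 : m A' x <= gap f be al x by rewrite e3; apply: Rmin_r.
split => [be' al' [[<- <-] //|/e1]|r r0 hr]; first by lra.
rewrite e3; apply: Rmin_glb; last by apply: hr; left.
by apply: e2 => // be' al' h; apply: hr; right.
Qed.

Definition candidate (f : X -> nat) (B i n : nat) (z : X) : Prop := kap z = i /\ improves B f z (recolor n f z).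

Definition profile (f : X -> nat) (x : X) (c : nat) : R := m (fun y => cset c (f y)) x.

Lemma candidate_Bo f B i n : coloring f -> Bo (candidate f B i n).
Proof. by move=> fc; apply: S_and; [apply: kB | apply: improves_Bo]. Qed.

Lemma profile_exchange f : coloring f -> ae (fun x => forall c c' a b, (a < k)%nat -> (b < k)%nat ->
  cset c a -> ~ cset c b -> (forall al, (al < k)%nat -> cset c' al <-> ((cset c al /\ al <> a) \/ al = b)) ->
  profile f x c' + m (fun y => f y = a) x = profile f x c + m (fun y => f y = b) x).
Proof.
move=> [fB [fk _]].
apply: ae_all => c; apply: ae_all => c'; apply: ae_all => a; apply: ae_all => b.
case: (classic (cset c a /\ ~ cset c b /\
  (forall al, (al < k)%nat -> cset c' al <-> ((cset c al /\ al <> a) \/ al = b)))) => [[h1 [h2 h3]]|h]; last first.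
  by apply: ae_true => x la lb h1 h2 h3; case: h.
have hP : Bo (fun y => cset c (f y) /\ f y <> a) by bor; [apply: measn_set | apply: fB].
have a1 : ae (fun x => profile f x c = m (fun y => cset c (f y) /\ f y <> a) x + m (fun y => f y = a) x).
  apply: (m_add m Hm) => //; try (exact: measn_set || exact: fB).
    by move=> x [].
  move=> x; split => [h|[[]//|->//]].
  by case: (Nat.eq_dec (f x) a); [right | left].
have a2 : ae (fun x => profile f x c' = m (fun y => cset c (f y) /\ f y <> a) x + m (fun y => f y = b) x).
  apply: (m_add m Hm) => //; try (exact: measn_set || exact: fB).
    by move=> x [h _] e; apply: h2; rewrite -e.
  by move=> x; apply: h3.
by apply: ae_mono (ae_and _ _ a1 a2) _ => x []; lra.
Qed.

(* The moved set [A] is kept small compared with the gaps between the classes in [B] and the others,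
   which is what [potential_drop] requires. *)
Lemma round f B i n : coloring f -> (B < 2 ^ k)%nat -> exists (f' : X -> nat) (A : X -> Prop),
  coloring f' /\ Bo A /\
  ae (fun x => m (fun y => f' y <> f y) x <= INR M * m A x /\
    (forall r, r <= m (candidate f B i n) x ->
       (forall be al, (be < k)%nat -> (al < k)%nat -> cset B be -> ~ cset B al -> r <= gap f be al x) -> r <= m A x) /\
    potential k (profile f' x) + m A x <= potential k (profile f x)).
Proof.
move=> fc hB; case: (fc) => fB [fk _].
pose pl := filter (fun p => if dec (cset B (fst p) /\ ~ cset B (snd p)) then true else false)
             (list_prod (seq 0 k) (seq 0 k)).
have plP be al : In (be, al) pl <-> ((be < k)%nat /\ (al < k)%nat /\ cset B be /\ ~ cset B al).
  rewrite /pl filter_In in_prod_iff !in_seq /=; case: (dec _) => h; split => //; try (by case; lia).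
    by move=> [h1 _]; split; [lia | split; [lia | tauto]].
  by move=> [h1 [h2 h3]]; case: h.
case: (select_many f (candidate f B i n) pl fB (candidate_Bo f B i n fc)) => A [AB [Ac hA]].
have Ai z : A z -> kap z = i by move=> /Ac [].
have Aimp z : A z -> improves B f z (recolor n f z) by move=> /Ac [].
exists (update f n A), A.
have uc := update_coloring f fc B i n A AB Ai Aimp.
split => //; split => //.
have uB : Bo (fun y => update f n A y <> f y).
  by apply: (measn_rel2 (fun a b => a <> b)) => //; case: uc.
have c0 : ae (fun x => m (fun y => update f n A y <> f y) x <= m (touched A) x).
  apply: m_mono => //; first exact: touched_Bo.
  by move=> y; rewrite /update; case: (dec _).
have c1 := touched_density i A AB Ai.
have c2 : ae (fun x => forall c, (forall al, (al < k)%nat -> cset c al -> cset B al) ->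
    profile (update f n A) x c <= profile f x c + m A x).
  apply: ae_all => c; case: (classic (forall al, (al < k)%nat -> cset c al -> cset B al)) => h; last first.
    by apply: ae_true => x.
  have := update_class f fc B i n A AB Ai Aimp c 1 0.
  move=> /(_ _)/ae_mono; apply; last by move=> x hx _; rewrite /profile; move: hx; rewrite /=; lra.
  by move=> z /Aimp [_ [_ [_ [h' _]]]]; rewrite Nat.add_0_r; apply: h'.
have c3 : ae (fun x => forall c, (forall al, (al < k)%nat -> cset B al -> cset c al) ->
    profile (update f n A) x c <= profile f x c).
  apply: ae_all => c; case: (classic (forall al, (al < k)%nat -> cset B al -> cset c al)) => h; last first.
    by apply: ae_true => x.
  have := update_class f fc B i n A AB Ai Aimp c 0 0.
  move=> /(_ _)/ae_mono; apply; last by move=> x hx _; rewrite /profile; move: hx; rewrite /=; lra.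
  by move=> z /Aimp [_ [_ [_ [_ [h' _]]]]]; rewrite !Nat.add_0_r; apply: h'.
have c4 : ae (fun x => profile (update f n A) x B + m A x <= profile f x B).
  have := update_class f fc B i n A AB Ai Aimp B 0 1.
  move=> /(_ _)/ae_mono; apply; last by move=> x; rewrite /profile /=; lra.
  by move=> z /Aimp [_ [_ [_ [_ [_ h']]]]]; rewrite Nat.add_0_r; apply: h'.
(* A crude bound, as a ball has at most [M] points. *)
have c5 : ae (fun x => forall c, profile (update f n A) x c <= profile f x c + INR M * m A x).
  apply: ae_all => c; have := update_class f fc B i n A AB Ai Aimp c M 0.
  move=> /(_ _)/ae_mono; apply; last by move=> x; rewrite /profile /=; lra.
  by move=> z _; have := ball_count_bound z (fun y => cset c (recolor n f z y)); lia.
apply: ae_mono (ae_and _ _ (ae_and _ _ (ae_and _ _ c0 c1) (ae_and _ _ c2 c3))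
  (ae_and _ _ (ae_and _ _ c4 c5) (ae_and _ _ hA (profile_exchange f fc)))) _.
move=> x [[[e0 e1] [e2 e3]] [[e4 e5] [[e6 e7] e8]]].
split; first by lra.
split.
  by move=> r h1 h2; apply: e7 => // be al /plP [l1 [l2 [l3 l4]]]; apply: h2.
apply: (potential_drop k _ _ B (m A x) (INR M)) => //.
- exact: (m_ge0 m Hm).
- exact: pos_INR.
- by move=> c; apply: (m_ge0 m Hm).
move=> pos c a b la lb ca nBa Bb ncb.
case: (card_exchange k c a b la lb ca ncb) => c' [k1 [k2 k3]].
exists c'; split => //; split => //.
have Ex := e8 c c' a b la lb ca ncb k3.
have hg : m A x <= gap f b a x by apply: e6; apply/plP.
move: hg; rewrite /gap => hg; have pe := eps_pos (S M).
have hM : (INR M + 1) * eps (S M) <= 1.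
  rewrite -S_INR -(pow2_eps (S M)); apply: Rmult_le_compat_r; first by lra.
  by apply: le_INR; have := Nat.pow_gt_lin_r 2 (S M); lia.
set df := m (fun y => f y = b) x - m (fun y => f y = a) x in hg.
case: (Rle_lt_dec df 0) => hd.
  by rewrite Rmax_left // in hg; lra.
rewrite Rmax_right in hg; first by lra.
suff : (INR M + 1) * m A x <= df by rewrite /df; lra.
have m1 : (INR M + 1) * m A x <= (INR M + 1) * (df * eps (S M)).
  by apply: Rmult_le_compat_l => //; have := pos_INR M; lra.
have m2 : df * ((INR M + 1) * eps (S M)) <= df * 1 by apply: Rmult_le_compat_l; lra.
by lra.
Qed.

(** Whether a recoloring improves depends only on the colors in the ball and next to it. *)
Lemma candidate_local f f' B i n z : coloring f' -> (forall y, reach adj 2 z y -> f y = f' y) ->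
  candidate f B i n z -> candidate f' B i n z.
Proof.
move=> [_ [fk fp]] H [hi [h1 [h2 [h3 [h4 [h5 h6]]]]]]; split => //.
have hb y : ball z y -> f y = f' y by move=> b; apply: H; left; apply: ball_reach.
have rb y : ball z y -> recolor n f z y = recolor n f' z y by rewrite /recolor; case: (dec _).
have nb y : ~ ball z y -> recolor n f' z y = f' y by rewrite /recolor; case: (dec _).
have cnt (P : nat -> Prop) (u v : X -> nat) : (forall y, ball z y -> u y = v y) ->
    ball_count z (fun y => P (u y)) = ball_count z (fun y => P (v y)).
  move=> huv; apply: nsum_ext => b _; apply: indic_iff; rewrite !ball_hasE huv //.
  exact: ball_point.
have c1 c := cnt (cset c) _ _ hb; have c2 c := cnt (cset c) _ _ rb.
split => //; split.
  by move=> y; case: (classic (ball z y)) => b; [rewrite -rb | rewrite nb].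
split; last first.
  by split => [c hc|]; [|split => [c hc|]]; rewrite -c1 -c2; [apply: h4 | apply: h5 |].
have key x y : ball z x -> adj x y -> recolor n f' z x <> recolor n f' z y.
  move=> bx a; rewrite -rb //; case: (classic (ball z y)) => b_; first by rewrite -rb //; apply: h3.
  rewrite nb // -H.
    by apply: (reach_trans 1 1 z x); [apply: ball_reach | apply: reach_adj].
  have <- : recolor n f z y = f y by rewrite /recolor; case: (dec _).
  exact: h3.
move=> x y a; case: (classic (ball z x)) => bx; first exact: key.
case: (classic (ball z y)) => b_; first by apply: not_eq_sym; apply: key => //; apply: lf_sym.
by rewrite !nb //; apply: fp.
Qed.

Lemma class_close f f' al : measn Bo f -> measn Bo f' ->
  ae (fun x => m (fun y => f y = al) x <= m (fun y => f' y = al) x + m (fun y => f y <> f' y) x).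
Proof.
move=> h h'; have hd : Bo (fun y => f y <> f' y) by apply: (measn_rel2 (fun a b => a <> b)).
have a1 := m_union (fun y => f' y = al) (fun y => f y <> f' y) (h' al) hd.
have a2 : ae (fun x => m (fun y => f y = al) x <= m (fun y => f' y = al \/ f y <> f' y) x).
  apply: m_mono; [exact: h | by bor; apply: h' |] => y e.
  by case: (Nat.eq_dec (f y) (f' y)) => e'; [left; rewrite -e' | right].
by apply: ae_mono (ae_and _ _ a1 a2) _ => x []; lra.
Qed.

(** A candidate is lost only within distance 2 of a changed vertex, and each unit of distance costs
    a factor [M * M]. *)
Lemma candidate_close f f' B i n : coloring f -> coloring f' ->
  ae (fun x => m (candidate f B i n) x <=
     m (candidate f' B i n) x + INR M * INR M * (INR M * INR M * m (fun y => f y <> f' y) x)).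
Proof.
move=> fc fc'; pose Q y := f y <> f' y.
have hQ : Bo Q by apply: (measn_rel2 (fun a b => a <> b)); [case: fc | case: fc'].
have hT : Bo (touched Q) := touched_Bo Q hQ; have hTT : Bo (touched (touched Q)) := touched_Bo _ hT.
have hC := candidate_Bo f B i n fc; have hC' := candidate_Bo f' B i n fc'.
have a1 := m_union (candidate f' B i n) (touched (touched Q)) hC' hTT.
have a2 : ae (fun x => m (candidate f B i n) x <= m (fun y => candidate f' B i n y \/ touched (touched Q) y) x).
  apply: m_mono => //; first by apply: S_or.
  move=> z cz; case: (classic (touched (touched Q) z)) => t; [by right | left].
  apply: (candidate_local f) => // y hy; apply: NNPP => ne; apply: t.
  have [w [bw by_]] : exists w, ball y w /\ ball w z.
    case: hy => [[e|[w [a e]]]|[w [a [e|[v [a' e]]]]]]; rewrite /= in e.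
    - by subst y; exists z; split; left.
    - by subst y; exists w; split; [left | right; apply: lf_sym].
    - by subst y; exists w; split; [left | right; apply: lf_sym].
    - by subst y; exists w; split; right; apply: lf_sym.
  by exists w; split => //; exists y.
have a3 := touched_all_density Q hQ; have a4 := touched_all_density _ hT.
apply: ae_mono (ae_and _ _ (ae_and _ _ a1 a2) (ae_and _ _ a3 a4)) _ => x [[e1 e2] [e3 e4]].
have : INR M * INR M * m (touched Q) x <= INR M * INR M * (INR M * INR M * m Q x).
  by apply: Rmult_le_compat_l => //; apply: Rmult_le_pos; apply: pos_INR.
by rewrite -[fun y => f y <> f' y]/Q; lra.
Qed.

(** On [N] the coloring [F 0] is kept; no edge leaves the invariant set [N], so the pieces do not
    conflict. *)
Lemma limit_coloring (F : nat -> X -> nat) (N : X -> Prop) : (forall n, coloring (F n)) -> null N -> invariant N ->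
  (forall x, ~ N x -> exists n, forall i, (n <= i)%nat -> F (S i) x = F i x) ->
  exists f, coloring f /\ forall x, ~ N x -> exists n, forall i, (n <= i)%nat -> F i x = f x.
Proof.
move=> Fc [NB _] iN hN.
pose st x := least (fun n => forall i, (n <= i)%nat -> F (S i) x = F i x).
pose f x := if dec (N x) then F 0%nat x else F (st x) x.
have hst x : ~ N x -> forall i, (st x <= i)%nat -> F i x = F (st x) x.
  move=> nx; case: (leastP _ (hN x nx)) => h _ i; elim=> [//|j le IH].
  by rewrite h.
have hf x : ~ N x -> f x = F (st x) x by rewrite /f; case: (dec _).
exists f; split; last by move=> x nx; exists (st x) => i le; rewrite hf //; apply: hst.
have stB : measn Bo st.
  apply: measn_least => n; apply: S_all => i; apply: S_imp; first exact: S_cst.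
  by apply: (measn_rel2 eq); [case: (Fc (S i)) | case: (Fc i)].
split; [|split].
- move=> j; apply: (S_if N (F 0%nat) (fun x => F (st x) x) (fun _ a => a = j)) => //.
    by case: (Fc 0%nat) => h _; apply: h.
  by apply: (measn_pre st (fun x n => F n x = j)) => // n; case: (Fc n) => h _; apply: h.
- by move=> x; rewrite /f; case: (dec _) => _; [case: (Fc 0%nat) => _ [] | case: (Fc (st x)) => _ []].
- move=> x y a; case: (classic (N x)) => nx.
    have ny : N y by apply: iN nx; apply: adjE.
    rewrite /f; case: (dec (N x)) => // _; case: (dec (N y)) => // _.
    by case: (Fc 0%nat) => _ [_]; apply.
  have ny : ~ N y by move=> ny; apply: nx; apply: iN ny; apply: adjE; apply: lf_sym.
  rewrite !hf // -(hst x nx (st x + st y)%nat) -?(hst y ny (st x + st y)%nat); try lia.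
  by case: (Fc (st x + st y)%nat) => _ [_]; apply.
Qed.

(** The rounds run through all triples of a set [B], a label and a recoloring, each infinitely
    often. If the limit had candidates of positive density along with a positive gap, so would all
    late colorings, and the rounds for this triple would each move a fixed amount, against
    summability. *)
Lemma stuck_coloring f0 : coloring f0 -> exists f, coloring f /\ ae (fun x =>
  forall B, (B < 2 ^ k)%nat ->
  (exists g0, 0 < g0 /\ forall be al, (be < k)%nat -> (al < k)%nat -> cset B be -> ~ cset B al ->
     g0 <= m (fun y => f y = be) x - m (fun y => f y = al) x) ->
  forall z h, E x z -> ~ improves B f z h).
Proof.
move=> f0c.
(* The round number codes a triple and a repetition counter; reduction modulo [2 ^ k] makes every
   value a legal set [B]. *)
pose pB n := (fst (of_nat (fst (of_nat n))) mod 2 ^ k)%nat.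
pose pi n := fst (of_nat (snd (of_nat (fst (of_nat n))))).
pose pn n := snd (of_nat (snd (of_nat (fst (of_nat n))))).
pose good n f f' A := coloring f' /\ Bo A /\
  ae (fun x => m (fun y => f' y <> f y) x <= INR M * m A x /\
    (forall r, r <= m (candidate f (pB n) (pi n) (pn n)) x ->
       (forall be al, (be < k)%nat -> (al < k)%nat -> cset (pB n) be -> ~ cset (pB n) al -> r <= gap f be al x) -> r <= m A x) /\
    potential k (profile f' x) + m A x <= potential k (profile f x)).
have pBk n : (pB n < 2 ^ k)%nat by apply: Nat.mod_upper_bound; apply: Nat.pow_nonzero.
have hstep (nf : nat * (X -> nat)) : exists fA : (X -> nat) * (X -> Prop),
    coloring (snd nf) -> good (fst nf) (snd nf) (fst fA) (snd fA).
  case: (classic (coloring (snd nf))) => c; last by exists (f0, fun _ => True).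
  by case: (round (snd nf) (pB (fst nf)) (pi (fst nf)) (pn (fst nf)) c (pBk _)) => f' [A h]; exists (f', A).
case: (choose _ hstep) => step {}hstep.
pose F := fix F n := match n with 0 => f0 | S n => fst (step (n, F n)) end.
pose A n := snd (step (n, F n)).
have Fc n : coloring (F n) by elim: n => [|n IH] //=; case: (hstep (n, F n) IH).
have hg n : good n (F n) (F (S n)) (A n) by exact: (hstep (n, F n) (Fc n)).
have AB n : Bo (A n) by case: (hg n) => _ [].
pose Dn n y := F (S n) y <> F n y.
have DB n : Bo (Dn n) by apply: (measn_rel2 (fun a b => a <> b)); [case: (Fc (S n)) | case: (Fc n)].
have g1 : ae (fun x => forall n, m (Dn n) x <= INR M * m (A n) x /\
    (forall r, r <= m (candidate (F n) (pB n) (pi n) (pn n)) x ->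
       (forall be al, (be < k)%nat -> (al < k)%nat -> cset (pB n) be -> ~ cset (pB n) al -> r <= gap (F n) be al x) -> r <= m (A n) x) /\
    potential k (profile (F (S n)) x) + m (A n) x <= potential k (profile (F n) x)).
  by apply: ae_all => n; case: (hg n) => _ [].
have sumA x : (forall n, potential k (profile (F (S n)) x) + m (A n) x <= potential k (profile (F n) x)) ->
    forall n, rsum (fun i => m (A i) x) n <= potential k (profile f0 x).
  move=> h n; suff : potential k (profile (F n) x) + rsum (fun i => m (A i) x) n <= potential k (profile f0 x).
    by have := potential_ge0 k (profile (F n) x); lra.
  by elim: n => [|n IH]; [rewrite /=; lra | have := h n; rewrite [rsum _ (S n)]/=; lra].
have sumD x : (forall n, m (Dn n) x <= INR M * m (A n) x) ->
    forall n, rsum (fun i => m (Dn i) x) n <= INR M * rsum (fun i => m (A i) x) n.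
  by move=> h; elim=> [|n IH] /=; [lra | have := h n; lra].
have bc := borel_cantelli Dn DB.
have ev : ae (fun x => exists n, forall i, (n <= i)%nat -> F (S i) x = F i x).
  apply: ae_mono (ae_and _ _ g1 bc) _ => x [h1 h2].
  case: h2 => [|n h2]; last by exists n => i /h2 h; apply: NNPP.
  exists (INR M * potential k (profile f0 x)) => n.
  apply: Rle_trans (sumD x (fun n => proj1 (h1 n)) n) _.
  by apply: Rmult_le_compat_l; [apply: pos_INR | apply: sumA => j; case: (h1 j) => _ []].
case/ae_inv_null: ev => N [nN [iN hN]].
case: (limit_coloring F N Fc nN iN hN) => f [fc hf].
exists f; split => //.
pose Cn n y := f y <> F n y.
have fB : measn Bo f by case: fc.
have FB n : measn Bo (F n) by case: (Fc n).
have CB n : Bo (Cn n) by apply: (measn_rel2 (fun a b => a <> b)).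
have NB : Bo N by case: nN.
have UB n : Bo (fun y => exists i, Dn (n + i)%nat y) by apply: S_ex.
have t1 : ae (fun x => forall n, m (Cn n) x <= m N x + m (fun y => exists i, Dn (n + i)%nat y) x).
  apply: ae_all => n.
  have b1 := m_union N (fun y => exists i, Dn (n + i)%nat y) NB (UB n).
  have b2 : ae (fun x => m (Cn n) x <= m (fun y => N y \/ exists i, Dn (n + i)%nat y) x).
    apply: m_mono => //; first by apply: S_or.
    move=> y ne; case: (classic (N y)) => ny; [by left | right].
    apply: NNPP => H; apply: ne; case: (hf y ny) => n0 h0.
    rewrite -(h0 (n + n0)%nat); first by lia.
    have const i : F (n + i)%nat y = F n y.
      elim: i => [|i IH]; first by rewrite Nat.add_0_r.
      by rewrite Nat.add_succ_r -IH; apply: NNPP => ne; apply: H; exists i.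
    exact: const.
  by apply: ae_mono (ae_and _ _ b1 b2) _ => x []; lra.
have t2 : ae (fun x => forall n r, (forall j, rsum (fun i => m (Dn (n + i)%nat) x) j <= r) ->
    m (fun y => exists i, Dn (n + i)%nat y) x <= r).
  by apply: ae_all => n; apply: (m_countable (fun i => Dn (n + i)%nat)) => i.
have t3 : ae (fun x => forall n al, m (fun y => F n y = al) x <= m (fun y => f y = al) x + m (Cn n) x /\
                              m (fun y => f y = al) x <= m (fun y => F n y = al) x + m (Cn n) x).
  apply: ae_all => n; apply: ae_all => al; apply: ae_and; last exact: class_close.
  have -> : Cn n = (fun y => F n y <> f y) by apply: pred_ext => y; split => h e; apply: h.
  exact: class_close.
have t4 : ae (fun x => forall n B i j, m (candidate f B i j) x <=
    m (candidate (F n) B i j) x + INR M * INR M * (INR M * INR M * m (Cn n) x)).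
  by apply: ae_all => n; apply: ae_all => B; apply: ae_all => i; apply: ae_all => j; apply: candidate_close.
have key : ae (fun x => forall B i j, (B < 2 ^ k)%nat ->
  (exists g0, 0 < g0 /\ forall be al, (be < k)%nat -> (al < k)%nat -> cset B be -> ~ cset B al ->
     g0 <= m (fun y => f y = be) x - m (fun y => f y = al) x) -> m (candidate f B i j) x = 0).
  apply: ae_mono (ae_and _ _ (ae_and _ _ g1 (m_null N nN)) (ae_and _ _ (ae_and _ _ t1 t2) (ae_and _ _ t3 t4))) _.
  move=> x [[e1 e0] [[e2 e3] [e4 e5]]] B i j lB [g0 [pg hgap]].
  have c0 := m_ge0 m Hm (candidate f B i j) x; case: (Req_dec (m (candidate f B i j) x) 0) => // ne; exfalso.
  set c := m (candidate f B i j) x in c0 ne.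
  have As := sumA x (fun n => proj2 (proj2 (e1 n))).
  have Ds n : rsum (fun i => m (Dn i) x) n <= INR M * potential k (profile f0 x).
    apply: Rle_trans (sumD x (fun n => proj1 (e1 n)) n) _.
    by apply: Rmult_le_compat_l; [apply: pos_INR | apply: As].
  have Csmall e : 0 < e -> exists n0, forall n, (n0 <= n)%nat -> m (Cn n) x <= e.
    move=> pe; case: (rsum_tail _ _ (fun i => m_ge0 m Hm (Dn i) x) Ds e pe) => n0 hn0.
    exists n0 => n le; have := e2 n; rewrite e0.
    suff : m (fun y => exists i, Dn (n + i)%nat y) x <= e by lra.
    apply: e3 => l; have := hn0 ((n - n0) + l)%nat; rewrite rsum_shift.
    have : 0 <= rsum (fun i => m (Dn (n0 + i)%nat) x) (n - n0).
      by apply: (rsum_mono _ 0) => [i'|]; [apply: (m_ge0 m Hm) | lia].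
    have -> : (fun i0 => m (Dn (n0 + (n - n0 + i0))%nat) x) = (fun i0 => m (Dn (n + i0)%nat) x).
      by extensionality i0; congr (m (Dn _) x); lia.
    by lra.
  pose KM := INR M * INR M * (INR M * INR M).
  have KM0 : 0 <= KM by apply: Rmult_le_pos; apply: Rmult_le_pos; apply: pos_INR.
  (* Within [e] of the limit, half of the candidates and half of the gap survive; [r] is then a
     lower bound for the amount moved. *)
  pose e := Rmin (g0 / 4) (c / (2 * (KM + 1))).
  have pe : 0 < e.
    by apply: Rmin_glb_lt; [lra | apply: Rmult_lt_0_compat; [lra | apply: Rinv_0_lt_compat; lra]].
  case: (Csmall e pe) => n1 hn1.
  pose r := Rmin (c / 2) (g0 / 2 * eps (S M)).
  have pr : 0 < r.
    by apply: Rmin_glb_lt; [lra | apply: Rmult_lt_0_compat; [lra | apply: eps_pos]].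
  case: (rsum_tail _ _ (fun i => m_ge0 m Hm (A i) x) As (r / 2) ltac:(lra)) => n2 hn2.
  pose q := to_nat (to_nat (B, to_nat (i, j)), (n1 + n2)%nat).
  have leq : (n1 + n2 <= q)%nat by have := to_nat_non_decreasing (to_nat (B, to_nat (i, j))) (n1 + n2); rewrite -/q; lia.
  have qB : pB q = B by rewrite /pB /q !cancel_of_to /= ?cancel_of_to /= Nat.mod_small.
  have qi : pi q = i by rewrite /pi /q !cancel_of_to /= ?cancel_of_to /= ?cancel_of_to.
  have qn : pn q = j by rewrite /pn /q !cancel_of_to /= ?cancel_of_to /= ?cancel_of_to.
  have small : m (A q) x <= r / 2.
    have := hn2 (S (q - n2)); rewrite /=.
    have -> : (n2 + (q - n2))%nat = q by lia.
    have : 0 <= rsum (fun i => m (A (n2 + i)%nat) x) (q - n2).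
      by apply: (rsum_mono _ 0) => [i'|]; [apply: (m_ge0 m Hm) | lia].
    by lra.
  suff : r <= m (A q) x by lra.
  have Cq := hn1 q ltac:(lia).
  have hc4 : e <= g0 / 4 by apply: Rmin_l.
  have hKM : KM * e <= c / 2.
    have h1 : KM * e <= (KM + 1) * (c / (2 * (KM + 1))).
      by apply: Rmult_le_compat => //; [lra | lra | apply: Rmin_r].
    by have h2 : (KM + 1) * (c / (2 * (KM + 1))) = c / 2 by [field; lra]; lra.
  case: (e1 q) => _ [h _]; apply: h.
    rewrite qB qi qn; have := e5 q B i j; rewrite -/c.
    have : KM * m (Cn q) x <= KM * e by apply: Rmult_le_compat_l.
    have : r <= c / 2 by apply: Rmin_l.
    by rewrite /KM in hKM *; lra.
  move=> be al l1 l2 hbe hal; rewrite qB in hbe hal.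
  apply: (Rle_trans _ (g0 / 2 * eps (S M))); first exact: Rmin_r.
  apply: Rmult_le_compat_r; first by apply: Rlt_le; apply: eps_pos.
  apply: Rle_trans (Rmax_r _ _).
  by have := hgap be al l1 l2 hbe hal; case: (e4 q be) => _; case: (e4 q al) => + _; lra.
have zn : ae (fun x => forall B i j, m (candidate f B i j) x = 0 -> ~ candidate f B i j x).
  apply: ae_all => B; apply: ae_all => i; apply: ae_all => j.
  by apply: m_zero_null; apply: candidate_Bo.
apply: ae_mono (ae_orb _ (ae_and _ _ key zn)) _ => x H B lB hgap z h ez himp.
case: (improves_code B f z h himp) => n hn.
case: (H z ez) => k1 k2; apply: (k2 B (kap z) n) => //; apply: k1 => //.
case: hgap => g0 [pg hg0]; exists g0; split => // be al l1 l2 l3 l4.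
by rewrite -!(m_inv m Hm _ x z ez); apply: hg0.
Qed.

Lemma nsum_filter (p : nat -> bool) n : length (filter p (seq 0 n)) = nsum (fun b => indic (p b = true)) n.
Proof.
elim: n => [|n IH] //; rewrite seq_S filter_app length_app IH /=.
by case E0 : (p n); [rewrite (indic_true (true = true)) | rewrite (indic_false (false = true))].
Qed.

(** * Counting neighbours of a color *)

Definition degree (x : X) (P : X -> Prop) : nat := nsum (fun b => indic (adj x (nu b x) /\ P (nu b x))) M.

Lemma degree_bound x P : (degree x P <= D)%nat.
Proof.
pose p b := if dec (adj x (nu b x) /\ P (nu b x)) then true else false.
have pP b : p b = true <-> (adj x (nu b x) /\ P (nu b x)) by rewrite /p; case: (dec _) => h; split.
have -> : degree x P = length (map (fun b => nu b x) (filter p (seq 0 M))).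
  by rewrite length_map nsum_filter; apply: nsum_ext => b _; apply: indic_iff; rewrite pP.
have hin b : In b (filter p (seq 0 M)) -> adj x (nu b x) by move=> /filter_In [_ /pP []].
apply: (lf_deg x); last by move=> y /in_map_iff [b [<- /hin]].
apply: NoDup_map_NoDup_ForallPairs; last by apply: NoDup_filter; apply: seq_NoDup.
move=> b b' /hin h /hin h' e.
by rewrite -(nu_kap kap b x h) -(nu_kap kap b' x h') e.
Qed.

Lemma degree_term x y (P : X -> Prop) : adj x y -> P y ->
  indic (adj x (nu (kap y) x) /\ P (nu (kap y) x)) = 1%nat.
Proof. by move=> h p; apply: indic_true; rewrite (nu_adj kap kap2 x y h). Qed.

Lemma degree_split f x P : (forall y, (f y < k)%nat) ->
  degree x P = nsum (fun c => degree x (fun y => P y /\ f y = c)) k.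
Proof.
move=> fk; rewrite /degree nsum_swap; apply: nsum_ext => b _.
rewrite (nsum_single _ k (f (nu b x)) (fk _)).
  by move=> c _ ne; apply: indic_false => -[_ [_ e]]; apply: ne.
by apply: indic_iff; tauto.
Qed.

Definition upd (h : X -> nat) (y0 : X) (c : nat) (y : X) : nat := if dec (y = y0) then c else h y.

Lemma upd_same h y0 c : upd h y0 c y0 = c.
Proof. by rewrite /upd; case: (dec _). Qed.

Lemma upd_other h y0 c y : y <> y0 -> upd h y0 c y = h y.
Proof. by rewrite /upd; case: (dec _). Qed.

Lemma ball_count_upd z h y0 c (P : nat -> Prop) : ball z y0 ->
  (ball_count z (fun y => P (upd h y0 c y)) + indic (P (h y0)) =
   ball_count z (fun y => P (h y)) + indic (P c))%nat.
Proof.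
move=> b0.
have e1 : indic (ball_has z (fun y => P (h y)) (kap y0)) = indic (P (h y0)).
  by apply: indic_iff; rewrite ball_hasE (point_ball z y0 b0); tauto.
have e2 : indic (ball_has z (fun y => P (upd h y0 c y)) (kap y0)) = indic (P c).
  by apply: indic_iff; rewrite ball_hasE (point_ball z y0 b0) upd_same; tauto.
rewrite -e1 -e2; apply: (nsum_update (fun b => indic (ball_has z (fun y => P (upd h y0 c y)) b))
  (fun b => indic (ball_has z (fun y => P (h y)) b))) => // b _ ne.
apply: indic_iff; rewrite !ball_hasE; split => -[k1 k2]; split => //.
  by rewrite upd_other in k2 => // e; apply: ne; rewrite -k1 e.
by rewrite upd_other => // e; apply: ne; rewrite -k1 e.
Qed.

(** If [x] gives up its color, [y] can take it: no other neighbour of [y] has this color. *)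
Definition solo (f : X -> nat) (y x : X) : Prop := forall x', adj y x' -> f x' = f x -> x' = x.

Section Counting.
Context (f : X -> nat) (fc : coloring f) (B : nat).

Lemma fk x : (f x < k)%nat. Proof. by case: fc => _ []. Qed.
Lemma fp x y : adj x y -> f x <> f y. Proof. by case: fc => _ [_]; apply. Qed.
Lemma fB : measn Bo f. Proof. by case: fc. Qed.

Lemma improves_single z al : cset B (f z) -> (al < k)%nat -> ~ cset B al -> (forall y, adj z y -> f y <> al) ->
  exists h, improves B f z h.
Proof.
move=> hz la hal free; exists (upd f z al).
have cnt c := ball_count_upd z f z al (cset c) (or_introl eq_refl).
split; [|split; [|split; [|split; [|split]]]].
- by move=> y nb; rewrite upd_other // => e; apply: nb; left.
- by move=> y; rewrite /upd; case: (dec _) => _ //; apply: fk.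
- move=> x y a; rewrite /upd; case: (dec _) => e; case: (dec _) => e'.
  + by subst x y; case: (lf_irr z).
  + by subst x; apply: not_eq_sym; apply: free.
  + by subst y; apply: free; apply: lf_sym.
  + exact: fp.
- by move=> c _; have := cnt c; have := indic_le1 (cset c al); lia.
- move=> c hc; have := cnt c; have := indic_le1 (cset c al).
  by rewrite (indic_true (cset c (f z))); [apply: hc; [apply: fk|] | lia].
- by have := cnt B; rewrite (indic_true (cset B (f z))) // (indic_false (cset B al)) //; lia.
Qed.

(** [z] hands its color to [y] and takes another one outside [B], so that [y] leaves [B]. *)
Lemma improves_swap z y al : ~ cset B (f z) -> adj z y -> cset B (f y) -> solo f y z ->
  (al < k)%nat -> ~ cset B al -> al <> f z -> (forall x, adj z x -> f x <> al) ->
  exists h, improves B f z h.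
Proof.
move=> hz azy hy hsolo la hal ne free.
have yz : y <> z by move=> e; subst y; apply: (lf_irr z).
exists (upd (upd f z al) y (f z)).
have cnt c : (ball_count z (fun x => cset c (upd (upd f z al) y (f z) x)) + indic (cset c (f y)) =
              ball_count z (fun x => cset c (f x)) + indic (cset c al))%nat.
  have := ball_count_upd z (upd f z al) y (f z) (cset c) (or_intror azy).
  have := ball_count_upd z f z al (cset c) (or_introl eq_refl).
  by rewrite (upd_other f z al y yz); lia.
have key x x' : adj x x' -> x = y \/ x = z -> upd (upd f z al) y (f z) x <> upd (upd f z al) y (f z) x'.
  move=> a [e|e]; subst x.
    rewrite upd_same; case: (classic (x' = z)) => [->|nz].
      by rewrite upd_other ?upd_same //; [apply: not_eq_sym | apply: not_eq_sym].
    have ny : x' <> y by move=> e; subst x'; apply: (lf_irr y).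
    by rewrite !upd_other // => e; apply: nz; apply: hsolo.
  rewrite upd_other ?upd_same; first exact: not_eq_sym.
  case: (classic (x' = y)) => [->|ny]; first by rewrite upd_same.
  have nz : x' <> z by move=> e; subst x'; apply: (lf_irr z).
  by rewrite !upd_other //; apply: not_eq_sym; apply: free.
split; [|split; [|split; [|split; [|split]]]].
- move=> x nb; have [n1 n2] : x <> y /\ x <> z by split=> e; apply: nb; rewrite e; [right | left].
  by rewrite !upd_other.
- by move=> x; rewrite /upd; case: (dec _) => _; [apply: fk | case: (dec _) => _ //; apply: fk].
- move=> x x' a; case: (classic (x = y \/ x = z)) => h; first exact: key.
  case: (classic (x' = y \/ x' = z)) => h'; first by apply: not_eq_sym; apply: key => //; apply: lf_sym.
  by rewrite !upd_other; try tauto; apply: fp.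
- by move=> c _; have := cnt c; have := indic_le1 (cset c al); lia.
- move=> c hc; have := cnt c; have := indic_le1 (cset c al).
  by rewrite (indic_true (cset c (f y))); [apply: hc; [apply: fk|] | lia].
- by have := cnt B; rewrite (indic_true (cset B (f y))) // (indic_false (cset B al)) //; lia.
Qed.

(* [z] takes color [ga] and hands its old color to both [y1] and [y2]. *)
Lemma improves_pair z y1 y2 ga : ~ cset B (f z) -> adj z y1 -> adj z y2 -> cset B (f y1) -> cset B (f y2) ->
  solo f y1 z -> solo f y2 z -> y1 <> y2 -> ~ adj y1 y2 ->
  (ga < k)%nat -> cset B ga -> (forall x, adj z x -> x <> y1 -> x <> y2 -> f x <> ga) ->
  exists h, improves B f z h.
Proof.
move=> hz a1 a2 b1 b2 s1 s2 ne na lg hg free.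
have y1z : y1 <> z by move=> e; subst y1; apply: (lf_irr z).
have y2z : y2 <> z by move=> e; subst y2; apply: (lf_irr z).
have gz : ga <> f z by move=> e; apply: hz; rewrite -e.
set h := upd (upd (upd f z ga) y1 (f z)) y2 (f z).
have h1 : h y1 = f z by rewrite /h upd_other ?upd_same.
have h2 : h y2 = f z by rewrite /h upd_same.
have hz' : h z = ga by rewrite /h (upd_other _ y2 _ z (not_eq_sym y2z)) (upd_other _ y1 _ z (not_eq_sym y1z)) upd_same.
have ho x : x <> y1 -> x <> y2 -> x <> z -> h x = f x by move=> *; rewrite /h !upd_other.
exists h.
have cnt c : (ball_count z (fun x => cset c (h x)) + indic (cset c (f y1)) + indic (cset c (f y2)) =
              ball_count z (fun x => cset c (f x)) + indic (cset c ga) + indic (cset c (f z)))%nat.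
  have := ball_count_upd z (upd (upd f z ga) y1 (f z)) y2 (f z) (cset c) (or_intror a2).
  have := ball_count_upd z (upd f z ga) y1 (f z) (cset c) (or_intror a1).
  have := ball_count_upd z f z ga (cset c) (or_introl eq_refl).
  rewrite (upd_other f z ga y1 y1z) (upd_other (upd f z ga) y1 (f z) y2) ?(upd_other f z ga y2 y2z).
    exact: not_eq_sym.
  by rewrite -/h; lia.
have hsolo y x : y = y1 \/ y = y2 -> adj y x -> h y <> h x.
  move=> hy a.
  have hyz : h y = f z by case: hy => ->.
  have sy : solo f y z by case: hy => ->.
  rewrite hyz; case: (classic (x = z)) => [->|nz]; first by rewrite hz'; apply: not_eq_sym.
  have [n1 n2] : x <> y1 /\ x <> y2.
    split=> e; subst x; case: hy => e; subst y.
    - by case: (lf_irr y1).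
    - by apply: na; apply: lf_sym.
    - by apply: na.
    - by case: (lf_irr y2).
  by rewrite ho // => e; apply: nz; apply: sy.
have hzo x : adj z x -> h z <> h x.
  move=> a; case: (classic (x = y1 \/ x = y2)) => hx.
    by apply: not_eq_sym; apply: hsolo => //; apply: lf_sym.
  have nz : x <> z by move=> e; subst x; apply: (lf_irr z).
  by rewrite hz' ho; try tauto; apply: not_eq_sym; apply: free; tauto.
split; [|split; [|split; [|split; [|split]]]].
- by move=> x nb; apply: ho => e; apply: nb; subst x; [right | right | left].
- move=> x; rewrite /h /upd; case: (dec _) => _; first exact: fk.
  by case: (dec _) => _; [apply: fk | case: (dec _) => _ //; apply: fk].
- move=> x x' a; case: (classic (x = y1 \/ x = y2)) => hx; first exact: hsolo.
  case: (classic (x' = y1 \/ x' = y2)) => hx'; first by apply: not_eq_sym; apply: hsolo => //; apply: lf_sym.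
  case: (classic (x = z)) => [e|nz]; first by subst x; apply: hzo.
  case: (classic (x' = z)) => [e|nz']; first by subst x'; apply: not_eq_sym; apply: hzo; apply: lf_sym.
  by rewrite !ho; try tauto; apply: fp.
- move=> c hc; have := cnt c; have := indic_le1 (cset c ga).
  have nz : ~ cset c (f z) by move=> h'; apply: hz; apply: hc => //; apply: fk.
  by rewrite (indic_false _ nz); lia.
- move=> c hc; have := cnt c; have := indic_le1 (cset c ga); have := indic_le1 (cset c (f z)).
  have t1 : cset c (f y1) by apply: hc => //; apply: fk.
  have t2 : cset c (f y2) by apply: hc => //; apply: fk.
  by rewrite (indic_true _ t1) (indic_true _ t2); lia.
- have := cnt B; rewrite (indic_true _ b1) (indic_true _ b2) (indic_true _ hg) (indic_false _ hz).
  by lia.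
Qed.

Context (Dk : (D < k)%nat).
Context (Z : X -> Prop) (ZB : Bo Z) (iZ : invariant Z) (stuck : forall z h, Z z -> ~ improves B f z h).

Lemma stuck_single y al : Z y -> cset B (f y) -> (al < k)%nat -> ~ cset B al -> exists x, adj y x /\ f x = al.
Proof.
move=> zy hy la hal; apply: NNPP => H.
case: (improves_single y al hy la hal) => [x a e|h]; last exact: stuck.
by apply: H; exists x.
Qed.

Lemma stuck_swap z y al : Z z -> ~ cset B (f z) -> adj z y -> cset B (f y) -> solo f y z ->
  (al < k)%nat -> ~ cset B al -> al <> f z -> exists x, adj z x /\ f x = al.
Proof.
move=> zz hz a hy s la hal ne; apply: NNPP => H.
case: (improves_swap z y al hz a hy s la hal ne) => [x a' e|h]; last exact: stuck.
by apply: H; exists x.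
Qed.

Lemma nsum_one n : nsum (fun _ => 1%nat) n = n.
Proof. by elim: n => [|n IH] //=; lia. Qed.

Lemma nsum_but_one (c0 : nat) : (c0 < k)%nat -> (nsum (fun c => indic (c <> c0)) k + 1 = k)%nat.
Proof.
move=> lt; have := nsum_update (fun c => indic (c <> c0)) (fun _ => 1%nat) k c0 lt.
rewrite (indic_false (c0 <> c0)); first by case.
rewrite nsum_one => h; rewrite h; last by lia.
by move=> i _ ne; apply: indic_true.
Qed.

(** Otherwise [stuck_swap] and [improves_pair] give [z], besides [y1] and [y2], a neighbour of every
    color but its own: at least [k + 1] neighbours, more than [D]. *)
Lemma solo_adj z y1 y2 : Z z -> ~ cset B (f z) -> adj z y1 -> adj z y2 -> cset B (f y1) -> cset B (f y2) ->
  solo f y1 z -> solo f y2 z -> y1 <> y2 -> adj y1 y2.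
Proof.
move=> zz hz a1 a2 b1 b2 s1 s2 ne; apply: NNPP => na.
pose Q y := y <> y1 /\ y <> y2.
have hcol c : (c < k)%nat -> c <> f z -> exists x, adj z x /\ (Q x /\ f x = c).
  move=> lc nc; case: (classic (cset B c)) => hc.
    apply: NNPP => H; case: (improves_pair z y1 y2 c hz a1 a2 b1 b2 s1 s2 ne na lc hc) => [x a n1 n2 e|h].
      by apply: H; exists x.
    exact: stuck.
  case: (stuck_swap z y1 c zz hz a1 b1 s1 lc hc nc) => x [a e].
  exists x; split => //; split => //.
  by split=> e'; subst x; apply: hc; rewrite -e.
have d1 : (k <= degree z Q + 1)%nat.
  rewrite (degree_split f z Q fk) -{1}(nsum_but_one (f z) (fk z)).
  suff : (nsum (fun c => indic (c <> f z)) k <= nsum (fun c => degree z (fun y => Q y /\ f y = c)) k)%nat by lia.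
  apply: nsum_le => c lc; case: (classic (c = f z)) => [->|nc]; first by rewrite indic_false; [case | lia].
  rewrite indic_true //; case: (hcol c lc nc) => x [a hx].
  rewrite -(degree_term z x (fun y => Q y /\ f y = c) a hx).
  exact: (nsum_ge1 (fun b => indic (adj z (nu b z) /\ (Q (nu b z) /\ f (nu b z) = c)))).
have d2 : (degree z Q + 2 <= degree z (fun _ => True))%nat.
  have kne : kap y1 <> kap y2 by move=> e; apply: ne; apply: (kap_nbrs kap kap2 z).
  have := nsum_ge2 (fun b => indic (adj z (nu b z) /\ ~ Q (nu b z))) M (kap y1) (kap y2) (kM _) (kM _) kne.
  rewrite !(degree_term z _ (fun y => ~ Q y)) //; try by rewrite /Q; tauto.
  suff -> : degree z (fun _ => True) = (degree z Q + nsum (fun b => indic (adj z (nu b z) /\ ~ Q (nu b z))) M)%nat by lia.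
  rewrite /degree -nsum_add; apply: nsum_ext => b _.
  case: (classic (adj z (nu b z))) => a; last first.
    by rewrite !indic_false //; tauto.
  case: (classic (Q (nu b z))) => q.
    by rewrite indic_true // indic_true // indic_false //; tauto.
  by rewrite indic_true // indic_false ?indic_true //; tauto.
by have := degree_bound z (fun _ => True); lia.
Qed.

Lemma solo_Bo (phi psi : X -> X) : meas Bo Bo phi -> meas Bo Bo psi -> Bo (fun t => solo f (phi t) (psi t)).
Proof.
move=> h1 h2; apply: (S_ext (fun t => forall c, adj (phi t) (nu c (phi t)) ->
    (f (nu c (phi t)) = f (psi t) -> nu c (phi t) = psi t))).
  move=> t; split => [H x' a e|H c]; last exact: H.
  by have := H (kap x'); rewrite (nu_adj kap kap2 _ _ a); apply.
have nm c : meas Bo Bo (fun t => nu c (phi t)) by apply: meas_comp => //; apply: (nu_meas kap kB kap2).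
apply: S_all => c; apply: S_imp; first exact: adj_Bo.
apply: S_imp; last by apply: eq_Bo.
apply: (measn_rel2 eq (fun t => f (nu c (phi t))) (fun t => f (psi t))) => j.
  by apply: (nm c (fun y => f y = j)); apply: fB.
by apply: (h2 (fun y => f y = j)); apply: fB.
Qed.

Lemma list_prod_app_l {I J : Type} (l1 l2 : list I) (l : list J) :
  list_prod (l1 ++ l2) l = list_prod l1 l ++ list_prod l2 l.
Proof. by elim: l1 => [|a l1 IH] //=; rewrite IH app_assoc. Qed.

Lemma multiplicity_prod {J : Type} (F : nat * J -> X -> Prop) n (l : list J) x :
  multiplicity (map F (list_prod (seq 0 n) l)) x = nsum (fun a => multiplicity (map (fun q => F (a, q)) l) x) n.
Proof.
elim: n => [|n IH] //; rewrite seq_S list_prod_app_l map_app multiplicity_app IH /=.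
by rewrite app_nil_r map_map.
Qed.

Lemma nsum_below (Q : Prop) v P : (v <= P)%nat -> nsum (fun i => indic (Q /\ (i < v)%nat)) P = (indic Q * v)%nat.
Proof.
case: (classic Q) => q; last by rewrite nsum_zero ?(indic_false Q) // => i _; apply: indic_false; tauto.
rewrite (indic_true Q) // Nat.mul_1_l; elim: P v => [|P IH] v le /=; first by lia.
case: (Nat.eq_dec v (S P)) => [->|ne].
  rewrite indic_true; first by split => //; lia.
  rewrite (nsum_ext _ (fun _ => 1%nat)) ?nsum_one; last by lia.
  by move=> i lt; apply: indic_true; split => //; lia.
by rewrite IH ?indic_false; lia.
Qed.

(** Double counting of the weights [w y x] along edges. For end labels [a], [b] and a unit [i], the
    edges of weight above [i] form a Borel matching given by [nu b], which compares the densities of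
    its two sides. *)
Lemma mass_transport (w : X -> X -> nat) (P c1 c2 : nat) (Y W : X -> Prop) : Bo Y -> Bo W ->
  (forall y x, (w y x <= P)%nat) ->
  (forall b, measn Bo (fun y => w y (nu b y))) -> (forall a, measn Bo (fun x => w (nu a x) x)) ->
  (forall y, Z y -> Y y -> (c1 <= nsum (fun b => indic (adj y (nu b y)) * w y (nu b y)) M)%nat) ->
  (forall x, Z x -> (nsum (fun a => indic (adj x (nu a x)) * w (nu a x) x) M <= c2 * indic (W x))%nat) ->
  ae (fun x => Z x -> INR c1 * m Y x <= INR c2 * m W x).
Proof.
move=> hY hW wP wB wB' hout hin.
pose F (q : nat * (nat * nat)) y := kap y = fst q /\ (adj y (nu (fst (snd q)) y) /\ (snd (snd q) < w y (nu (fst (snd q)) y))%nat).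
pose G (q : nat * (nat * nat)) x := kap x = fst (snd q) /\ (adj x (nu (fst q) x) /\ (snd (snd q) < w (nu (fst q) x) x)%nat).
pose idx := list_prod (seq 0 M) (list_prod (seq 0 M) (seq 0 P)).
have aB b : Bo (fun y => adj y (nu b y)) by apply: adj_Bo => //; apply: (nu_meas kap kB kap2).
have FB q : Bo (F q).
  rewrite /F; bor; [apply: kB | apply: aB |].
  by apply: (measn_sub (fun y => w y (nu (fst (snd q)) y)) (fun v => (snd (snd q) < v)%nat)); apply: wB.
have GB q : Bo (G q).
  rewrite /G; bor; [apply: kB | apply: aB |].
  by apply: (measn_sub (fun x => w (nu (fst q) x) x) (fun v => (snd (snd q) < v)%nat)); apply: wB'.
have FG : ae (fun x => forall a b i, m (F (a, (b, i))) x <= m (G (a, (b, i))) x).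
  apply: ae_all => a; apply: ae_all => b; apply: ae_all => i.
  apply: m_single_emb => //; apply: (emb_single_mk (nu b)).
  - by apply: (nu_meas kap kB kap2).
  - exact: nu_orb.
  - move=> y [/= ky [ay iy]]; have back := nu_back kap kap2 b y ay; rewrite ky in back.
    split => /=; first exact: (nu_kap kap b y ay).
    by rewrite back; split => //; apply: lf_sym.
  - move=> y y' [/= ky [ay _]] [/= ky' [ay' _]] e.
    by rewrite -(nu_back kap kap2 b y ay) -(nu_back kap kap2 b y' ay') ky ky' e.
have Fm y : multiplicity (map F idx) y = nsum (fun b => indic (adj y (nu b y)) * w y (nu b y))%nat M.
  rewrite /idx multiplicity_prod (nsum_single _ M (kap y) (kM y)).
    move=> a _ ne; rewrite multiplicity_prod; apply: nsum_zero => b _; rewrite multiplicity_seq.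
    by apply: nsum_zero => i _; apply: indic_false => -[/= e _]; apply: ne.
  rewrite multiplicity_prod; apply: nsum_ext => b _; rewrite multiplicity_seq -(nsum_below _ _ P) //.
  by apply: nsum_ext => i _; apply: indic_iff; rewrite /F /=; tauto.
have Gm x : multiplicity (map G idx) x = nsum (fun a => indic (adj x (nu a x)) * w (nu a x) x)%nat M.
  rewrite /idx multiplicity_prod; apply: nsum_ext => a _.
  rewrite multiplicity_prod (nsum_single _ M (kap x) (kM x)).
    move=> b _ ne; rewrite multiplicity_seq.
    by apply: nsum_zero => i _; apply: indic_false => -[/= e _]; apply: ne.
  rewrite multiplicity_seq -(nsum_below _ _ P) //.
  by apply: nsum_ext => i _; apply: indic_iff; rewrite /G /=; tauto.
have a1 : ae (fun x => Z x -> total (repeat Y c1) x <= total (map F idx) x).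
  apply: total_le => //; [exact: Forall_repeat_Bo | exact: Forall_map_Bo |].
  move=> x zx; rewrite multiplicity_repeat Fm; case: (classic (Y x)) => y; last by rewrite indic_false //; lia.
  by rewrite indic_true // Nat.mul_1_r; apply: hout.
have a2 : ae (fun x => Z x -> total (map G idx) x <= total (repeat W c2) x).
  apply: total_le => //; [exact: Forall_map_Bo | exact: Forall_repeat_Bo |].
  by move=> x zx; rewrite multiplicity_repeat Gm; apply: hin.
apply: ae_mono (ae_and _ _ FG (ae_and _ _ a1 a2)) _ => x [h1 [h2 h3]] zx.
have := h2 zx; have := h3 zx; rewrite !total_repeat.
have : total (map F idx) x <= total (map G idx) x by apply: total_map_le => -[a [b i]].
by lra.
Qed.

Lemma degree_add x (P : X -> Prop) : (degree x P + degree x (fun y => ~ P y) <= D)%nat.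
Proof.
apply: Nat.le_trans (degree_bound x (fun _ => True)).
rewrite /degree -nsum_add; apply: nsum_le => b _.
case: (classic (adj x (nu b x))) => a; last by rewrite !indic_false; try tauto; lia.
case: (classic (P (nu b x))) => q.
  by rewrite (indic_false (_ /\ ~ _)) ?(indic_true (_ /\ True)); try tauto; have := indic_le1 (adj x (nu b x) /\ P (nu b x)); lia.
by rewrite (indic_false (_ /\ P _)) ?(indic_true (_ /\ True)); try tauto; have := indic_le1 (adj x (nu b x) /\ ~ P (nu b x)); lia.
Qed.

Lemma degree_colors x (p : nat -> Prop) : (forall al, (al < k)%nat -> p al -> exists y, adj x y /\ f y = al) ->
  (nsum (fun al => indic (p al)) k <= degree x (fun y => p (f y)))%nat.
Proof.
move=> H; rewrite (degree_split f x _ fk); apply: nsum_le => c lc.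
case: (classic (p c)) => hc; last by rewrite indic_false //; lia.
rewrite indic_true //; case: (H c lc hc) => y [a e].
rewrite -(degree_term x y (fun y => p (f y) /\ f y = c) a); first by rewrite e.
exact: (nsum_ge1 (fun b => indic (adj x (nu b x) /\ (p (f (nu b x)) /\ f (nu b x) = c)))).
Qed.

Local Notation outside := (nsum (fun al => indic (~ cset B al)) k).
Local Notation inside := (card k B).

Lemma outside_inside : (outside + inside = k)%nat.
Proof.
rewrite /card -nsum_add -{2}(nsum_one k); apply: nsum_ext => al _.
case: (classic (cset B al)) => h.
  by rewrite (indic_true _ h) indic_false //; tauto.
by rewrite (indic_false _ h) indic_true.
Qed.

(** A unique neighbour of color [al] counts twice; otherwise there are two of them. *)
Lemma stuck_two y al : Z y -> cset B (f y) -> (al < k)%nat -> ~ cset B al ->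
  (2 <= nsum (fun b => indic (adj y (nu b y)) * (indic (f (nu b y) = al) * (1 + indic (solo f y (nu b y))))) M)%nat.
Proof.
move=> zy hy la hal; case: (stuck_single y al zy hy la hal) => x [a e].
pose F b := (indic (adj y (nu b y)) * (indic (f (nu b y) = al) * (1 + indic (solo f y (nu b y)))))%nat.
have Fx x' : adj y x' -> f x' = al -> F (kap x') = (1 + indic (solo f y x'))%nat.
  by move=> a' e'; rewrite /F (nu_adj kap kap2 y x' a') (indic_true _ a') (indic_true _ e'); lia.
change (2 <= nsum F M)%nat; case: (classic (solo f y x)) => s.
  by have := nsum_ge1 F M (kap x) (kM x); rewrite (Fx x a e) (indic_true _ s); lia.
have [x' [a' [e' ne]]] : exists x', adj y x' /\ f x' = f x /\ x' <> x.
  apply: NNPP => H; apply: s => x' a' e'; apply: NNPP => ne; apply: H.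
  by exists x'.
have kne : kap x <> kap x' by move=> ek; apply: ne; apply: eq_sym; apply: (kap_nbrs kap kap2 y).
have := nsum_ge2 F M (kap x) (kap x') (kM x) (kM x') kne.
by rewrite (Fx x a e) (Fx x' a') ?e' //; lia.
Qed.

Lemma nu_measure b : meas Bo Bo (nu b).
Proof. exact: (nu_meas kap kB kap2). Qed.

Lemma set_Bo d : Bo (fun y => cset d (f y)).
Proof. by apply: measn_set; apply: fB. Qed.

Lemma set_nu_Bo d b : Bo (fun y => cset d (f (nu b y))).
Proof. by apply: (nu_measure b (fun y => cset d (f y))); apply: set_Bo. Qed.

(* An edge [y -- x] with [f y] in [B] and [f x = al] carries weight 2 if it is the only one from [y] to
   color [al], and weight 1 otherwise; so [y] sends at least 2. A vertex [x] receiving along a solo edge has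
   neighbours of all colors outside [B] except [al], which leaves room for few neighbours in [B]. *)
Lemma count_few al : (al < k)%nat -> ~ cset B al -> (outside <= inside + 1)%nat ->
  ae (fun x => Z x -> INR 2 * m (fun y => cset B (f y)) x <= INR (2 * inside) * m (fun y => f y = al) x).
Proof.
move=> la hal hab; have kab := outside_inside.
have fcB c : Bo (fun x => f x = c) by apply: fB.
have fcnB c b : Bo (fun x => f (nu b x) = c) by apply: (nu_measure b (fun y => f y = c)).
apply: (mass_transport (fun y x => indic (cset B (f y) /\ f x = al) * (1 + indic (solo f y x)))%nat 2) => //.
- exact: set_Bo.
- move=> y x; have := indic_le1 (cset B (f y) /\ f x = al); have := indic_le1 (solo f y x); nia.
- move=> b; apply: (measn_op2 Nat.mul); first by apply: measn_indic; bor; [apply: set_Bo | apply: fcnB].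
  apply: (measn_op2 Nat.add (fun _ => 1%nat)); first exact: measn_cst.
  by apply: measn_indic; apply: solo_Bo => //; apply: nu_measure.
- move=> b; apply: (measn_op2 Nat.mul); first by apply: measn_indic; bor; [apply: set_nu_Bo | apply: fcB].
  apply: (measn_op2 Nat.add (fun _ => 1%nat)); first exact: measn_cst.
  by apply: measn_indic; apply: solo_Bo => //; apply: nu_measure.
- move=> y zy hy; apply: Nat.le_trans (stuck_two y al zy hy la hal) _.
  apply: nsum_le => b _; apply: Nat.mul_le_mono_l; apply: Nat.mul_le_mono_r.
  exact: indic_le.
move=> x zx; case: (classic (f x = al)) => e; last first.
  rewrite nsum_zero; last by lia.
  by move=> b _; rewrite (indic_false (_ /\ f x = al)) ?Nat.mul_0_l ?Nat.mul_0_r //; tauto.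
rewrite (indic_true _ e) Nat.mul_1_r.
pose dB := degree x (fun y => cset B (f y)).
have dAB := degree_add x (fun y => cset B (f y)); rewrite -/dB in dAB.
have hx : ~ cset B (f x) by rewrite e.
case: (classic (exists y, adj x y /\ cset B (f y) /\ solo f y x)) => [[y [a [hy s]]]|no].
  (* A solo edge forces neighbours of all outside colors but one, so at most [inside] neighbours
     remain in [B], each of weight at most 2. *)
  have dA : (outside <= degree x (fun y => ~ cset B (f y)) + 1)%nat.
    have := degree_colors x (fun al' => ~ cset B al' /\ al' <> f x).
    have := nsum_update (fun al' => indic (~ cset B al')) (fun al' => indic (~ cset B al' /\ al' <> f x)) k (f x) (fk x).
    rewrite (indic_true _ hx) (indic_false (_ /\ f x <> f x)); first by tauto.
    move=> h1 h2.
    have h3 : (nsum (fun al' => indic (~ cset B al')) k + 0 = nsum (fun al' => indic (~ cset B al' /\ al' <> f x)) k + 1)%nat.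
      by apply: h1 => al' _ ne; apply: indic_iff; tauto.
    have h4 : (nsum (fun al' => indic (~ cset B al' /\ al' <> f x)) k <= degree x (fun y => ~ cset B (f y) /\ f y <> f x))%nat.
      by apply: h2 => al' la' [hal' ne]; apply: (stuck_swap x y al').
    have h5 : (degree x (fun y => ~ cset B (f y) /\ f y <> f x) <= degree x (fun y => ~ cset B (f y)))%nat.
      by apply: nsum_le => b _; apply: indic_le; tauto.
    by lia.
  suff : (nsum (fun a0 => indic (adj x (nu a0 x)) * (indic (cset B (f (nu a0 x)) /\ f x = al) * (1 + indic (solo f (nu a0 x) x)))) M <= 2 * dB)%nat by lia.
  rewrite /dB /degree -nsum_mul; apply: nsum_le => b _.
  have := indic_le1 (solo f (nu b x) x).
  case: (classic (adj x (nu b x) /\ cset B (f (nu b x)))) => h.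
    by rewrite (indic_true _ h) (indic_true (adj _ _)) ?(indic_true (_ /\ f x = al)); try tauto; lia.
  rewrite (indic_false _ h); case: (classic (adj x (nu b x))) => h'; last by rewrite (indic_false _ h').
  by rewrite (indic_false (_ /\ f x = al)); [tauto | lia].
(* Without solo edges all weights are at most 1, and [dB <= D <= inside + outside - 1 <= 2 *
   inside]. *)
suff : (nsum (fun a0 => indic (adj x (nu a0 x)) * (indic (cset B (f (nu a0 x)) /\ f x = al) * (1 + indic (solo f (nu a0 x) x)))) M <= dB)%nat by lia.
apply: nsum_le => b _.
case: (classic (adj x (nu b x) /\ cset B (f (nu b x)))) => h.
  rewrite (indic_true _ h) (indic_true (adj _ _)) ?(indic_true (_ /\ f x = al)); try tauto.
  rewrite (indic_false (solo f _ x)); last by lia.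
  by move=> s; apply: no; exists (nu b x); tauto.
rewrite (indic_false _ h); case: (classic (adj x (nu b x))) => h'; last by rewrite (indic_false _ h').
by rewrite (indic_false (_ /\ f x = al)); [tauto | lia].
Qed.

(** Sum [stuck_two] over the colors outside [B]: a solo neighbour contributes to both terms on the
    right. *)
Lemma solo_many y : Z y -> cset B (f y) ->
  (2 * outside <= degree y (fun x => ~ cset B (f x)) + nsum (fun b => indic (adj y (nu b y) /\ (~ cset B (f (nu b y)) /\ solo f y (nu b y)))) M)%nat.
Proof.
move=> zy hy; rewrite -nsum_mul.
apply: (Nat.le_trans _ (nsum (fun al => nsum (fun b => indic (~ cset B al) * (indic (adj y (nu b y)) * (indic (f (nu b y) = al) * (1 + indic (solo f y (nu b y)))))) M) k)%nat).
  apply: nsum_le => al la; rewrite nsum_mul.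
  case: (classic (cset B al)) => h; first by rewrite (indic_false (~ _)); [tauto | lia].
  by rewrite (indic_true _ h); have := stuck_two y al zy hy la h; lia.
rewrite nsum_swap /degree -nsum_add; apply: nsum_le => b _.
rewrite (nsum_single _ k (f (nu b y)) (fk _)).
  by move=> al _ ne; rewrite (indic_false (f (nu b y) = al)); [apply: not_eq_sym | lia].
rewrite (indic_true (f (nu b y) = f (nu b y))) //.
case: (classic (adj y (nu b y))) => a; last by rewrite (indic_false _ a); lia.
case: (classic (cset B (f (nu b y)))) => h; first by rewrite (indic_false (~ cset _ _)); [tauto | lia].
rewrite (indic_true _ h) (indic_true _ a) (indic_true (adj _ _ /\ ~ _)) //.
case: (classic (solo f y (nu b y))) => s.
  by rewrite (indic_true _ s) indic_true.
by rewrite (indic_false _ s); lia.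
Qed.

(* A vertex outside [B] has pairwise adjacent solo neighbours in [B], so that with [d_B y] the number of
   neighbours of [y] in [B] the weights [1 / (d_B y + 1)] of these neighbours sum up to at most 1.
   All weights are multiplied by [b * b!], where [b] is the number of colors in [B]. *)
Lemma count_many : (0 < inside)%nat -> (inside <= outside)%nat ->
  ae (fun x => Z x -> INR (outside * fact inside) * m (fun y => cset B (f y)) x <=
                    INR (inside * fact inside) * m (fun y => ~ cset B (f y)) x).
Proof.
move=> b0 hab; have kab := outside_inside.
pose dB y := degree y (fun x => cset B (f x)).
pose wt y := (inside * (fact inside / (dB y + 1)))%nat.
pose Q y x := cset B (f y) /\ (~ cset B (f x) /\ solo f y x).
have dBB : measn Bo dB.
  rewrite /dB /degree; apply: (measn_nsum (fun b y => indic (adj y (nu b y) /\ cset B (f (nu b y))))) => b.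
  by apply: measn_indic; apply: S_and; [apply: adj_Bo => //; apply: nu_measure | apply: set_nu_Bo].
have wtB : measn Bo wt by move=> j; apply: (measn_sub dB (fun v => (inside * (fact inside / (v + 1)))%nat = j)).
have wt_le y : (wt y <= inside * fact inside)%nat.
  apply: Nat.mul_le_mono_l; apply: Nat.Div0.div_le_upper_bound; nia.
apply: (mass_transport (fun y x => indic (Q y x) * wt y)%nat (inside * fact inside)) => //.
- exact: set_Bo.
- by apply: S_not; apply: set_Bo.
- by move=> y x; have := indic_le1 (Q y x); have := wt_le y; nia.
- move=> b; apply: (measn_op2 Nat.mul) => //; apply: measn_indic; rewrite /Q; bor; [exact: set_Bo | exact: set_nu_Bo |].
  by apply: solo_Bo => //; apply: nu_measure.
- move=> b; apply: (measn_op2 Nat.mul).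
    apply: measn_indic; rewrite /Q; bor; [exact: set_nu_Bo | exact: set_Bo |].
    by apply: solo_Bo => //; apply: nu_measure.
  by move=> j; apply: (nu_measure b (fun y => wt y = j)).
- move=> y zy hy; set si := nsum (fun b => indic (adj y (nu b y) /\ (~ cset B (f (nu b y)) /\ solo f y (nu b y)))) M.
  have hs := solo_many y zy hy; rewrite -/si in hs.
  have dA : (outside <= degree y (fun x => ~ cset B (f x)))%nat.
    by apply: degree_colors => al la hal; apply: stuck_single.
  have dAB := degree_add y (fun x => cset B (f x)); rewrite -/(dB y) in dAB.
  have -> : nsum (fun b => indic (adj y (nu b y)) * (indic (Q y (nu b y)) * wt y))%nat M = (wt y * si)%nat.
    rewrite /si -nsum_mul; apply: nsum_ext => b _.
    case: (classic (adj y (nu b y))) => a; last by rewrite (indic_false _ a) (indic_false (_ /\ _ /\ _)); [tauto | lia].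
    rewrite (indic_true _ a) (indic_iff (Q y (nu b y)) (adj y (nu b y) /\ (~ cset B (f (nu b y)) /\ solo f y (nu b y)))).
      by rewrite /Q; tauto.
    by lia.
  (* All outside colors occur next to [y], hence [dB y + 1 <= inside] and the division in [wt y] is
     exact. *)
  case: (fact_divide (dB y + 1) inside) => [||q Eq]; [lia | lia |].
  have Ew : wt y = (inside * q)%nat by rewrite /wt Eq Nat.div_mul //; lia.
  rewrite Ew Eq.
  (* Combine [hs] with the bound [D < outside + inside] on all neighbours of [y]. *)
  have h1 : (outside - inside + (dB y + 1) <= si)%nat by lia.
  have h2 : (inside * q * (outside - inside + (dB y + 1)) <= inside * q * si)%nat by apply: Nat.mul_le_mono_l.
  apply: Nat.le_trans h2.
  have h3 : ((outside - inside) * (q * (dB y + 1)) <= (outside - inside) * (inside * q))%nat.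
    by apply: Nat.mul_le_mono_l; rewrite Nat.mul_comm; apply: Nat.mul_le_mono_r; lia.
  have -> : (outside * (q * (dB y + 1)) = (outside - inside) * (q * (dB y + 1)) + inside * (q * (dB y + 1)))%nat by nia.
  by nia.
move=> x zx; case: (classic (cset B (f x))) => hx.
  rewrite nsum_zero; last by lia.
  by move=> b _; rewrite (indic_false (Q _ x)); [rewrite /Q; tauto | lia].
rewrite (indic_true _ hx) Nat.mul_1_r.
pose P a := adj x (nu a x) /\ Q (nu a x) x.
set s := nsum (fun a => indic (P a)) M.
(* The solo neighbours of [x] in [B] form a clique by [solo_adj], so each of them sees the [s - 1]
   others. *)
have hterm a : P a -> (s <= dB (nu a x) + 1)%nat.
  case=> ax [ay [_ sy]]; pose y := nu a x.
  have ka : kap y = a by apply: (nu_kap kap a x).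
  have aM : (a < M)%nat by rewrite -ka.
  have e1 : (s + indic (P a /\ a <> a) = nsum (fun a' => indic (P a' /\ a' <> a)) M + indic (P a))%nat.
    by apply: (nsum_update (fun a' => indic (P a'))) => // i _ ne; apply: indic_iff; tauto.
  have := indic_le1 (P a).
  suff : (nsum (fun a' => indic (P a' /\ (a' <> a)%nat)) M <= dB y)%nat.
    by rewrite (indic_false (P a /\ a <> a)) in e1; [tauto | rewrite -/y; lia].
  apply: nsum_le => a' _; apply: indic_le => -[[ax' [ay' [_ sy']]] ne].
  have ka' : kap (nu a' x) = a' by apply: (nu_kap kap a' x).
  have nyy : y <> nu a' x by move=> e; apply: ne; rewrite -ka' -e.
  have ady : adj y (nu a' x) by apply: (solo_adj x).
  have -> : nu a' y = nu a' x by rewrite -{1}ka'; apply: (nu_adj kap kap2).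
  by [].
have hle : (nsum (fun a => indic (adj x (nu a x)) * (indic (Q (nu a x) x) * wt (nu a x))) M <=
            (inside * (fact inside / s)) * s)%nat.
  rewrite {2}/s -nsum_mul; apply: nsum_le => a aM.
  case: (classic (P a)) => h; last first.
    case: (classic (adj x (nu a x))) => a'; last by rewrite (indic_false _ a'); lia.
    by rewrite (indic_false (Q _ x)); [by move=> q; apply: h; split | lia].
  have hs := hterm a h; have s0 : (0 < s)%nat.
    by have := nsum_ge1 (fun a => indic (P a)) M a aM; rewrite (indic_true _ h) -/s; lia.
  rewrite (indic_true _ h); case: (h) => h1 h2; rewrite (indic_true _ h1) (indic_true _ h2).
  suff : (wt (nu a x) <= inside * (fact inside / s))%nat by lia.
  by apply: Nat.mul_le_mono_l; apply: Nat.div_le_compat_l; lia.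
apply: Nat.le_trans hle _; have := Nat.Div0.mul_div_le (fact inside) s; nia.
Qed.

Lemma class_sum (d : nat -> Prop) : Bo (fun y => d (f y)) ->
  ae (fun x => m (fun y => d (f y)) x = rsum (fun al => INR (indic (d al)) * m (fun y => f y = al) x) k).
Proof.
move=> hd; pose F al y := d al /\ f y = al.
have FB al : Bo (F al) by rewrite /F; bor; apply: fB.
have Fm x : multiplicity (map F (seq 0 k)) x = multiplicity [fun y => d (f y)] x.
  rewrite multiplicity_seq /multiplicity /= Nat.add_0_r (nsum_single _ k (f x) (fk x)).
    by move=> c _ ne; apply: indic_false => -[_ e]; apply: ne.
  by apply: indic_iff; rewrite /F; tauto.
have a1 : ae (fun x => total [fun y => d (f y)] x <= total (map F (seq 0 k)) x).
  apply: total_le_all; [by apply: Forall_cons => //; apply: Forall_nil | exact: Forall_map_Bo |].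
  by move=> x; rewrite Fm.
have a2 : ae (fun x => total (map F (seq 0 k)) x <= total [fun y => d (f y)] x).
  apply: total_le_all; [exact: Forall_map_Bo | by apply: Forall_cons => //; apply: Forall_nil |].
  by move=> x; rewrite Fm.
apply: ae_mono (ae_and _ _ (ae_and _ _ a1 a2) m_empty) _ => x [[h1 h2] h3].
have Fe al : m (F al) x = INR (indic (d al)) * m (fun y => f y = al) x.
  case: (classic (d al)) => h.
    rewrite (indic_true _ h) Rmult_1_l; congr (m _ x); apply: pred_ext => y; rewrite /F; tauto.
  rewrite (indic_false _ h) Rmult_0_l -h3; congr (m _ x); apply: pred_ext => y; rewrite /F; tauto.
have Et n : total (map F (seq 0 n)) x = rsum (fun al => INR (indic (d al)) * m (fun y => f y = al) x) n.
  elim: n => [|n IH]; first by [].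
  by rewrite seq_S map_app total_app IH /total /= Fe; lra.
by rewrite !Et in h1 h2; move: h1 h2; rewrite /total /=; lra.
Qed.

(** By [key] every class outside [B] is less dense than the average class in [B]; each of the two
    counting lemmas yields an opposite inequality. *)
Lemma stuck_impossible : (exists be, (be < k)%nat /\ cset B be) -> (exists al, (al < k)%nat /\ ~ cset B al) ->
  (forall x be al, Z x -> (be < k)%nat -> (al < k)%nat -> cset B be -> ~ cset B al ->
     m (fun y => f y = al) x < m (fun y => f y = be) x) -> ae (fun x => ~ Z x).
Proof.
move=> [be0 [lb0 hb0]] [al0 [la0 ha0]] hlt.
have b0 : (0 < inside)%nat by have := nsum_ge1 (fun al => indic (cset B al)) k be0 lb0; rewrite (indic_true _ hb0) /card; lia.
have a0 : (0 < outside)%nat by have := nsum_ge1 (fun al => indic (~ cset B al)) k al0 la0; rewrite (indic_true _ ha0); lia.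
have s1 := class_sum (cset B) (set_Bo B).
have hn : Bo (fun y => ~ cset B (f y)) by apply: S_not; apply: set_Bo.
have s2 := class_sum (fun al => ~ cset B al) hn.
have key x al : m (fun y => cset B (f y)) x = rsum (fun al => INR (indic (cset B al)) * m (fun y => f y = al) x) k ->
    Z x -> (al < k)%nat -> ~ cset B al -> INR inside * m (fun y => f y = al) x < m (fun y => cset B (f y)) x.
  move=> -> zx la hal; rewrite /card INR_nsum Rmult_comm -rsum_scal; apply: rsum_lt.
    move=> be lb; case: (classic (cset B be)) => h; last by rewrite (indic_false _ h) /=; lra.
    by rewrite (indic_true _ h) /=; have := hlt x be al zx lb la h hal; lra.
  exists be0; split => //; rewrite (indic_true _ hb0) /=; have := hlt x be0 al zx lb0 la hb0 hal; lra.
case: (le_lt_dec outside (inside + 1)) => hab.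
  apply: ae_mono (ae_and _ _ s1 (count_few al0 la0 ha0 hab)) _ => x [h1 h2] zx.
  by have := h2 zx; have := key x al0 h1 zx la0 ha0; rewrite mult_INR /=; lra.
have hab' : (inside <= outside)%nat by lia.
apply: ae_mono (ae_and _ _ (ae_and _ _ s1 s2) (count_many b0 hab')) _ => x [[h1 h2] h3] zx.
have pf : 0 < INR (fact inside) by apply: lt_0_INR; apply: lt_O_fact.
have := h3 zx; rewrite !mult_INR => h4.
have h5 : INR outside * m (fun y => cset B (f y)) x <= INR inside * m (fun y => ~ cset B (f y)) x.
  by apply: (Rmult_le_reg_r (INR (fact inside))) => //; lra.
suff : INR inside * m (fun y => ~ cset B (f y)) x < INR outside * m (fun y => cset B (f y)) x by lra.
rewrite h2 -rsum_scal INR_nsum (Rmult_comm (rsum _ _)) -rsum_scal; apply: rsum_lt.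
  move=> al la; case: (classic (cset B al)) => h.
    by rewrite (indic_false (~ cset B al)) /=; [tauto | lra].
  by rewrite (indic_true _ h) /=; have := key x al h1 zx la h; lra.
exists al0; split => //; rewrite (indic_true _ ha0) /=; have := key x al0 h1 zx la0 ha0; lra.
Qed.

End Counting.

Lemma finite_max (s : nat -> R) n : (0 < n)%nat -> exists i, (i < n)%nat /\ forall j, (j < n)%nat -> s j <= s i.
Proof.
elim: n => [|n IH] lt; first by lia.
case: (Nat.eq_dec n 0) => [->|ne]; first by exists 0%nat; split => // j lj; have -> : j = 0%nat by [lia]; lra.
case: IH => [|i [li hi]]; first by lia.
case: (Rle_lt_dec (s n) (s i)) => h.
  exists i; split; first by lia.
  by move=> j lj; case: (Nat.eq_dec j n) => [->//|nj]; apply: hi; lia.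
exists n; split; first by lia.
move=> j lj; case: (Nat.eq_dec j n) => [->|nj]; first by lra.
by have := hi j ltac:(lia); lra.
Qed.

(** Take for [B] the colors of maximal density on an orbit. If a color were missing from [B] there
    would be a gap, which [stuck_impossible] excludes off a null set. *)
Lemma equal_classes f0 : (D < k)%nat -> coloring f0 -> exists f, coloring f /\
  ae (fun x => forall al be, (al < k)%nat -> (be < k)%nat -> m (fun y => f y = al) x = m (fun y => f y = be) x).
Proof.
move=> Dk f0c; case: (stuck_coloring f0 f0c) => f [fc hs]; exists f; split => //.
have fB' : measn Bo f by case: fc.
case/ae_inv_null: hs => N [nN [iN hN]].
have NB : Bo N by case: nN.
pose s x c := m (fun y => f y = c) x.
pose Z B x := (forall be al, (be < k)%nat -> ((al < k)%nat -> (cset B be -> (~ cset B al -> s x al < s x be)))) /\ ~ N x.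
have hZ B : (B < 2 ^ k)%nat -> (exists be, (be < k)%nat /\ cset B be) -> (exists al, (al < k)%nat /\ ~ cset B al) ->
    ae (fun x => ~ Z B x).
  move=> lB hb ha; apply: (stuck_impossible f fc B Dk (Z B)) => //.
  - rewrite /Z; bor; apply: measR_lt; apply: m_meas; exact: fB'.
  - move=> x y e [h1 h2]; split; last by apply: (invariant_not _ iN _ _ e h2).
    by move=> be al; rewrite /s -!(m_inv m Hm _ x y e); apply: h1.
  - move=> z h [h1 h2]; apply: (hN z h2 B lB) => //; last exact: orb_refl.
    case: hb => be0 [lb0 hb0]; case: ha => al0 [la0 ha0].
    have k0 : (0 < k)%nat by lia.
    (* The gap has a positive minimum over the finitely many colors; colors on the wrong side of [B]
       are replaced by the defaults [al0] and [be0]. *)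
    case: (finite_max (fun al => if dec (cset B al) then s z al0 else s z al) k k0) => a1 [l1 h3].
    case: (finite_max (fun be => if dec (cset B be) then - s z be else - s z be0) k k0) => b1 [l2 h4].
    pose A1 := if dec (cset B a1) then al0 else a1; pose B1 := if dec (cset B b1) then b1 else be0.
    have [pA qA] : (A1 < k)%nat /\ ~ cset B A1 by rewrite /A1; case: (dec _).
    have [pB qB] : (B1 < k)%nat /\ cset B B1 by rewrite /B1; case: (dec _).
    exists (s z B1 - s z A1); split; first by have := h1 B1 A1 pB pA qB qA; lra.
    move=> be al lb la cb ca; rewrite -/(s z be) -/(s z al).
    have := h3 al la; have := h4 be lb; rewrite /A1 /B1.
    by case: (dec (cset B a1)) => _; case: (dec (cset B b1)) => _; case: (dec (cset B be)) => // _; case: (dec (cset B al)) => // _; lra.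
  - by move=> x be al [h _] *; apply: h.
have hZ' : ae (fun x => forall B, (B < 2 ^ k)%nat -> (exists be, (be < k)%nat /\ cset B be) ->
    (exists al, (al < k)%nat /\ ~ cset B al) -> ~ Z B x).
  apply: ae_all => B; case: (classic ((B < 2 ^ k)%nat /\ (exists be, (be < k)%nat /\ cset B be) /\
    (exists al, (al < k)%nat /\ ~ cset B al))) => [[h1 [h2 h3]]|h].
    by apply: ae_mono (hZ B h1 h2 h3) _.
  by apply: ae_true => x h1 h2 h3; case: h.
apply: ae_mono (ae_and _ _ hZ' (ae_null _ nN)) _ => x [h1 nx] al be la lb.
case: (finite_max (s x) k) => [|c0 [lc hc]]; first by lia.
suff H c : (c < k)%nat -> s x c = s x c0 by rewrite -/(s x al) -/(s x be) !H.
move=> lc'; apply: NNPP => ne.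
case: (cset_code k (fun c => s x c = s x c0)) => B [lB hB].
apply: (h1 B lB); [by exists c0; rewrite hB | by exists c; rewrite hB |].
split => // b' a' lb' la'; rewrite !hB // => -> na.
by have := hc a' la'; case: (Rtotal_order (s x a') (s x c0)) => [//|[//|]]; lra.
Qed.

(** * The compressible part *)

Lemma reach_Bo r (phi psi : X -> X) : meas Bo Bo phi -> meas Bo Bo psi -> Bo (fun x => reach adj r (phi x) (psi x)).
Proof.
move=> h1 h2; elim: r phi h1 => [|r IH] phi h1 /=; first exact: eq_Bo.
apply: S_or; first exact: IH.
apply: (S_ext (fun x => exists b, adj (phi x) (nu b (phi x)) /\ reach adj r (nu b (phi x)) (psi x))).
  move=> x; split => [[b [a h]]|[z [a h]]]; first by exists (nu b (phi x)).
  by exists (kap z); rewrite (nu_adj kap kap2 _ _ a).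
have nm b : meas Bo Bo (fun x => nu b (phi x)) by apply: meas_comp => //; apply: (nu_meas kap kB kap2).
by apply: S_ex => b; apply: S_and; [apply: adj_Bo | apply: IH].
Qed.

Lemma reach_split n s x y : reach adj (n + s) x y -> exists w, reach adj n x w /\ reach adj s w y.
Proof.
elim: n x => [|n IH] x /=; first by exists x.
case=> [/IH|[z [a /IH]]] [w [h1 h2]]; exists w; split => //; first by left.
by right; exists z.
Qed.

Lemma reach_orb r x y : reach adj r x y -> E x y.
Proof.
elim: r x => [|r IH] x /=; first by move=> ->; apply: orb_refl.
by case=> [/IH//|[z [/adjE h /IH]]]; apply: orb_trans.
Qed.

Definition at_distance (n : nat) (x y : X) : Prop := reach adj n x y /\ forall j, (j < n)%nat -> ~ reach adj j x y.

Section Syndetic.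
Context (reachE : forall x y, E x y -> exists r, reach adj r x y).

(** Orbits are infinite and balls finite, so some point is at least [n] away; a shortest path to it
    passes a point at distance exactly [n]. *)
Lemma at_distance_exists n x : exists y, at_distance n x y.
Proof.
case: (reach_list (adj := adj) n) => N /(_ x) [l [_ hl]].
case: (ac_inf x l) => i hi; pose y := g i x.
have ex := reachE x y (orb_g i x).
case: (leastP _ ex) => h1 h2; set r := least _ in h1 h2.
have nr : (n <= r)%nat.
  case: (le_lt_dec n r) => // lt; case: hi; apply: hl; apply: (reach_mono r) => //; lia.
have hr : reach adj (n + (r - n)) x y by have -> : (n + (r - n) = r)%nat by lia.
case: (reach_split n (r - n) x y hr) => w [k1 k2].
exists w; split => // j lj hj; apply: (h2 (j + (r - n))%nat); first by lia.
exact: reach_trans hj k2.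
Qed.

(* The centers are far apart but meet every ball of bounded radius; color [al] is reserved for the points
   chosen at distance [2 * al] from a center. *)
Lemma syndetic_coloring : (D < k)%nat -> exists h, coloring h /\ exists L, forall al x, (al < k)%nat ->
  exists y, reach adj L x y /\ h y = al.
Proof.
(* Adjacent chosen points bring their centers within [2 * al + 1 + 2 * be], which is below
   [4 * k + 1]; so these centers coincide. *)
move=> Dk; pose r := (4 * k + 1)%nat.
case: (finite_coloring (adj := adj) r) => M' [c [cB [cM cr]]].
pose center z := ~ exists y, reach adj r z y /\ (c y < c z)%nat.
have centerB : Bo center.
  apply: (measn_pre c (fun z n => ~ exists y, reach adj r z y /\ (c y < n)%nat)) => // n.
  by apply: S_not; apply: reach_nbr; apply: (measn_sub c (fun v => (v < n)%nat)).
have center_far z z' : center z -> center z' -> reach adj r z z' -> z = z'.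
  move=> h h' hr; apply: NNPP => ne; have := cr _ _ hr ne.
  case: (Nat.lt_total (c z) (c z')) => [lt|[//|lt]] _.
    by apply: h'; exists z; split => //; apply: reach_sym.
  by apply: h; exists z'.
(* A point that is no center sees a smaller label within [r], and at most [M'] such descents are
   possible. *)
have center_near x : exists z, reach adj (M' * r) x z /\ center z.
  suff : forall n x, (c x < n)%nat -> exists z, reach adj (n * r) x z /\ center z by apply.
  elim=> [|n IH] {}x lt; first by lia.
  case: (classic (center x)) => hx; first by exists x; split => //; apply: reach_refl.
  case: (NNPP _ hx) => y [h1 h2]; case: (IH y) => [|z [h3 h4]]; first by lia.
  by exists z; split => //; apply: reach_trans h1 h3.
pose pt al := select (fun i z => at_distance (2 * al) z (g i z)).
have ptP al z : at_distance (2 * al) z (pt al z).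
  case: (selectP (fun i z => at_distance (2 * al) z (g i z)) z); last by move=> i [h [e _]]; rewrite /pt e.
  case: (at_distance_exists (2 * al) z) => y [h1 h2].
  by case: (reach_orb _ _ _ h1) => i e; exists i; rewrite e.
have ptB al : meas Bo Bo (pt al).
  apply: select_meas => i; have gi : meas Bo Bo (g i) := ac_meas i; rewrite /at_distance; bor; last by apply: (reach_Bo _ (fun z => z) (g i)); [apply: meas_id | exact: gi].
  by apply: (reach_Bo _ (fun z => z) (g i)); [apply: meas_id | exact: gi].
pose Y al y := exists z, center z /\ pt al z = y.
have YB al : Bo (Y al) by apply: image_Bo => // x; apply: select_orb.
have Ysep al be x y : (al < k)%nat -> (be < k)%nat -> Y al x -> Y be y -> reach adj 1 x y -> al = be /\ x = y.
  move=> la lb [z [hz ex]] [z' [hz' ey]] hxy.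
  have [dx nx] := ptP al z; have [dy ny] := ptP be z'; rewrite ex in dx nx; rewrite ey in dy ny.
  have h1 : reach adj (2 * al + 1) z y by apply: reach_trans dx hxy.
  have h2 : reach adj (2 * al + 1 + 2 * be) z z' by apply: reach_trans h1 _; apply: reach_sym.
  have zz : z = z' by apply: center_far => //; apply: (reach_mono _ r) h2; rewrite /r; lia.
  subst z'.
  have h3 : reach adj (2 * be + 1) z x by apply: reach_trans dy _; apply: reach_sym.
  (* For one center, the distances reserved for different colors differ by at least 2, which
     adjacency cannot bridge. *)
  have ab : al = be.
    case: (Nat.lt_total al be) => [lt|[//|lt]].
      by case: (ny (2 * al + 1)%nat) => //; lia.
    by case: (nx (2 * be + 1)%nat) => //; lia.
  by subst be; rewrite -ex -ey.
(* The value [k] means that no color is reserved at [x]. *)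
pose p x := least (fun a => a = k \/ Y a x).
have pB : measn Bo p by apply: (measn_least (fun a x => a = k \/ Y a x)) => a; bor.
have pY x : (p x < k)%nat -> Y (p x) x.
  move=> lt; case: (leastP (fun a => a = k \/ Y a x)); first by exists k; left.
  by rewrite -/(p x) => -[e|//] _; lia.
have Yp al x : (al < k)%nat -> Y al x -> p x = al.
  move=> la y; have le : (p x <= al)%nat by apply: (least_le (fun a => a = k \/ Y a x)); right.
  case: (Ysep (p x) al x x) => //; try lia; last exact: reach_refl.
  by apply: pY; lia.
case: (extend_coloring k p Dk pB) => [x y a lt e|h [h1 [h2 [h3 h4]]]].
  case: (Ysep (p x) (p y) x y) => //; try lia; [exact: pY | by apply: pY; lia | exact: reach_adj |].
  by move=> _ exy; subst y; case: (lf_irr x).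
exists h; split => //; exists (M' * r + 2 * k)%nat => al x la.
case: (center_near x) => z [k1 k2]; exists (pt al z); split.
  apply: (reach_trans _ _ _ z) => //; case: (ptP al z) => k3 _.
  by apply: reach_mono k3; lia.
have hY : Y al (pt al z) by exists z.
by rewrite h4 (Yp al).
Qed.

Lemma infinite_fiber (s : nat -> nat) n : (forall i, (s i < n)%nat) -> exists j, forall a, exists i, (a <= i)%nat /\ s i = j.
Proof.
move=> h; suff H : forall b, (forall i, (b <= i)%nat -> (s i < n)%nat) -> exists j, forall a, exists i, (a <= i)%nat /\ s i = j.
  by apply: (H 0%nat) => i _; apply: h.
elim: n {h} => [|n IH] b h; first by have := h b (le_n b); lia.
case: (classic (forall a, exists i, (a <= i)%nat /\ s i = n)) => [H|H]; first by exists n.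
have [a Ha] : exists a, ~ exists i, (a <= i)%nat /\ s i = n by apply: not_all_ex_not.
apply: (IH (Nat.max a b)) => i le.
have lb : (b <= i)%nat by lia.
have := h i lb; case: (Nat.eq_dec (s i) n) => [e|]; last by lia.
by case: Ha; exists i; split => //; lia.
Qed.

(* The infinitely many disjoint copies of [N] inside the space can be pushed into [A] by moving each point
   by at most [L] steps. This is injective up to a finite label, and one label occurs infinitely often. *)
Lemma emb_syndetic N A L : null N -> invariant N -> Bo A -> (forall x, exists y, reach adj L x y /\ A y) ->
  emb (single N) (single (fun x => A x /\ N x)).
Proof.
move=> [NB [Th [[Tm TE] [Tin Tinj]]]] iN AB near.
(* Points moved to the same place are within [L + L] of each other, so [c] tells them apart. *)
case: (finite_coloring (adj := adj) (L + L)) => M' [c [cB [cM cr]]].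
pose T n x := snd (Th (n, x)).
have TB n : meas Bo Bo (T n) by move=> C HC; apply: (Tm (fun q => C (snd q)) _ n) => i.
have TO n x : E x (T n x) by apply: (TE (n, x)).
have T_inj n n' x y : N x -> N y -> T n x = T n' y -> n = n' /\ x = y.
  move=> nx ny e; suff [] : (n, x) = (n', y) by [].
  apply: Tinj => //; apply: injective_projections => //.
  by case: (Tin (n, x) nx) => -> _; case: (Tin (n', y) ny).
pose Q i x := A (g i x) /\ reach adj L x (g i x).
pose p := select Q.
have pB : meas Bo Bo p.
  by apply: select_meas => i; have gi : meas Bo Bo (g i) := ac_meas i; rewrite /Q; bor; [apply: gi | apply: (reach_Bo _ (fun z => z) (g i)); [apply: meas_id | exact: gi]].
have pP x : A (p x) /\ reach adj L x (p x).
  case: (selectP Q x); last by move=> i [h [e _]]; rewrite /p e.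
  case: (near x) => y [h1 h2]; case: (reach_orb _ _ _ h1) => i e.
  by exists i; rewrite /Q e.
have p_inj x y : c x = c y -> p x = p y -> x = y.
  move=> ec ep; apply: NNPP => ne; apply: (cr x y) => //.
  case: (pP x) => _ h; case: (pP y) => _ h'; rewrite ep in h.
  by apply: reach_trans h _; apply: reach_sym.
pose rich j x := forall a, exists n, (a <= n)%nat /\ c (T n x) = j.
have cT n j : Bo (fun x => c (T n x) = j) by apply: (TB n (fun y => c y = j)).
have richB j : Bo (rich j) by rewrite /rich; bor.
have richE x : exists j, rich j x by apply: (infinite_fiber (fun n => c (T n x)) M').
pose idx x := least (fun j => saturation (rich j) x).
apply: (emb_pieces idx).
- by apply: measn_least => j; apply: saturation_Bo.
- move=> x y e; apply: least_ext => j.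
  by split; apply: saturation_inv => //; apply: orb_sym.
move=> j.
(* At a rich point, [en i x] enumerates the copies of [x] that carry the label [j]. *)
pose en := fix en i x := match i with
  | 0 => least (fun n => c (T n x) = j)
  | S i => least (fun n => (en i x < n)%nat /\ c (T n x) = j) end.
have enB i : measn Bo (en i).
  elim: i => [|i IH] /=; first exact: (measn_least (fun n x => c (T n x) = j)).
  apply: (measn_least (fun n x => (en i x < n)%nat /\ c (T n x) = j)) => n; apply: S_and => //.
  exact: (measn_sub (en i) (fun v => (v < n)%nat)).
have enP i x : rich j x -> c (T (en i x) x) = j.
  case: i => [|i] h /=.
    by case: (h 0%nat) => n [_ e]; apply: (proj1 (leastP (fun n => c (T n x) = j) _)); exists n.
  case: (h (S (en i x))) => n [l e].
  by case: (leastP (fun n => (en i x < n)%nat /\ c (T n x) = j)) => [|[]]; first by exists n.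
have enS i x : rich j x -> (en i x < en (S i) x)%nat.
  move=> h /=; case: (h (S (en i x))) => n [l e].
  by case: (leastP (fun n => (en i x < n)%nat /\ c (T n x) = j)) => [|[]]; first by exists n.
have en_lt i i' x : rich j x -> (i < i')%nat -> (en i x < en i' x)%nat.
  by move=> h; elim=> [|i'' _ IH]; [apply: enS | apply: Nat.lt_trans IH (enS _ _ h)].
(* [x] goes to a rich point of its orbit and then into copy number [en (first x)]: points sent to
   one rich point by different group elements thus land in different copies. *)
pose first x := least (fun i => rich j (g i x)).
have firstB : measn Bo first by apply: (measn_least (fun i x => rich j (g i x))) => i; apply: ac_meas.
pose put i x := p (T (en i x) x).
have putB i : meas Bo Bo (put i).
  move=> C HC; apply: (measn_pre (en i) (fun x n => C (p (T n x)))) => // n.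
  by apply: (TB n (fun y => C (p y))); apply: pB.
have first_rich x : idx x = j -> rich j (g (first x) x).
  move=> e; suff h : exists i, rich j (g i x) by apply: (proj1 (leastP _ h)).
  rewrite -e; apply: (proj1 (leastP (fun j => saturation (rich j) x) _)).
  by case: (richE x) => j' h; exists j'; apply: saturation_sub.
have putO i x : E x (put i x) by apply: orb_trans (TO _ _) (select_orb _ _).
have phiO x : E x (put (first x) (g (first x) x)) by apply: orb_trans (orb_g _ _) (putO _ _).
apply: (emb_mk (fun _ _ => 0%nat) (fun _ x => put (first x) (g (first x) x))) => //.
- by move=> _; apply: measn_cst.
- move=> _ C HC; apply: (measn_pre first (fun x i => C (put i (g i x)))) => // i.
  by apply: (ac_meas i (fun x => C (put i x))); apply: putB.
- move=> i x [[/= e nx] _]; split => //=; split; last by apply: iN nx.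
  by case: (pP (T (en (first x) (g (first x) x)) (g (first x) x))).
- move=> i i' x y [[/= -> nx] ix] [[/= -> ny] iy] _ e; split => //.
  have rx := first_rich x ix; have ry := first_rich y iy.
  have e' := p_inj _ _ (eq_trans (enP _ _ rx) (eq_sym (enP _ _ ry))) e.
  case: (T_inj _ _ _ _ (iN _ _ (orb_g _ _) nx) (iN _ _ (orb_g _ _) ny) e') => e1 e2.
  rewrite -e2 in e1; have ef : first x = first y.
    case: (Nat.lt_total (first x) (first y)) => [lt|[//|lt]].
      by have := en_lt _ _ _ rx lt; lia.
    by have := en_lt _ _ _ rx lt; lia.
  by rewrite -ef in e2; apply: g_inj e2.
Qed.

End Syndetic.

(** * Gluing equidecompositions *)

Definition equivalent (A B : X -> Prop) : Prop := exists phi, meas Bo Bo phi /\ (forall x, E x (phi x)) /\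
  (forall x, A x -> B (phi x)) /\ (forall x y, A x -> A y -> phi x = phi y -> x = y) /\
  forall y, B y -> exists x, A x /\ phi x = y.

(** The classical argument; the iterated images are Borel since images along orbits are, by
    [image_Bo]. *)
Lemma schroeder_bernstein A B : Bo A -> Bo B -> emb (single A) (single B) -> emb (single B) (single A) ->
  equivalent A B.
Proof.
move=> hA hB /emb_singleP [f [fB [fE [fin finj]]]] /emb_singleP [h [hm [hE [hin hinj]]]].
case: (emb_inverse h B hm hE hB hinj) => h' [hm' [hE' hK]].
pose img (Q : X -> Prop) y := exists x, Q x /\ h x = y.
have imgB Q : Bo Q -> Bo (img Q) by move=> hQ; apply: image_Bo.
pose C := fix C n := match n with
  | 0 => fun x => A x /\ ~ img B x
  | S n => img (fun y => exists x, C n x /\ f x = y) end.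
have CB n : Bo (C n) by elim: n => [|n IH] /=; [bor; apply: imgB | apply: imgB; apply: image_Bo].
pose U x := exists n, C n x.
have UB : Bo U by apply: S_ex.
have CA n x : C n x -> A x by elim: n x => [|n IH] x /=; [case | move=> [y [[z [/IH hz <-]] <-]]; auto].
have notU x : A x -> ~ U x -> exists y, B y /\ h y = x.
  by move=> ax nu; apply: NNPP => H; apply: nu; exists 0%nat.
have fU x : U x -> U (h (f x)) by move=> [n hn]; exists (S n), (f x); split => //; exists x.
exists (fun x => if dec (U x) then f x else h' x); split; [|split; [|split; [|split]]].
- by move=> Q HQ; apply: (S_if _ _ _ (fun _ => Q)) => //; [apply: fB | apply: hm'].
- by move=> x; case: (dec _).
- move=> x ax; case: (dec _) => u; first exact: fin.
  by case: (notU x ax u) => y [b <-]; rewrite hK.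
- have key x y : A x -> A y -> U x -> ~ U y -> f x <> h' y.
    move=> ax ay ux uy e; case: (notU y ay uy) => z [bz ez].
    by rewrite -ez hK // in e; apply: uy; rewrite -ez -e; apply: fU.
  move=> x y ax ay; case: (dec _) => ux; case: (dec _) => uy e.
  + exact: finj.
  + by case: (key x y).
  + by case: (key y x).
  + case: (notU x ax ux) => z [bz ez]; case: (notU y ay uy) => z' [bz' ez'].
    by rewrite -ez -ez' !hK // in e; rewrite -ez -ez' e.
- move=> y b; case: (classic (U (h y))) => u.
    case: (u) => -[|n] /=; first by case=> _ []; exists y.
    move=> [z [[x [cx e]] ez]]; have ax := CA n x cx; exists x; split => //.
    case: (dec _) => ux; last by case: ux; exists n.
    by rewrite e; apply: hinj => //; rewrite -e; apply: fin.
  by exists (h y); split; [apply: hin | case: (dec _) => // _; apply: hK].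
Qed.

Lemma greedy_equivalent A B Z : Bo A -> Bo B -> invariant Z ->
  (forall x, Z x -> ~ left_rest A B x /\ ~ right_rest A B x) ->
  equivalent (fun x => A x /\ Z x) (fun x => B x /\ Z x).
Proof.
move=> hA hB iZ h; exists (greedy_map A B); split; first exact: greedy_map_meas.
split; first exact: greedy_orb.
split; [|split].
- move=> x [a z]; split; first by case: (greedy_map_in A B x a) => //; case: (h x z).
  by apply: iZ z; apply: greedy_orb.
- move=> x y [ax zx] [ay zy]; apply: greedy_map_inj => //; [by case: (h x zx) | by case: (h y zy)].
- move=> y [b z]; case: (greedy_map_surj A B y b) => [|x [a [_ e]]]; first by case: (h y z).
  exists x; split => //; split => //; apply: iZ z; apply: orb_sym; rewrite -e.
  exact: greedy_orb.
Qed.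

Lemma equivalent_glue A B N : Bo N -> equivalent (fun x => A x /\ N x) (fun x => B x /\ N x) ->
  equivalent (fun x => A x /\ ~ N x) (fun x => B x /\ ~ N x) -> equivalent A B.
Proof.
move=> hN [f [f1 [f2 [f3 [f4 f5]]]]] [h [h1 [h2 [h3 [h4 h5]]]]].
exists (fun x => if dec (N x) then f x else h x); split; [|split; [|split; [|split]]].
- by move=> Q HQ; apply: (S_if _ _ _ (fun _ => Q)) => //; [apply: f1 | apply: h1].
- by move=> x; case: (dec _).
- by move=> x a; case: (dec _) => n; [case: (f3 x) | case: (h3 x)].
- move=> x y a b; case: (dec _) => n; case: (dec _) => n' e.
  + exact: f4.
  + by case: (f3 x (conj a n)); rewrite e => _ n1; case: (h3 y (conj b n')).
  + by case: (f3 y (conj b n')); rewrite -e => _ n1; case: (h3 x (conj a n)).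
  + exact: h4.
- move=> y b; case: (classic (N y)) => n.
    by case: (f5 y (conj b n)) => x [[a n'] e]; exists x; split => //; case: (dec _).
  by case: (h5 y (conj b n)) => x [[a n'] e]; exists x; split => //; case: (dec _).
Qed.

(** Off an invariant null set [N], equal densities make the greedy matching of two classes perfect.
    On [N] the coloring [h] is used, all of [N] embedding into each of its classes. *)
Lemma equitable_coloring : (forall x y, E x y -> exists r, reach adj r x y) -> (D < k)%nat ->
  exists f, coloring f /\ forall al be, (al < k)%nat -> (be < k)%nat ->
    equivalent (fun x => f x = al) (fun x => f x = be).
Proof.
move=> reachE Dk; case: (syndetic_coloring reachE Dk) => h [hc [L hL]].
case: (equal_classes h Dk hc) => f [fc feq].
have [fB' [fk' fp']] := fc; have [hB' [hk' hp']] := hc.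
have : ae (fun x => forall al be, (al < k)%nat -> (be < k)%nat ->
    ~ left_rest (fun y => f y = al) (fun y => f y = be) x /\ ~ right_rest (fun y => f y = al) (fun y => f y = be) x).
  have h0 : ae (fun x => forall al be, m (fun y => f y = al) x = m (fun y => f y = be) x ->
      m (left_rest (fun y => f y = al) (fun y => f y = be)) x = 0 /\
      m (right_rest (fun y => f y = al) (fun y => f y = be)) x = 0).
    apply: ae_all => al; apply: ae_all => be.
    case: (m_greedy _ _ (fB' al) (fB' be)) => W; move/ae_mono; apply => x [e1 [e2 [_ [e3 _]]]] e.
    by lra.
  have h1 : ae (fun x => forall al be,
     (m (left_rest (fun y => f y = al) (fun y => f y = be)) x = 0 -> ~ left_rest (fun y => f y = al) (fun y => f y = be) x) /\
     (m (right_rest (fun y => f y = al) (fun y => f y = be)) x = 0 -> ~ right_rest (fun y => f y = al) (fun y => f y = be) x)).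
    apply: ae_all => al; apply: ae_all => be.
    by apply: ae_and; apply: m_zero_null; [apply: left_rest_Bo | apply: right_rest_Bo].
  apply: ae_mono (ae_and _ _ feq (ae_and _ _ h0 h1)) _ => x [k1 [k2 k3]] al be la lb.
  by case: (k3 al be) => h3 h4; case: (k2 al be (k1 al be la lb)); auto.
case/ae_inv_null => N [nN [iN hN]]; have NB : Bo N by case: nN.
pose F x := if dec (N x) then h x else f x.
have FN x : N x -> F x = h x by rewrite /F; case: (dec _).
have FnN x : ~ N x -> F x = f x by rewrite /F; case: (dec _).
exists F; split.
  split; [|split].
  - by move=> j; apply: (S_if _ _ _ (fun _ a => a = j)).
  - by move=> x; rewrite /F; case: (dec _).
  - move=> x y a; case: (classic (N x)) => n.
      by have n' := iN _ _ (adjE _ _ a) n; rewrite !FN //; apply: hp'.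
    by have n' := invariant_not _ iN _ _ (adjE _ _ a) n; rewrite !FnN //; apply: fp'.
move=> al be la lb; apply: (equivalent_glue _ _ N NB).
  have sub ga ga' : (ga < k)%nat -> (ga' < k)%nat -> emb (single (fun x => F x = ga /\ N x)) (single (fun x => F x = ga' /\ N x)).
    move=> lg lg'; apply: (emb_trans _ (single N)).
      by apply: emb_sub => q [e [_ n]].
    apply: (emb_trans _ (single (fun x => h x = ga' /\ N x))).
      by apply: (emb_syndetic N _ L) => // x; apply: hL.
    by apply: emb_sub => q [e [e' n]]; split => //; rewrite FN.
  have FB ga : Bo (fun x => F x = ga) by apply: (S_if _ _ _ (fun _ a => a = ga)).
  by apply: schroeder_bernstein; [bor | bor | apply: sub | apply: sub].
have -> : (fun x => F x = al /\ ~ N x) = (fun x => f x = al /\ ~ N x).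
  by apply: pred_ext => x; split => -[e n]; split => //; rewrite -e FnN.
have -> : (fun x => F x = be /\ ~ N x) = (fun x => f x = be /\ ~ N x).
  by apply: pred_ext => x; split => -[e n]; split => //; rewrite -e FnN.
apply: greedy_equivalent; [exact: fB' | exact: fB' | exact: invariant_not |].
by move=> x n; apply: hN.
Qed.

End Moves.
End DensityTheory.
End Action.

Theorem theorem1p3 (X : Type) (S : (X -> Prop) -> Prop) (adj : X -> X -> Prop)
  (Delta : nat) :
  borel_graph S adj -> aperiodic adj -> degree_le adj Delta ->
  forall k : nat, (Delta + 1 <= k)%nat ->
  exists f : X -> nat, borel_equitable_coloring S adj k f.
Proof.
move=> HG Hap Hdeg k le; have LF := borel_graph_lf S adj Delta HG Hdeg.
have SA : is_sigma_algebra S := lf_sig.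
(* One labelling serves both the group action, at distance 2, and the separation of simultaneous
   moves, at distance 3. *)
case: (finite_coloring (adj := adj) 3) => M [kap [kB [kM kap3]]].
have kap2 x y : reach adj 2 x y -> x <> y -> kap x <> kap y by move=> h; apply: kap3; left.
case: (walk_action kap kB kap2 Hap) => AC Horb.
case: density_exists => m Hm.
have adjE x y : adj x y -> orb (fun n => walk (adj := adj) kap (word n)) x y by move=> a; apply/Horb; apply: rt_step.
have reachE x y : orb (fun n => walk (adj := adj) kap (word n)) x y -> exists r, reach adj r x y.
  move/Horb; elim=> [u v a|u|u v w _ [r h] _ [s h']].
  - by exists 1%nat; apply: reach_adj.
  - by exists 0%nat.
  - by exists (r + s)%nat; apply: reach_trans h h'.
have Dk : (Delta < k)%nat by lia.
case: (equitable_coloring m Hm M kap kB kM kap3 adjE k reachE Dk) => f [[fB [fk fp]] fe].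
exists f; split => // al be la lb; case: (fe al be la lb) => phi [h1 [h2 [h3 [h4 h5]]]].
exists phi; split => //; split => //; split => //; split; last by move=> x _; apply/Horb.
by move=> C HC; apply: S_and; [exact: (fB al) | exact: (h1 C HC)].
Qed.
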